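(* Let $S\subset\mathbb{C}$ be an open horizontal strip and let $u\in WAP(S)$ be a subharmonic almost periodic function in $S$. Then its Fourier-Bohr coefficients are continuous in $\mathrm{Im}\,S$; that is, for every $\lambda\in\mathbb{R}$ the function $$y\mapsto a_\lambda(u,y)=\lim_{T\to\infty}\frac1{2T}\int_{-T}^{T}u(x+iy)e^{-i\lambda x}\,dx$$ is continuous on $\mathrm{Im}\,S$.
   Context: Write $z=x+iy$. An open horizontal strip is a set $S=\{z\in\mathbb{C}: a<\mathrm{Im}\,z<b\}$ with $-\infty\le a<b\le+\infty$; $\mathrm{Im}\,S=\{\mathrm{Im}\,z:z\in S\}$. Subharmonic functions are assumed not identically $-\infty$; they are locally integrable and hence are regarded as distributions. $D(S)$ denotes the space of test functions (smooth, compactly supported in $S$). Uniformly almost periodic (Bohr) function on the real axis: a continuous function $g$ on $\mathbb{R}$ such that from any sequence $\{t_n\}\subset\mathbb{R}$ one can choose a subsequence $\{t_{n'}\}$ for which the functions $g(t+t_{n'})$ converge uniformly on $\mathbb{R}$. $WAP(S)$ (subharmonic almost periodic functions): the class of subharmonic functions $u$ in $S$ such that for every test function $\varphi\in D(S)$ the function $t\mapsto\int u(z)\varphi(z-t)\,dx\,dy$, $t\in\mathbb{R}$, is uniformly almost periodic on the real axis. Functions in $WAP(S)$ are Stepanov almost periodic: from any sequence $\{h_n\}\subset\mathbb{R}$ one can choose a subsequence $\{h_{n'}\}$ and a function $g$ on $S$ such that $\sup_{\alpha\le\mathrm{Im}\,z\le\beta}\int_0^1|u(z+h_{n'}+t)-g(z+t)|\,dt\to0$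 for all $\alpha<\beta$ in $\mathrm{Im}\,S$. In particular $u$ is Stepanov almost periodic on every line $y=\mathrm{const}$ in $S$, so the limits defining the Fourier-Bohr coefficients $a_\lambda(u,y)$, $\lambda\in\mathbb{R}$, $y\in\mathrm{Im}\,S$, exist. *)

(* Defs.v *)
From HB Require Import structures.
From mathcomp Require Import all_boot all_order all_algebra.
From mathcomp Require Import all_classical all_reals all_analysis.
From mathcomp.real_closed Require Export complex.

Set Implicit Arguments.
Unset Strict Implicit.
Unset Printing Implicit Defensive.

Import Order.TTheory GRing.Theory Num.Theory.
Import numFieldNormedType.Exports.

Local Open Scope classical_set_scope.
Local Open Scope complex_scope.
Local Open Scope ring_scope.

(* The domain plane is modelled as R * R, the point z = x + iy being (x, y):
   R * R carries the product topology, the normed R-module structure used for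
   derivatives, and the product sigma-algebra.  Its norm is the max norm, so
   Euclidean discs are written out.  Complex values live in R[i], seen as
   R[i]^o to get the topology of its modulus. *)

Section Strips.
Context {R : realType}.

Definition strip (a b : \bar R) : set (R * R) :=
  [set z | (a < z.2%:E)%E /\ (z.2%:E < b)%E].

Definition im_set (S : set (R * R)) : set R := [set z.2 | z in S].

End Strips.

Section Subharmonic.
Context {R : realType}.

Definition closed_disc (z : R * R) (r : R) : set (R * R) :=
  [set w | (w.1 - z.1) ^+ 2 + (w.2 - z.2) ^+ 2 <= r ^+ 2].

Definition circle_point (z : R * R) (r t : R) : R * R :=
  (z.1 + r * cos t, z.2 + r * sin t).

Definition circle_mean (u : R * R -> \bar R) (z : R * R) (r : R) : \bar R :=
  (((2 * pi)^-1)%:E *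
   \int[lebesgue_measure]_(t in `[0%R, (2 * pi)%R]) u (circle_point z r t))%E.

(* The values of u outside the open set D are irrelevant.  The mean may be -oo;
   its positive part is finite since u is bounded above on the circle.  The
   last clause excludes u = -oo identically. *)
Definition subharmonic (D : set (R * R)) (u : R * R -> \bar R) : Prop :=
  [/\ forall z, D z -> (u z < +oo)%E,
      forall z (c : R), D z -> (u z < c%:E)%E ->
        \forall w \near z, (u w < c%:E)%E,
      forall z r, 0 < r -> closed_disc z r `<=` D ->
        (u z <= circle_mean u z r)%E
    & exists2 z, D z & u z != -oo%E].

End Subharmonic.

Section TestFunctions.
Context {R : realType}.

(* iterated partial derivatives: true stands for d/dx, false for d/dy *)
Definition unit_vector (i : bool) : R * R := if i then (1, 0) else (0, 1).

Definition iter_partial (s : seq bool) (phi : R * R -> R) : R * R -> R :=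
  foldr (fun i g z => 'D_(unit_vector i) g z) phi s.

Definition smooth (phi : R * R -> R) : Prop :=
  forall s : seq bool, continuous (iter_partial s phi) /\
    forall (i : bool) z, derivable (iter_partial s phi) z (unit_vector i).

Definition test_function (S : set (R * R)) (phi : R * R -> R) : Prop :=
  let supp := closure [set z | phi z != 0] in
  [/\ smooth phi, compact supp & supp `<=` S].

End TestFunctions.

Section AlmostPeriodic.
Context {R : realType}.

Definition uniformly_almost_periodic (g : R -> R) : Prop :=
  continuous g /\
  forall t : nat -> R, exists k : nat -> nat, exists h : R -> R,
    {homo k : m n / (m < n)%N} /\
    {uniform, (fun n s => g (s + t (k n))) @ \oo --> h}.

Definition shifted_pairing (S : set (R * R)) (u : R * R -> \bar R)
    (phi : R * R -> R) (t : R) : R :=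
  fine (\int[(lebesgue_measure \x lebesgue_measure)%E]_(z in S)
          (u z * (phi (z.1 - t, z.2))%:E))%E.

Definition WAP (S : set (R * R)) (u : R * R -> \bar R) : Prop :=
  subharmonic S u /\
  forall phi, test_function S phi ->
    uniformly_almost_periodic (shifted_pairing S u phi).

End AlmostPeriodic.

Section FourierBohr.
Context {R : realType}.

(* exp (i t) *)
Definition cis (t : R) : R[i] := cos t +i* sin t.

Definition complex_integral (D : set R) (f : R -> R[i]) : R[i] :=
  (\int[lebesgue_measure]_(x in D) complex.Re (f x))%R +i*
  (\int[lebesgue_measure]_(x in D) complex.Im (f x))%R.

(* fine (-oo) = 0; fourier_bohr_exists makes u finite almost everywhere on the
   line, where this convention then plays no role. *)
Definition fourier_mean (u : R * R -> \bar R) (lam y T : R) : R[i]^o :=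
  ((2 * T)^-1)%:C *
  complex_integral `[- T, T]
    (fun x => (fine (u (x, y)))%:C * cis (- (lam * x))).

Definition fourier_bohr (u : R * R -> \bar R) (lam y : R) : R[i]^o :=
  lim (fourier_mean u lam y T @[T --> +oo]).

Definition fourier_bohr_exists (u : R * R -> \bar R) (lam y : R) : Prop :=
  (forall T : R, 0 < T ->
     lebesgue_measure.-integrable `[- T, T] (fun x => u (x, y))) /\
  cvg (fourier_mean u lam y T @[T --> +oo]).

End FourierBohr.

(* Main.v *)
From HB Require Import structures.
Require Import Defs.
From mathcomp Require Import all_boot all_order all_algebra.
From mathcomp Require Import all_classical all_reals all_analysis.
From mathcomp Require Import measurable_realfun ring lra.
From mathcomp Require finmap.
Import Order.TTheory GRing.Theory Num.Theory.
Import numFieldNormedType.Exports.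
Local Open Scope classical_set_scope.
Local Open Scope ring_scope.

Set Implicit Arguments.
Unset Strict Implicit.
Unset Printing Implicit Defensive.

(** Fix a height [y0] and a small [del]. On the slab [|y - y0| <= 4 del] write
    [u = M - f]. If the constant [M] can be taken large enough for the whole slab, then
    [f >= 0], and the means of [u] along a line are those of [f] up to the mean of a
    cosine.

    Such an [M] exists ([slab_upper_bound]). The values of [u] are dominated by its
    pairings with radial bumps, by the sub-mean-value inequality. If these pairings were
    unbounded over the slab, a gliding hump ([gliding_hump]) would combine vertically
    displaced bumps into one test function whose pairings with the translates of [u] are
    unbounded, contrary to almost periodicity.

    The values of [f] on a line are replaced by its layers, the integrals
    [N t y] of [f (x, y)] against a smooth window of radius [r] centred at [x = t].

    - In [y] the layers inherit the mean inequality of the superharmonic function [f],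
      with a loss factor [1 - K rho ^ 2 / 2] because a window is not convex but only
      semiconvex ([hat_semiconvex], [slice_supermean]). For nonnegative functions of one
      variable such an inequality implies a Harnack inequality
      ([supermean_comparison], [layer_harnack]). So the layers are bounded
      ([layer_bound]) and Lipschitz in [y] ([layer_lipschitz]), uniformly in [t].

    - In [t] the layers, averaged over a short interval of heights, are pairings of [u]
      with the translates of a product of two windows ([uap_layer_mean]), hence almost
      periodic. By the Lipschitz bound the layers themselves are uniform limits of
      almost periodic functions, and have means against every cosine
      ([layer_equimean], [equimean_cvg]).

    Convolution with the window multiplies [cos (lam x + th)] by a constant [ch], which
    is positive if [|lam| r < 1] ([cosine_mass], [cosine_smear]). For a nonnegative
    weight [w] with convolution [w'], Tonelli's theorem shows that the integrals of
    [N w] and of [f w'] over [[- T, T]] differ by a bounded amount ([smear_mean]). With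
    [w = 1] and [w = 1 + cos] this yields the integrability of [f] on the line, and its
    means against cosines, as those of the layers divided by [ch] ([mean_line]). These
    are Lipschitz in [y] because the layers are. *)

(** * Rotations and translations of the plane *)

Section PlaneMeasure.
Context {R : realType}.
Local Notation mu := (@lebesgue_measure R).
Local Notation mu2 := (mu \x mu)%E.

Lemma lebesgue_measureD (c : R) (A : set R) : measurable A ->
  pushforward mu ((fun x : R => x + c) : _ -> measurableTypeR R) A = mu A.
Proof.
move=> mA.
have mf : measurable_fun setT (fun x : measurableTypeR R => (x + c : measurableTypeR R)).
  exact: measurable_funD.
pose f : {mfun measurableTypeR R >-> measurableTypeR R} :=
  HB.pack (fun x : measurableTypeR R => (x + c : measurableTypeR R))
    (isMeasurableFun.Build _ _ _ _ _ mf).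
rewrite -[pushforward _ _]/(pushforward mu f).
apply/esym/lebesgue_measure_unique => //= _ [[a b]] _ <-.
rewrite /pushforward (_ : _ @^-1` _ = `]a - c, b - c]%classic); last first.
  by apply/seteqP; split => x /=; rewrite !in_itv/= lerBrDr ltrBlDr.
rewrite !lebesgue_measure_itv/= !lte_fin ltrD2r.
by case: ifP => // _; rewrite -!EFinB; congr EFin; ring.
Qed.

Lemma ge0_integralDx (f : R -> \bar R) (c : R) : measurable_fun [set: R] f ->
  (forall x, (0 <= f x)%E) ->
  (\int[mu]_x f (x + c)%R = \int[mu]_x f x)%E.
Proof.
move=> mf f0.
have mphi : measurable_fun setT (fun x : measurableTypeR R => (x + c : measurableTypeR R)).
  exact: measurable_funD.
have := @ge0_integral_pushforward _ _ _ _ R _ mphi mu setT f measurableT mf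
  (fun x _ => f0 x).
rewrite preimage_setT => H; apply: (eq_trans (esym H)).
by apply: eq_measure_integral => //= A mA AS; exact/lebesgue_measureD.
Qed.

Lemma ge0_integralNx (f : R -> \bar R) : measurable_fun [set: R] f ->
  (forall x, (0 <= f x)%E) ->
  (\int[mu]_x f (- x)%R = \int[mu]_x f x)%E.
Proof.
move=> mf f0.
have mphi : measurable_fun setT (fun x : measurableTypeR R => (- x : measurableTypeR R)).
  exact: measurable_funN.
have := @ge0_integral_pushforward _ _ _ _ R _ mphi mu setT f measurableT mf
  (fun x _ => f0 x).
rewrite preimage_setT => H; apply: (eq_trans (esym H)).
by apply: eq_measure_integral => //= A mA AS; exact/lebesgue_measureN.
Qed.

Lemma measurable_shear1 (c d : R) :
  measurable_fun setT (fun z : R * R => (z.1 + c * z.2 + d, z.2)).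
Proof.
apply: measurable_fun_pair => //.
apply: measurable_funD => //; apply: measurable_funD => //.
exact: measurable_funM.
Qed.

Lemma measurable_shear2 (c d : R) :
  measurable_fun setT (fun z : R * R => (z.1, z.2 + c * z.1 + d)).
Proof.
apply: measurable_fun_pair => //.
apply: measurable_funD => //; apply: measurable_funD => //.
exact: measurable_funM.
Qed.

Lemma ge0_integral_shear1 (g : R * R -> \bar R) (c d : R) :
  measurable_fun setT g -> (forall z, (0 <= g z)%E) ->
  (\int[mu2]_z g (z.1 + c * z.2 + d, z.2)%R = \int[mu2]_z g z)%E.
Proof.
move=> mg g0; rewrite !fubini_tonelli2//; last first.
  exact: (measurableT_comp mg (measurable_shear1 c d)).
apply: eq_integral => y _; rewrite /fubini_G/=.
under eq_integral do rewrite -addrA.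
move: (@ge0_integralDx (fun x => g (x, y)) (c * y + d)) => /=.
apply => //.
exact: measurableT_comp mg (pair2_measurable y).
Qed.

Lemma ge0_integral_shear2 (g : R * R -> \bar R) (c d : R) :
  measurable_fun setT g -> (forall z, (0 <= g z)%E) ->
  (\int[mu2]_z g (z.1, z.2 + c * z.1 + d)%R = \int[mu2]_z g z)%E.
Proof.
move=> mg g0; rewrite !fubini_tonelli1//; last first.
  exact: (measurableT_comp mg (measurable_shear2 c d)).
apply: eq_integral => x _; rewrite /fubini_F/=.
under eq_integral do rewrite -addrA.
move: (@ge0_integralDx (fun y => g (x, y)) (c * x + d)) => /=.
apply => //.
exact: measurableT_comp mg (pair1_measurable x).
Qed.

Definition rot (c s : R) (z : R * R) := (c * z.1 - s * z.2, s * z.1 + c * z.2).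

Lemma measurable_rot (c s : R) : measurable_fun setT (rot c s).
Proof.
by apply: measurable_fun_pair => //;
  [apply: measurable_funB|apply: measurable_funD]; exact: measurable_funM.
Qed.

(** A rotation other than the half turn is a product of three shears. *)
Let ge0_integral_rot_shears (g : R * R -> \bar R) (c s : R) :
  c ^+ 2 + s ^+ 2 = 1 -> c != -1 ->
  measurable_fun setT g -> (forall z, (0 <= g z)%E) ->
  (\int[mu2]_z g (rot c s z) = \int[mu2]_z g z)%E.
Proof.
move=> cs c1 mg g0.
  have c1' : 1 + c != 0 by rewrite addrC -(opprK 1) subr_eq0.
  pose t := s / (1 + c).
  have sE : s = t * (1 + c) by rewrite /t; field.
  have st : 1 - t * s = c.
    rewrite /t; apply/eqP; rewrite -subr_eq0; apply/eqP.
    transitivity ((1 - (c ^+ 2 + s ^+ 2)) / (1 + c)); first by field.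
    by rewrite cs subrr mul0r.
  rewrite -(@ge0_integral_shear1 g (- t) 0)//.
  rewrite -(@ge0_integral_shear2 (fun z => g (z.1 + - t * z.2 + 0, z.2)) s 0)//.
  rewrite -(@ge0_integral_shear1 (fun z => (fun z => g (z.1 + - t * z.2 + 0, z.2)) (z.1, z.2 + s * z.1 + 0)) (- t) 0)//.
    apply: eq_integral => -[x y] _ /=; congr g; rewrite /rot/= !addr0 !mulNr.
    have cx := congr1 ( *%R^~ x) st.
    have cy := congr1 ( *%R^~ y) st.
    have s2 : s * y = (2 * t - t * t * s) * y by rewrite {1}sE -st; ring.
    by congr pair; lra.
  have -> : (fun z : R * R => (fun z => g (z.1 + - t * z.2 + 0, z.2)) (z.1, z.2 + s * z.1 + 0)) = (g \o (fun z : R * R => (z.1 + -t * z.2 + 0, z.2))) \o (fun z : R * R => (z.1, z.2 + s * z.1 + 0)) by [].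
  have m := @measurableT_comp _ _ _ _ _ _ _ _ _ (measurableT_comp mg (measurable_shear1 (-t) 0)) (measurable_shear2 s 0).
  exact: m.
  exact: (measurableT_comp mg (measurable_shear1 (-t) 0)).
Qed.

Lemma ge0_integral_rot (g : R * R -> \bar R) (c s : R) : c ^+ 2 + s ^+ 2 = 1 ->
  measurable_fun setT g -> (forall z, (0 <= g z)%E) ->
  (\int[mu2]_z g (rot c s z) = \int[mu2]_z g z)%E.
Proof.
have [-> + mg g0|c1 cs] := eqVneq c (-1); last exact: ge0_integral_rot_shears.
(* The half turn is the square of a quarter turn. *)
rewrite sqrrN expr1n => s1; have /eqP : s ^+ 2 = 0 by lra.
rewrite sqrf_eq0 => /eqP ->.
have q : (0 : R) ^+ 2 + 1 ^+ 2 = 1 by rewrite expr0n expr1n add0r.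
have q0 : (0 : R) != -1 by rewrite eq_sym oppr_eq0 oner_eq0.
rewrite -(ge0_integral_rot_shears q q0 mg g0).
rewrite -(ge0_integral_rot_shears q q0 (measurableT_comp mg (measurable_rot 0 1))); last first.
  by move=> z; exact: g0.
apply: eq_integral => -[x y] _ /=; congr g; rewrite /rot/=.
by congr pair; ring.
Qed.

Lemma ge0_integral_translate2 (g : R * R -> \bar R) (w : R * R) :
  measurable_fun setT g -> (forall z, (0 <= g z)%E) ->
  (\int[mu2]_z g (z.1 + w.1, z.2 + w.2)%R = \int[mu2]_z g z)%E.
Proof.
move=> mg g0; rewrite -(ge0_integral_shear1 0 w.1 mg g0).
rewrite -(ge0_integral_shear2 0 w.2
  (measurableT_comp mg (measurable_shear1 0 w.1))); last first.
  by move=> z; exact: g0.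
by apply: eq_integral => -[x y] _ /=; rewrite !mul0r !addr0.
Qed.

Lemma ge0_integral_period_shift (g : R -> \bar R) (p c : R) :
  measurable_fun [set: R] g -> (forall x, (0 <= g x)%E) ->
  (forall x, g (x + p) = g x) -> 0 <= c <= p ->
  (\int[mu]_(x in `[0%R, p]) g (x + c)%R = \int[mu]_(x in `[0%R, p]) g x)%E.
Proof.
move=> mg g0 gp /andP[c0 cp].
have mgc d : measurable_fun [set: R] (fun x => g (x + d)).
  by apply: measurableT_comp => //; exact: measurable_funD.
have sh (a b d : R) : (\int[mu]_(x in `]a, b]) g (x + d)%R =
    \int[mu]_(x in `](a + d)%R, (b + d)%R]) g x)%E.
  rewrite integral_mkcond [RHS]integral_mkcond.
  rewrite -[RHS](ge0_integralDx d)/=; last 2 first.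
  - by apply/(measurable_restrictT _ _).1 => //; exact: measurable_funTS.
  - by move=> x; apply: erestrict_ge0.
  apply: eq_integral => x _; rewrite /patch !mem_setE !in_itv/= lerD2r ltrD2r//.
rewrite -!integral_itv_obnd_cbnd; do ?exact: measurable_funTS.
rewrite sh add0r.
have U (x y z : R) : x <= y -> y <= z -> (\int[mu]_(t in `]x, z]) g t =
   \int[mu]_(t in `]x, y]) g t + \int[mu]_(t in `]y, z]) g t)%E.
  move=> xy yz; rewrite -ge0_integral_setU//.
  - by rewrite -itv_bndbnd_setU.
  - exact: measurable_funTS.
  - apply/disj_setPS => t [] /=; rewrite !in_itv/= => /andP[_ ty] /andP[yt _].
    by move: (lt_le_trans yt ty); rewrite ltxx.
have c1 : p <= p + c by rewrite lerDl.
rewrite (U c p (p + c) cp c1) (U 0 c p c0 cp) addeC; congr (_ + _)%E.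
transitivity (\int[mu]_(t in `](0 + p)%R, (c + p)%R]) g t)%E.
  by rewrite add0r addrC.
rewrite -sh; apply: eq_integral => x _.
by rewrite gp.
Qed.

(** Averaging the rotations of a plane point over a full turn gives the mean over
    the circle through this point, whatever its argument. *)
Lemma circle_rotation (r t x : R) :
  rot (cos t) (sin t) (r * cos x, r * sin x) = (r * cos (x + t), r * sin (x + t)).
Proof. by rewrite /rot/= cosD sinD; congr pair; ring. Qed.

Lemma polar_form (w : R * R) : exists r t : R, [/\ 0 <= r, 0 <= t <= 2 * pi &
  w = (r * cos t, r * sin t)].
Proof.
pose r := Num.sqrt (w.1 ^+ 2 + w.2 ^+ 2).
have r2 : r ^+ 2 = w.1 ^+ 2 + w.2 ^+ 2.
  by rewrite sqr_sqrtr// addr_ge0 ?sqr_ge0.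
have [r0|r0] := eqVneq r 0.
  have p0 : 0 <= (pi : R) := pi_ge0 R.
  exists 0, 0; split => //; first by rewrite lexx mulr_ge0.
  move: r2; rewrite r0 expr0n/= => /esym/eqP; rewrite paddr_eq0 ?sqr_ge0//.
  rewrite !sqrf_eq0 => /andP[/eqP w1 /eqP w2].
  by rewrite !mul0r [w]surjective_pairing w1 w2.
have rp : 0 < r by rewrite lt_def r0 sqrtr_ge0.
pose c := w.1 / r.
have wc : w.1 = r * c by rewrite /c; field.
have w2 : w.2 ^+ 2 = r ^+ 2 * (1 - c ^+ 2).
  have -> : w.2 ^+ 2 = r ^+ 2 - w.1 ^+ 2 by rewrite r2; ring.
  by rewrite wc; ring.
have c1 : -1 <= c <= 1.
  rewrite -ler_norml -(ler_sqr _)// ?nnegrE// expr1n real_normK ?num_real//.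
  rewrite -subr_ge0 -(pmulr_rge0 _ (exprn_gt0 2 rp)) -w2; exact: sqr_ge0.
have sa : r * sin (acos c) = `|w.2|.
  rewrite sin_acos// -[RHS]sqrtr_sqr w2 sqrtrM ?sqr_ge0// sqrtr_sqr ger0_norm//.
  exact: ltW.
have a0 := acos_ge0 c1; have ap := acos_lepi c1.
case: (leP 0 w.2) => w20.
  exists r, (acos c); split; first exact: ltW.
    by rewrite a0/=; lra.
  by rewrite acosK// sa ger0_norm// -wc -surjective_pairing.
exists r, (2 * pi - acos c); split; first exact: ltW.
  by apply/andP; split; lra.
have e t : cos (2 * pi - t) = cos t :> R.
  by rewrite -cosN opprB -(@cosD2pi _ (t - _)) mulr_natl subrK.
have e2 t : sin (2 * pi - t) = - sin t :> R.
  by rewrite -sinN -(sinD2pi (- t)); congr sin; ring.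
rewrite e e2 acosK// mulrN sa ltr0_norm// opprK -wc.
exact: surjective_pairing.
Qed.

End PlaneMeasure.

(** * Boxes and Borel sets of the plane *)

Section OpenSets.
Context {R : realType}.

Definition box (p : R * R) (r : R) : set (R * R) :=
  [set z | `|z.1 - p.1| <= r /\ `|z.2 - p.2| <= r].

Lemma boxE p r : box p r = `[p.1 - r, p.1 + r] `*` `[p.2 - r, p.2 + r].
Proof.
by apply/seteqP; split => z; rewrite /box/= !in_itv/= !ler_distl => -[].
Qed.

Lemma measurable_box p r : measurable (box p r).
Proof. by rewrite boxE; apply: measurableX. Qed.

Lemma compact_box p r : compact (box p r).
Proof. by rewrite boxE; apply: compact_setX; exact: segment_compact. Qed.

Lemma nbhs_boxP (z : R * R) (A : set (R * R)) :
  nbhs z A <-> exists2 r, 0 < r & box z r `<=` A.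
Proof.
split => [/nbhs_ballP[e /= e0 eA]|[r r0 rA]].
  exists (e / 2); first by rewrite divr_gt0.
  move=> w [w1 w2]; apply: eA; split => /=; rewrite /ball/= distrC.
  - by apply: (le_lt_trans w1); lra.
  - by apply: (le_lt_trans w2); lra.
apply/nbhs_ballP; exists r => //= w [] /=; rewrite /ball/= => w1 w2; apply: rA.
by split; rewrite distrC ltW.
Qed.

(** An open set is the countable union of the open squares with rational centre and
    rational size that it contains. *)
Lemma open_measurable2 (A : set (R * R)) : open A -> measurable A.
Proof.
move=> oA.
pose B (q1 q2 q3 : rat) := let b : set (R * R) :=
  (`]ratr q1 - ratr q3, ratr q1 + ratr q3[%classic `*`
   `]ratr q2 - ratr q3, ratr q2 + ratr q3[%classic) in
  if asbool (b `<=` A) then b else set0.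
rewrite (_ : A = \bigcup_q1 \bigcup_q2 \bigcup_q3 B q1 q2 q3); last first.
  apply/seteqP; split => [z Az|z [q1 _ [q2 _ [q3 _]]]]; last first.
    by rewrite /B; case: asboolP => // bA /bA.
  have [r r0 rA] := (nbhs_boxP _ _).1 (open_nbhs_nbhs (conj oA Az)).
  have /rat_in_itvoo[q3] : r / 4 < r / 2 by lra.
  rewrite in_itv/= => /andP[q3l q3r].
  have /rat_in_itvoo[q1] : z.1 - ratr q3 < z.1 by lra.
  rewrite in_itv/= => /andP[q1l q1r].
  have /rat_in_itvoo[q2] : z.2 - ratr q3 < z.2 by lra.
  rewrite in_itv/= => /andP[q2l q2r].
  exists q1 => //; exists q2 => //; exists q3 => //; rewrite /B.
  case: asboolP => [_|]; first by split => /=; rewrite in_itv/=; lra.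
  case => w [] /=; rewrite !in_itv/= => w1 w2; apply: rA; split;
  rewrite ler_distl; lra.
do 3 (apply: bigcupT_measurable_rat => ?).
rewrite /B; case: ifP => // _; exact: measurableX.
Qed.

Lemma continuous_measurable2 (f : R * R -> R) : continuous f -> measurable_fun setT f.
Proof.
move=> cf; apply: (measurability _ (RGenOInfty.measurableE R)) => /= _ [_ [a ->] <-].
rewrite setTI; apply: open_measurable2.
by apply: open_comp => // z _; exact: cf.
Qed.

End OpenSets.

(** * Subharmonic functions and their gap to an upper bound *)

Section Subharmonic.
Context {R : realType}.
Local Notation mu := (@lebesgue_measure R).
Local Notation mu2 := (mu \x mu)%E.
Variables (S : set (R * R)) (u : R * R -> \bar R).
Hypotheses (oS : open S) (su : subharmonic S u).

Lemma open_sublevel (c : R) : open (S `&` [set z | (u z < c%:E)%E]).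
Proof.
rewrite openE => z [Sz uz]; apply: filterI; first exact: open_nbhs_nbhs.
by case: su => _ h _ _; exact: h.
Qed.

Lemma measurable_subharmonic : measurable_fun S u.
Proof.
move=> mS; apply: (measurability _ (ErealGenInftyO.measurableE R)) => //.
move=> /= _ [_ [a ->] <-]; rewrite (_ : _ `&` _ = S `&` [set z | (u z < a%:E)%E]).
  by apply: open_measurable2; exact: open_sublevel.
by apply/seteqP; split => z [Sz]; rewrite /= in_itv/=.
Qed.

Lemma subharmonic_ub (K : set (R * R)) : compact K -> K `<=` S ->
  exists M : R, forall z, K z -> (u z <= M%:E)%E.
Proof.
move=> /compact_near_coveringP cK KS.
have [N _ /(_ N (leqnn N)) h] : \forall n \near \oo, K `<=` (fun z => (u z < n%:R%:E)%E).
  apply: cK => z Kz; have Sz := KS _ Kz.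
  have [n un] : exists n : nat, (u z < n%:R%:E)%E.
    case: su => /(_ z Sz) uz _ _ _.
    case E : (u z) uz => [r||]// _; last by exists 0%N; rewrite ltNyr.
    exists (Num.bound `|r|); rewrite lte_fin.
    exact: le_lt_trans (ler_norm r) (archi_boundP (normr_ge0 r)).
  exists (S `&` (fun w => (u w < n%:R%:E)%E), [set m | (n <= m)%N]).
    split; last by exists n.
    by apply: open_nbhs_nbhs; split; [exact: open_sublevel|split].
  move=> [w m] /= [[_ uw] nm]; apply: (lt_le_trans uw).
  by rewrite lee_fin ler_nat.
by exists N%:R => z Kz; exact/ltW/h.
Qed.

(** The value [0] off [K] makes [M - u] a nonnegative measurable function on the whole
    plane, to which the theorems of Tonelli and Fatou apply before anything is known
    about integrability. *)
Definition gap (K : set (R * R)) (M : R) : R * R -> \bar R :=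
  (fun z => M%:E - u z)%E \_ K.

Lemma gapE K M z : K z -> gap K M z = (M%:E - u z)%E.
Proof. by move=> Kz; rewrite /gap patchE mem_set. Qed.

Lemma gap_out K M z : ~ K z -> gap K M z = 0%E.
Proof. by move=> Kz; rewrite /gap patchE memNset. Qed.

Section gap.
Variables (K : set (R * R)) (M : R).
Hypotheses (mK : measurable K) (KS : K `<=` S)
  (uM : forall z, K z -> (u z <= M%:E)%E).

Lemma measurable_gap : measurable_fun setT (gap K M).
Proof.
apply/(measurable_restrictT _ _).1 => //; apply: emeasurable_funB => //.
apply: measurable_funS measurable_subharmonic => //; exact: open_measurable2.
Qed.

Lemma gap_ge0 z : (0 <= gap K M z)%E.
Proof.
have [Kz|Kz] := pselect (K z); last by rewrite gap_out.
by rewrite gapE// sube_ge0 ?uM// orbT.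
Qed.

Lemma measurable_circle_point (z : R * R) (r : R) :
  measurable_fun [set: R] (circle_point z r).
Proof.
by apply: measurable_fun_pair; apply: measurable_funD => //;
  apply: measurable_funM => //; apply: continuous_measurable_fun;
  [exact: continuous_cos|exact: continuous_sin].
Qed.

Lemma closed_disc_circle (z : R * R) (r t : R) : closed_disc z r (circle_point z r t).
Proof.
rewrite /closed_disc/circle_point/= ![_ + _ - _]addrAC !subrr !add0r !exprMn -mulrDr.
by rewrite cos2Dsin2 mulr1.
Qed.

Lemma supermean_gap z r : 0 < r -> closed_disc z r `<=` K ->
  (\int[mu]_(t in `[0%R, (2 * pi)%R]) gap K M (circle_point z r t) <=
   (2 * pi)%:E * gap K M z)%E.
Proof.
move=> r0 zrK.
have pi0 : 0 < 2 * pi :> R by rewrite mulr_gt0// pi_gt0.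
have Kz : K z by apply: zrK; rewrite /closed_disc/= !subrr !expr0n/= addr0 sqr_ge0.
have Kc t : K (circle_point z r t) by apply: zrK; exact: closed_disc_circle.
have mc : measurable_fun `[0, 2 * pi] (fun t => u (circle_point z r t)).
  have mSu := measurable_subharmonic.
  have h : measurable_fun setT (fun t => u (circle_point z r t)).
    apply: (@measurable_comp _ _ _ _ _ _ S) => //.
    - exact: open_measurable2.
    - by move=> _ [t _ <-]; exact/KS/Kc.
    - exact: measurable_circle_point.
  exact: measurable_funTS.
case: su => _ _ /(_ z r r0 (subset_trans zrK KS)) uz _.
rewrite (gapE _ Kz).
case E : (u z) => [x||]; last 2 first.
- by have := uM Kz; rewrite E.
- by rewrite /= mulry gtr0_sg// mul1e leey.
have mI : (mu `[0%R, (2 * pi)%R]%classic = (2 * pi)%:E)%E.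
  by rewrite lebesgue_measure_itv/= lte_fin pi0 oppr0 adde0.
have Ic : mu.-integrable `[0, 2 * pi] (cst M%:E).
  by apply/integrableP; split => //; rewrite integral_cst//= mI -EFinM ltry.
(* A finite value at the centre forces integrability on the circle: the circle mean is
   then not [-oo], and [u] is bounded above. *)
have Ii : mu.-integrable `[0, 2 * pi] (fun t => u (circle_point z r t)).
  apply/integrableP; split => //.
  have p_fin : (\int[mu]_(t in `[0%R, (2 * pi)%R])
      (fun t => u (circle_point z r t))^\+ t < +oo)%E.
    apply: (@le_lt_trans _ _ (\int[mu]_(t in `[0%R, (2 * pi)%R]) `|M|%:E)%E); last first.
      by rewrite integral_cst//= mI -EFinM ltry.
    apply: ge0_le_integral => //; first exact: measurable_funepos.
    move=> t _; rewrite funeposE maxEle; case: ifPn => _; first by rewrite lee_fin.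
    by apply: (le_trans (uM (Kc t))); rewrite lee_fin ler_norm.
  have n_fin : (\int[mu]_(t in `[0%R, (2 * pi)%R])
      (fun t => u (circle_point z r t))^\- t < +oo)%E.
    move: uz; rewrite E /circle_mean integralE.
    have pf : (\int[mu]_(t in `[0%R, (2 * pi)%R])
      (fun t => u (circle_point z r t))^\+ t \is a fin_num)%E.
      by rewrite ge0_fin_numE//; exact: integral_ge0.
    rewrite -(fineK pf) ltey; apply: contraPneq => ->.
    by rewrite /= mulrNy gtr0_sg ?invr_gt0// mul1e.
  have -> : (fun t => `|u (circle_point z r t)|)%E =
    (abse \o (fun t => u (circle_point z r t))) by [].
  rewrite fune_abse.
  rewrite ge0_integralD//; [exact: lte_add_pinfty|exact: measurable_funepos|exact: measurable_funeneg].
under eq_integral do rewrite gapE//.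
rewrite integralB// integral_cst//= mI.
move: uz; rewrite E /circle_mean -(fineK (integrable_fin_num _ Ii))//.
rewrite -EFinM lee_fin -!EFinB -!EFinM lee_fin mulrC ler_pdivlMr//; lra.
Qed.

End gap.
End Subharmonic.

(** * Area means *)

Section Tonelli3.
Context {R : realType}.
Local Notation mu := (@lebesgue_measure R).
Local Open Scope ereal_scope.

Lemma tonelli3 (G : R * (R * R) -> \bar R) :
  measurable_fun setT G -> (forall a, 0 <= G a) ->
  \int[mu]_t \int[mu \x mu]_w G (t, w) = \int[mu \x mu]_w \int[mu]_t G (t, w).
Proof.
move=> mG G0.
have m12 : measurable_fun setT (fun a : (R * R) * R => G (a.1.1, (a.1.2, a.2))).
  apply: (measurableT_comp mG); apply: measurable_fun_pair.
    exact: measurableT_comp.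
  by apply: measurable_fun_pair => //; exact: measurableT_comp.
have mt t : measurable_fun setT (fun w => G (t, w)).
  exact: measurableT_comp mG (pair1_measurable t).
have mx x : measurable_fun setT (fun a : R * R => G (a.1, (x, a.2))).
  apply: (measurableT_comp mG); apply: measurable_fun_pair => //.
  by apply: measurable_fun_pair => //.
transitivity (\int[mu]_t \int[mu]_x \int[mu]_y G (t, (x, y))).
  apply: eq_integral => t _.
  by rewrite fubini_tonelli1 //; exact: mt.
transitivity (\int[mu]_x \int[mu]_t \int[mu]_y G (t, (x, y))).
  apply: (@fubini_tonelli _ _ _ _ R mu mu (fun a : R * R => \int[mu]_y G (a.1, (a.2, y)))).
    exact: (@measurable_fun_fubini_tonelli_F _ _ _ _ R mu (fun a : (R * R) * R => G (a.1.1, (a.1.2, a.2)))).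
  by move=> a; exact: integral_ge0.
rewrite [RHS]fubini_tonelli1 /=; last 2 first.
- exact: (@measurable_fun_fubini_tonelli_G _ _ _ _ R mu G).
- by move=> a; exact: integral_ge0.
apply: eq_integral => x _.
by apply: (@fubini_tonelli _ _ _ _ R mu mu (fun a : R * R => G (a.1, (x, a.2)))) => //; exact: mx.
Qed.

End Tonelli3.

Section AreaMean.
Context {R : realType}.
Local Notation mu := (@lebesgue_measure R).
Local Notation mu2 := (mu \x mu)%E.

(** Rotating the variable of integration and averaging over the angle turns the
    circle means into an area mean without a change to polar coordinates. *)
Lemma area_supermean (f : R * R -> \bar R) (om : R -> R) (z : R * R) (d : R) :
  measurable_fun setT f -> (forall w, (0 <= f w)%E) ->
  measurable_fun setT om -> (forall q, 0 <= om q) -> 0 < d ->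
  (forall q, d ^+ 2 < q -> om q = 0) ->
  (forall r, 0 < r -> r <= d ->
    (\int[mu]_(t in `[0%R, (2 * pi)%R]) f (circle_point z r t) <=
     (2 * pi)%:E * f z)%E) ->
  (\int[mu2]_w ((om (w.1 ^+ 2 + w.2 ^+ 2))%:E * f (z.1 + w.1, z.2 + w.2)%R) <=
   f z * \int[mu2]_w (om (w.1 ^+ 2 + w.2 ^+ 2))%:E)%E.
Proof.
move=> mf f0 mom om0 d0 omd fz.
pose W := (\int[mu2]_w (om (w.1 ^+ 2 + w.2 ^+ 2))%:E)%E.
pose Om (w : R * R) := (om (w.1 ^+ 2 + w.2 ^+ 2))%:E.
have mq : measurable_fun setT (fun w : R * R => w.1 ^+ 2 + w.2 ^+ 2).
  by apply: measurable_funD; apply: measurable_funX.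
have mOm : measurable_fun setT Om.
  by apply/measurable_EFinP; exact: measurableT_comp mom mq.
have Om0 w : (0 <= Om w)%E by rewrite lee_fin.
have mt : measurable_fun setT (fun w : R * R => (z.1 + w.1, z.2 + w.2)).
  by apply: measurable_fun_pair; apply: measurable_funD.
pose g w := (Om w * f (z.1 + w.1, z.2 + w.2)%R)%E.
have mg : measurable_fun setT g.
  by apply: emeasurable_funM => //; exact: measurableT_comp mf mt.
have g0 w : (0 <= g w)%E by exact: mule_ge0.
have pi0 : 0 < 2 * pi :> R by rewrite mulr_gt0// pi_gt0.
have mI : (mu `[0%R, (2 * pi)%R]%classic = (2 * pi)%:E)%E.
  by rewrite lebesgue_measure_itv/= lte_fin pi0 oppr0 adde0.
have mrot : measurable_fun setT (fun a : R * (R * R) => rot (cos a.1) (sin a.1) a.2).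
  have mcos : measurable_fun setT (fun a : R * (R * R) => cos a.1).
    by apply: measurableT_comp => //; apply: continuous_measurable_fun; exact: continuous_cos.
  have msin : measurable_fun setT (fun a : R * (R * R) => sin a.1).
    by apply: measurableT_comp => //; apply: continuous_measurable_fun; exact: continuous_sin.
  have m1 : measurable_fun setT (fun a : R * (R * R) => a.2.1) by exact: measurableT_comp.
  have m2 : measurable_fun setT (fun a : R * (R * R) => a.2.2) by exact: measurableT_comp.
  by apply: measurable_fun_pair; [apply: measurable_funB|apply: measurable_funD];
    exact: measurable_funM.
have key : ((2 * pi)%:E * \int[mu2]_w g w <= (2 * pi)%:E * (f z * W))%E.
  have -> : ((2 * pi)%:E * \int[mu2]_w g w =
    \int[mu]_(t in `[0%R, (2 * pi)%R]) \int[mu2]_w g (rot (cos t) (sin t) w))%E.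
    have h t := ge0_integral_rot (cos2Dsin2 t) mg g0.
    under [RHS]eq_integral do rewrite h.
    by rewrite integral_cst// muleC; congr (_ * _)%E; exact: (esym mI).
  pose I : set R := `[0, 2 * pi]%classic.
  pose G (a : R * (R * R)) := ((\1_I a.1)%:E * g (rot (cos a.1) (sin a.1) a.2))%E.
  have mG : measurable_fun setT G.
    apply: emeasurable_funM; last exact: measurableT_comp mg mrot.
    have mI1 : measurable_fun setT (\1_I : R -> R).
      by apply: measurable_indic; exact: measurable_itv.
    by apply/measurable_EFinP; exact: measurableT_comp.
  have G0 a : (0 <= G a)%E by apply: mule_ge0 => //; rewrite lee_fin.
  have -> : (\int[mu]_(t in `[0%R, (2 * pi)%R]) \int[mu2]_w g (rot (cos t) (sin t) w)
     = \int[mu]_t \int[mu2]_w G (t, w))%E.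
    rewrite integral_mkcond; apply: eq_integral => t _; rewrite patchE /G/=.
    case: ifPn => tI; first by under [RHS]eq_integral do rewrite indicE tI mul1e.
    by under eq_integral do rewrite indicE (negbTE tI) mul0e; rewrite integral0.
  have GFT := tonelli3 mG G0.
  rewrite GFT.
  have -> : ((2 * pi)%:E * (f z * W) = \int[mu2]_w ((2 * pi)%:E * f z * Om w))%E.
    rewrite ge0_integralZl// ?muleA//.
    by rewrite mule_ge0// lee_fin ltW.
  apply: ge0_le_integral => //.
  - by move=> w _; exact: integral_ge0.
  - exact: (@measurable_fun_fubini_tonelli_G _ _ _ _ R mu G).
  - exact: emeasurable_funM.
  move=> w _.
  have [r [t [r0 tpi wE]]] := polar_form w.
  have rw : w.1 ^+ 2 + w.2 ^+ 2 = r ^+ 2.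
    by rewrite wE/= !exprMn -mulrDr cos2Dsin2 mulr1.
  have mc : measurable_fun setT (fun x => f (circle_point z r x)).
    exact: measurableT_comp mf (measurable_circle_point z r).
  have mcs : measurable_fun I (fun x => f (circle_point z r (x + t))).
    apply: measurable_funTS; apply: (measurableT_comp mc).
    exact: measurable_funD.
  have -> : (\int[mu]_x G (x, w) = Om w * \int[mu]_(x in I) f (circle_point z r (x + t)%R))%E.
    rewrite -ge0_integralZl//; last exact: measurable_itv.
    rewrite [RHS]integral_mkcond; apply: eq_integral => x _; rewrite patchE /G/=.
    rewrite indicE; case: ifPn => xI; last by rewrite mul0e.
    have Omrot : Om (rot (cos x) (sin x) w) = Om w.
      rewrite /Om wE circle_rotation/=.
      by rewrite !exprMn -!mulrDr !cos2Dsin2.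
    rewrite mul1e /g Omrot; congr (_ * f _)%E.
    by rewrite wE circle_rotation/= (addrC t x).
  rewrite (muleC _ (Om w)).
  have [rd|rd] := leP r d; last first.
    rewrite /Om rw omd ?mul0e//.
    by rewrite ltr_pXn2r ?nnegrE// ltW.
  apply: lee_wpmul2l => //.
  rewrite (ge0_integral_period_shift mc)//; last first.
    by move=> x; rewrite /circle_point mulr_natl cosD2pi sinD2pi.
  have [r0'|r0'] := eqVneq r 0; last by apply: fz => //; rewrite lt_def r0' r0.
  rewrite r0'; under eq_integral do rewrite /circle_point !mul0r !addr0 -surjective_pairing.
  rewrite integral_cst; last exact: measurable_itv.
  rewrite muleC; apply: lee_wpmul2r => //; rewrite le_eqVlt; apply/orP; left.
  by apply/eqP; exact: mI.
by move: key; rewrite lee_pmul2l.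
Qed.

End AreaMean.

(** * Local integrability in a strip *)

(** The plane as a pointed space, for the finite subcovers of its compact sets. *)
HB.instance Definition _ (T U : ptopologicalType) := Pointed.on (T * U)%type.

Section LocalIntegrability.
Context {R : realType}.
Local Notation mu := (@lebesgue_measure R).
Local Notation mu2 := (mu \x mu)%E.

Lemma integrable_setU d (T : measurableType d) (m : {measure set T -> \bar R})
    (A B : set T) (f : T -> \bar R) : measurable A -> measurable B ->
  m.-integrable A f -> m.-integrable B f -> m.-integrable (A `|` B) f.
Proof.
move=> mA mB /integrableP[mfA iA] /integrableP[mfB iB]; apply/integrableP.
have mf : measurable_fun (A `|` B) f by exact/measurable_funU.
split => //; rewrite -(setDUK (@subsetUl _ A B)) ge0_integral_setU//=.
- apply: lte_add_pinfty => //; apply: (le_lt_trans _ iB).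
  apply: ge0_subset_integral => //.
  + by apply: measurableD => //; exact: measurableU.
  + exact: measurableT_comp.
  + by move=> x [[]].
- by apply: measurableD => //; exact: measurableU.
- by rewrite setDUK//; apply: measurableT_comp.
- by rewrite disj_set2E setDIK.
Qed.

Lemma mu2_rect (a b c d : R) : a <= b -> c <= d ->
  (mu2 (`[a, b]%classic `*` `[c, d]%classic) = ((b - a) * (d - c))%:E)%E.
Proof.
move=> ab cd; rewrite product_measure1E; [|exact: measurable_itv..].
rewrite /= !lebesgue_measure_itv/= !lte_fin.
move: ab cd; rewrite !le_eqVlt => /predU1P[->|ab] /predU1P[->|cd];
  by rewrite ?ltxx ?ab ?cd ?subrr ?mul0r ?mulr0 ?mule0 ?mul0e -?EFinB -?EFinM.
Qed.

Lemma mu2_box (p : R * R) (r : R) : 0 <= r -> mu2 (box p r) = ((2 * r) ^+ 2)%:E.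
Proof.
move=> r0; rewrite boxE mu2_rect; [|lra..].
by congr EFin; ring.
Qed.

Lemma closed_disc_sub_box (z : R * R) r : 0 <= r -> closed_disc z r `<=` box z r.
Proof.
move=> r0 w; rewrite /closed_disc/box/= => h.
have h1 := sqr_ge0 (w.1 - z.1); have h2 := sqr_ge0 (w.2 - z.2).
by split; rewrite -(ler_pXn2r (ltn0Sn 1)) ?nnegrE// real_normK ?num_real//; lra.
Qed.

Lemma box_sub (p q : R * R) (r s : R) : box p s q -> box q r `<=` box p (r + s).
Proof.
move=> [p1 p2] w [w1 w2]; split; apply: (le_trans (ler_distD _ _ _)).
  exact: lerD w1 p1.
exact: lerD w2 p2.
Qed.

Lemma box_le (p : R * R) (r s : R) : r <= s -> box p r `<=` box p s.
Proof. by move=> rs w [w1 w2]; split; exact: le_trans rs. Qed.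

Lemma measurable_sqdist (z : R * R) :
  measurable_fun setT (fun w : R * R => (w.1 - z.1) ^+ 2 + (w.2 - z.2) ^+ 2).
Proof. by apply: measurable_funD; apply: measurable_funX; apply: measurable_funB. Qed.

Lemma area_supermean_centred (f : R * R -> \bar R) (om : R -> R) (z : R * R) (d : R) :
  measurable_fun setT f -> (forall w, (0 <= f w)%E) ->
  measurable_fun setT om -> (forall q, 0 <= om q) -> 0 < d ->
  (forall q, d ^+ 2 < q -> om q = 0) ->
  (forall r, 0 < r -> r <= d ->
    (\int[mu]_(t in `[0%R, (2 * pi)%R]) f (circle_point z r t) <=
     (2 * pi)%:E * f z)%E) ->
  (\int[mu2]_w ((om ((w.1 - z.1) ^+ 2 + (w.2 - z.2) ^+ 2))%:E * f w) <=
   f z * \int[mu2]_w (om (w.1 ^+ 2 + w.2 ^+ 2))%:E)%E.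
Proof.
move=> mf f0 mom om0 d0 omd fz.
apply: le_trans (area_supermean mf f0 mom om0 d0 omd fz).
rewrite -(ge0_integral_translate2 z).
- rewrite le_eqVlt; apply/orP; left; apply/eqP; apply: eq_integral => w _ /=.
  by rewrite !(addrC z.1) !(addrC z.2) !addrK.
- apply: emeasurable_funM => //; apply/measurable_EFinP.
  exact: measurableT_comp mom (measurable_sqdist z).
- by move=> w; apply: mule_ge0 => //; rewrite lee_fin.
Qed.

Variables (S : set (R * R)) (u : R * R -> \bar R).
Hypotheses (oS : open S) (su : subharmonic S u).

Let measurable_u_sub A : measurable A -> A `<=` S -> measurable_fun A u.
Proof.
move=> mA AS; apply: measurable_funS (measurable_subharmonic oS su) => //.
exact: open_measurable2.
Qed.

(** A finite value [u z] bounds the area mean of [M - u] over the disc of radius [d],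
    and this disc contains the box of radius [d / 2]. *)
Lemma integrable_near_finite (z : R * R) (d : R) : 0 < d -> box z d `<=` S ->
  u z != -oo%E -> mu2.-integrable (box z (d / 2)) u.
Proof.
move=> d0 zdS uz.
have [M uM] := subharmonic_ub oS su (compact_box (p := z) (r := d)) zdS.
pose f := gap u (box z d) M.
have mB := measurable_box z d.
have mf : measurable_fun setT f by exact: (measurable_gap oS su).
have f0 w : (0 <= f w)%E by exact: gap_ge0.
have mom : measurable_fun setT (\1_(`]-oo, d ^+ 2]%classic) : R -> R).
  by apply: measurable_indic; exact: measurable_itv.
have om0 q : 0 <= (\1_(`]-oo, d ^+ 2]%classic) : R -> R) q by [].
have omd q : d ^+ 2 < q -> (\1_(`]-oo, d ^+ 2]%classic) : R -> R) q = 0.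
  by move=> dq; rewrite indicE memNset//= in_itv/=; apply/negP; rewrite -ltNge.
have fzr r : 0 < r -> r <= d -> (\int[mu]_(t in `[0%R, (2 * pi)%R])
    f (circle_point z r t) <= (2 * pi)%:E * f z)%E.
  move=> r0 rd; apply: (@supermean_gap _ S u oS su) => //.
  apply: (subset_trans (closed_disc_sub_box (ltW r0))); exact: box_le.
have h := area_supermean_centred mf f0 mom om0 d0 omd fzr.
have sq2 (x y e : R) : `|x| <= e -> `|y| <= e -> x ^+ 2 + y ^+ 2 <= 2 * e ^+ 2.
  move=> xe ye; have e0 : 0 <= e by exact: le_trans xe.
  have := ler_pXn2r (ltn0Sn 1) (normr_ge0 x) e0; rewrite xe real_normK ?num_real//.
  have := ler_pXn2r (ltn0Sn 1) (normr_ge0 y) e0; rewrite ye real_normK ?num_real//.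
  by move=> *; lra.
have Wfin : (\int[mu2]_w (\1_(`]-oo, d ^+ 2]%classic) (w.1 ^+ 2 + w.2 ^+ 2))%:E < +oo)%E.
  apply: (@le_lt_trans _ _ (\int[mu2]_w (\1_(box (0, 0) d) w)%:E)%E).
    apply: ge0_le_integral => //.
    - apply/measurable_EFinP; apply: (measurableT_comp mom).
      by apply: measurable_funD; apply: measurable_funX.
    - by apply/measurable_EFinP; apply: measurable_indic; exact: measurable_box.
    move=> w _; rewrite lee_fin !indicE ler_nat; case: (boolP (_ \in `]-oo, _]%classic)) => //.
    move=> /set_mem/=; rewrite in_itv/= => wd; rewrite mem_set//.
    by apply: (closed_disc_sub_box (ltW d0)); rewrite /closed_disc/= !subr0.
  rewrite integral_indic// ?setIT; last exact: measurable_box.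
  by rewrite [X in (X < _)%E](_ : _ = mu2 (box (0, 0) d))// mu2_box ?ltry// ltW.
have fz : (f z < +oo)%E.
  rewrite /f gapE; last by split; rewrite subrr normr0 ltW.
  have uz' : (u z <= M%:E)%E by apply: uM; split; rewrite subrr normr0 ltW.
  by case: (u z) uz uz' => //= r _ _; rewrite -EFinB ltry.
have fI : (\int[mu2]_(w in box z (d / 2)) f w < +oo)%E.
  apply: (@le_lt_trans _ _ (f z * \int[mu2]_w
     (\1_(`]-oo, (d ^+ 2)%R]%classic) (w.1 ^+ 2 + w.2 ^+ 2)%R)%:E)%E).
    apply: (le_trans _ h); rewrite integral_mkcond; apply: ge0_le_integral => //.
    - by move=> w _; apply: erestrict_ge0.
    - apply/(measurable_restrictT _ _).1; first exact: measurable_box.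
      exact: measurable_funTS.
    - apply: emeasurable_funM => //; apply/measurable_EFinP.
      exact: measurableT_comp mom (measurable_sqdist z).
    move=> w _; rewrite patchE; case: ifPn => [|_]; last first.
      by apply: mule_ge0 => //; rewrite lee_fin.
    move=> /set_mem[w1 w2]; rewrite indicE mem_set ?mul1e//= in_itv/=.
    have := sq2 _ _ _ w1 w2; have := sqr_ge0 d; lra.
  by apply: lte_mul_pinfty => //; rewrite ge0_fin_numE.
have sub : box z (d / 2) `<=` box z d by apply: box_le; lra.
have mb := measurable_box z (d / 2).
apply/integrableP; split; first by apply: measurable_u_sub => // w /sub /zdS.
apply: (@le_lt_trans _ _ (\int[mu2]_(w in box z (d / 2)) (f w + `|M|%:E))%E).
  apply: ge0_le_integral => //.
  - by apply: measurableT_comp => //; apply: measurable_u_sub => // w /sub /zdS.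
  - by apply: emeasurable_funD => //; exact: measurable_funTS.
  move=> w /sub wd; rewrite /f gapE//; have := uM _ wd.
  case: (u w) => [x||]//=; rewrite !lee_fin => xM.
  by rewrite ler_norml; have := ler_norm M; have := ler_norm (- M); rewrite normrN => *; apply/andP; split; lra.
rewrite ge0_integralD//; last exact: measurable_funTS.
apply: lte_add_pinfty => //; rewrite integral_cst//.
by rewrite [X in (_ * X)%E](_ : _ = mu2 (box z (d / 2)))// mu2_box ?ltry//; lra.
Qed.

Lemma integrable_finite_point (p : R * R) (r : R) : 0 < r -> box p r `<=` S ->
  mu2.-integrable (box p r) u -> exists2 z, box p r z & u z != -oo%E.
Proof.
move=> r0 prS /integrableP[_ iu]; apply: contrapT => h.
have uE z : box p r z -> u z = -oo%E.
  by move=> bz; apply/eqP; apply: contrapT => /negP uz; apply: h; exists z.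
move: iu; rewrite (eq_integral (cst +oo%E)); last first.
  by move=> z /set_mem/uE ->.
rewrite integral_cst; last exact: measurable_box.
rewrite [X in (_ * X)%E](_ : _ = mu2 (box p r))// mu2_box ?ltW//.
by rewrite gt0_mulye ?ltxx// lte_fin exprn_gt0// mulr_gt0.
Qed.

(** Integrability propagates along a chain of overlapping boxes: from a point where
    [u] is finite it is integrable on a box around it, which contains points near
    the next centre where [u] is finite. *)
Lemma integrable_chain (p : nat -> R * R) (r : R) (N : nat) : 0 < r ->
  (forall k, (k <= N)%N -> box (p k) (7 * r) `<=` S) ->
  (forall k, (k < N)%N -> box (p k) r (p k.+1)) ->
  u (p 0%N) != -oo%E -> mu2.-integrable (box (p N) r) u.
Proof.
move=> r0 pS pp up.
(* A box of radius [3 r] around a point of [box (p k) r] needs room [6 r] around that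
   point. It contains the next box, the centres being at distance at most [r]. *)
have sub k z : (k <= N)%N -> box (p k) r z -> u z != -oo%E ->
    mu2.-integrable (box z (3 * r)) u.
  move=> kN bz uz; rewrite (_ : 3 * r = 6 * r / 2); last by field.
  apply: integrable_near_finite => //; first lra.
  apply: subset_trans (pS k kN); rewrite (_ : 7 * r = 6 * r + r); last by ring.
  exact: box_sub.
have main k : (k <= N)%N -> exists2 z, box (p k) r z & u z != -oo%E.
  elim: k => [_|k IH kN].
    by exists (p 0%N) => //; split; rewrite subrr normr0 ltW.
  have [z bz uz] := IH (ltnW kN).
  apply: integrable_finite_point => //.
    apply: subset_trans (pS _ kN); apply: box_le; lra.
  move: (sub k z (ltnW kN) bz uz).
  apply: integrableS; [exact: measurable_box..|].
  have zk : box z r (p k) by case: bz => ? ?; split; rewrite distrC.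
  have zk1 : box z (r + r) (p k.+1) by exact: (box_sub zk (pp k kN)).
  rewrite (_ : 3 * r = r + (r + r)); last by ring.
  exact: box_sub.
have [z bz uz] := main N (leqnn N).
move: (sub N z (leqnn N) bz uz).
apply: integrableS; [exact: measurable_box..|].
have zk : box z r (p N) by case: bz => ? ?; split; rewrite distrC.
apply: (@subset_trans _ (box z (r + r))); first exact: box_sub.
by apply: box_le; lra.
Qed.

Lemma integrable_compact (K : set (R * R)) : compact K -> measurable K ->
  (forall z, K z -> exists2 r, 0 < r & mu2.-integrable (box z r) u) ->
  mu2.-integrable K u.
Proof.
move=> cK mK h.
have /choice[r rP] : forall z, exists r, K z -> 0 < r /\ mu2.-integrable (box z r) u.
  move=> z; have [Kz|Kz] := pselect (K z); last by exists 0.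
  by have [r r0 ri] := h z Kz; exists r.
have : cover_compact K by rewrite -compact_cover.
move=> /(_ _ K (fun z => (box z (r z))^°)%classic)[| |D DK KD].
- by move=> z _; exact: open_interior.
- move=> z Kz; exists z => //; rewrite /interior; apply/nbhs_boxP.
  by exists (r z) => //; have [] := rP z Kz.
have : mu2.-integrable (\big[setU/set0]_(z <- finmap.enum_fset D) box z (r z)) u.
  have : forall z, z \in finmap.enum_fset D -> K z by move=> z /DK/set_mem.
  elim: (finmap.enum_fset D) => [_|z s IH sK]; first by rewrite big_nil; exact: integrable_set0.
  rewrite big_cons; apply: integrable_setU.
  - exact: measurable_box.
  - by apply: bigsetU_measurable => *; exact: measurable_box.
  - by have [] := rP z (sK z (mem_head _ _)).
  - by apply: IH => w ws; apply: sK; rewrite in_cons ws orbT.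
apply: integrableS => //.
  by apply: bigsetU_measurable => *; exact: measurable_box.
move=> z /KD[w /= wD /interior_subset wz].
by rewrite -bigcup_seq; exists w.
Qed.

End LocalIntegrability.

Section Strip.
Context {R : realType}.
Local Notation mu := (@lebesgue_measure R).
Local Notation mu2 := (mu \x mu)%E.
Variables (a b : \bar R).

Lemma open_strip : open (strip a b).
Proof.
have o (c : \bar R) : open [set y : R | (c < y%:E)%E] /\ open [set y : R | (y%:E < c)%E].
  case: c => [c||]; split.
  - by rewrite (_ : mkset _ = [set y | c < y])//; exact: open_gt.
  - by rewrite (_ : mkset _ = [set y | y < c])//; exact: open_lt.
  - rewrite (_ : mkset _ = set0); first exact: open0.
    by apply/seteqP; split => y //=; rewrite ltNge leey.
  - rewrite (_ : mkset _ = setT); first exact: openT.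
    by apply/seteqP; split => y //= _; rewrite ltry.
  - rewrite (_ : mkset _ = setT); first exact: openT.
    by apply/seteqP; split => y //= _; rewrite ltNyr.
  - rewrite (_ : mkset _ = set0); first exact: open0.
    by apply/seteqP; split => y //=; rewrite ltNge leNye.
have sE : strip a b = snd @^-1` ([set y : R | (a < y%:E)%E] `&` [set y : R | (y%:E < b)%E]).
  by [].
rewrite sE; apply: open_comp => [z _|]; first exact: cvg_snd.
by apply: openI; [exact: (o a).1|exact: (o b).2].
Qed.

Lemma strip_between (z0 z1 z : R * R) : strip a b z0 -> strip a b z1 ->
  z0.2 <= z.2 -> z.2 <= z1.2 -> strip a b z.
Proof.
move=> [/= a0 b0] [/= a1 b1] y0y yy1; split => /=.
  by apply: lt_le_trans a0 _; rewrite lee_fin.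
by apply: le_lt_trans b1; rewrite lee_fin.
Qed.

Lemma strip_room (y : R) : strip a b (0, y) -> exists2 r, 0 < r &
  forall x y', `|y' - y| <= r -> strip a b (x, y').
Proof.
move=> sy; have /nbhs_boxP[r r0 rS] := open_nbhs_nbhs (conj open_strip sy).
exists r => // x y' yy'.
by have : strip a b (0, y') by apply: rS; split => /=; rewrite ?subrr ?normr0// ltW.
Qed.

Variables (u : R * R -> \bar R) (su : subharmonic (strip a b) u).

(** A strip is convex, so the segment from a point where [u] is finite to the given
    point carries a chain of boxes. The room available at the two ends is available at
    every height between them. *)
Lemma integrable_strip (K : set (R * R)) : compact K -> measurable K ->
  K `<=` strip a b -> mu2.-integrable K u.
Proof.
move=> cK mK KS; apply: integrable_compact => // z Kz.
have [_ _ _ [z0 Sz0 uz0]] := su.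
have S0 : strip a b (0, z0.2) by case: Sz0.
have S1 : strip a b (0, z.2) by case: (KS z Kz).
have [r0 r0p r0S] := strip_room S0; have [r1 r1p r1S] := strip_room S1.
pose r := Num.min r0 r1 / 7.
have rp : 0 < r by rewrite divr_gt0// lt_min r0p.
have r7 : 0 < 7 * r by lra.
have rr0 : 7 * r <= r0 by rewrite mulrC divfK// ge_min lexx.
have rr1 : 7 * r <= r1 by rewrite mulrC divfK// ge_min lexx orbT.
pose L := `|z.1 - z0.1| + `|z.2 - z0.2|.
pose N := (Num.bound (L / r)).+1.
have N0 : 0 < N%:R :> R by rewrite ltr0n.
have LN : L <= N%:R * r.
  rewrite -ler_pdivrMr//; apply/ltW/(lt_trans (archi_boundP _)).
    by rewrite divr_ge0 ?addr_ge0// ltW.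
  by rewrite ltr_nat.
pose p (k : nat) := (z0.1 + k%:R / N%:R * (z.1 - z0.1), z0.2 + k%:R / N%:R * (z.2 - z0.2)).
have p0 : p 0%N = z0 by rewrite /p !mul0r !addr0 -surjective_pairing.
have pN : p N = z.
  by rewrite /p divff ?gt_eqF// !mul1r !(addrC z0.1) !(addrC z0.2) !subrK -surjective_pairing.
exists r => //; rewrite -pN; apply: (integrable_chain open_strip su) => //; last by rewrite p0.
- move=> k kN w [_ w2].
  have t0 : 0 <= k%:R / N%:R :> R by rewrite divr_ge0.
  have t1 : k%:R / N%:R <= 1 :> R by rewrite ler_pdivrMr// mul1r ler_nat.
  move: w2; rewrite /p/= ler_distl; set t := _ / _ in t0 t1 * => /andP[wl wr].
  have [zz|zz] := leP z0.2 z.2.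
    apply: (@strip_between (0, z0.2 - 7 * r) (0, z.2 + 7 * r)).
    - by apply: r0S; rewrite addrC addKr normrN (gtr0_norm r7).
    - by apply: r1S; rewrite addrC addKr (gtr0_norm r7).
    - by apply: le_trans wl; rewrite lerD2r lerDl mulr_ge0// subr_ge0.
    - apply: (le_trans wr); rewrite lerD2r -lerBrDl ler_piMl// subr_ge0//.
  apply: (@strip_between (0, z.2 - 7 * r) (0, z0.2 + 7 * r)).
  - by apply: r1S; rewrite addrC addKr normrN (gtr0_norm r7).
  - by apply: r0S; rewrite addrC addKr (gtr0_norm r7).
  - apply: le_trans wl; rewrite lerD2r -lerBlDl -[leLHS]mul1r ler_wnM2r//.
    by rewrite subr_le0 ltW.
  - apply: (le_trans wr); rewrite lerD2r gerDl mulr_ge0_le0// subr_le0 ltW//.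
- move=> k kN; have step (x y : R) : `|y - x| <= L ->
      `|x + k.+1%:R / N%:R * (y - x) - (x + k%:R / N%:R * (y - x))| <= r.
    move=> xy; rewrite (_ : _ - _ = N%:R^-1 * (y - x)); last first.
      by rewrite -natr1; field; rewrite gt_eqF.
    rewrite normrM ger0_norm ?invr_ge0// ler_pdivrMl//.
    exact: (le_trans xy).
  split; apply: step; rewrite /L; [rewrite lerDl|rewrite lerDr]; exact: normr_ge0.
Qed.

End Strip.

(** * Smooth bumps *)

Section Flat.
Context {R : realType}.

(** Up to linear combinations, the derivatives of [exp (- 1 / s)]: this family is stable
    under differentiation. *)
Definition flat (k : nat) (s : R) : R := if 0 < s then s ^- k * expR (- s^-1) else 0.

Lemma flat_ge0 k s : 0 <= flat k s.
Proof.
by rewrite /flat; case: ifPn => // s0; rewrite mulr_ge0 ?expR_ge0// invr_ge0 exprn_ge0// ltW.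
Qed.

Lemma flat_gt0 k s : 0 < s -> 0 < flat k s.
Proof. by move=> s0; rewrite /flat s0 mulr_gt0 ?expR_gt0// invr_gt0 exprn_gt0. Qed.

Lemma flat_le0 k s : s <= 0 -> flat k s = 0.
Proof. by move=> s0; rewrite /flat ltNge s0. Qed.

(** The exponential beats every power, so [flat k] has a second order zero at the
    origin, whatever [k]. *)
Lemma flat_le_sqr k s : `|flat k s| <= (k.+2)`!%:R * s ^+ 2.
Proof.
rewrite ger0_norm ?flat_ge0//; have [s0|s0] := ltP 0 s; last first.
  by rewrite flat_le0// mulr_ge0// sqr_ge0.
rewrite /flat s0 expRN ler_pdivrMr ?expR_gt0//.
have sV : 0 <= s^-1 by rewrite invr_ge0 ltW.
have := expR_ge1Dxn k.+1 sV.
have f0 : 0 < (k.+2)`!%:R :> R by rewrite ltr0n fact_gt0.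
move=> h.
have {h} : s^-1 ^+ k.+2 / k.+2`!%:R <= expR s^-1 by apply: le_trans h; rewrite lerDr.
rewrite ler_pdivrMr// => h.
have s2 : 0 < s ^+ 2 by rewrite exprn_gt0.
have := ler_wpM2r (ltW s2) h.
rewrite -addn2 exprD exprVn -mulrA -exprVn -exprMn mulVf ?gt_eqF// expr1n mulr1 => h2.
by apply: (le_trans h2); rewrite le_eqVlt; apply/orP; left; apply/eqP; ring.
Qed.

Lemma is_derive_flat k (s : R) :
  is_derive s 1 (flat k) (flat k.+2 s - k%:R * flat k.+1 s).
Proof.
have [s0|s0|->] := ltgtP s 0.
- rewrite !flat_le0 ?ltW// mulr0 subrr.
  have H : is_derive s 1 (cst 0 : R -> R) (0 : R) by exact: is_derive_cst.
  apply: near_eq_is_derive H.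
  near=> t; rewrite flat_le0//; apply/ltW; near: t.
  exact: lt_nbhsl.
- have sn0 : s != 0 by rewrite gt_eqF.
  suff H : is_derive s 1 (fun t : R => t^-1 ^+ k * expR (- t^-1))
      (flat k.+2 s - k%:R * flat k.+1 s).
    apply: near_eq_is_derive H; near=> t; have t0 : 0 < t by near: t; exact: lt_nbhsr.
    by rewrite /flat t0 /= exprVn.
  have dV : is_derive s 1 (fun t : R => t^-1) (- s ^- 2).
    apply: is_derive_eq; first exact: is_deriveV.
    by rewrite scaler1.
  have dX : is_derive s 1 (fun t : R => t^-1 ^+ k) (k%:R * s^-1 ^+ k.-1 * (- s ^- 2)).
    have dP : is_derive s^-1 1 (fun t : R => t ^+ k) (k%:R * s^-1 ^+ k.-1).
      apply: DeriveDef; first exact: exprn_derivable.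
      by rewrite exp_derive /GRing.scale/= mulr1.
    exact: (is_derive1_comp dP dV).
  have dN : is_derive s 1 (fun t : R => - t^-1) (s ^- 2).
    by have := is_deriveN dV; rewrite opprK.
  have dE : is_derive s 1 (fun t : R => expR (- t^-1)) (expR (- s^-1) * s ^- 2).
    exact: (is_derive1_comp (is_derive_expR _) dN).
  have := is_deriveM dX dE; set d := (X in is_derive _ _ _ X) => H.
  suff <- : d = flat k.+2 s - k%:R * flat k.+1 s by exact: H.
  rewrite /d.
  rewrite /flat s0 /=; rewrite -!exprVn.
  rewrite /GRing.scale/=; move: (s^-1) (expR _) => v E.
  by case: k {dX d H} => [|k] /=; rewrite !exprS; ring.
- rewrite !flat_le0// mulr0 subrr.
  have f0 : forall k, flat k 0 = 0 by move=> j; rewrite flat_le0.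
  have cv : (fun h : R => h^-1 *: (flat k (h *: 1 + 0) - flat k 0)) @ 0^' --> (0 : R).
    apply/cvgrPdist_le => e e0; near=> h.
    have h0 : h != 0 by near: h; exact: nbhs_dnbhs_neq.
    rewrite addr0 scaler1 f0 subr0 sub0r normrN normrM normfV.
    rewrite ler_pdivrMl ?normr_gt0//.
    apply: (le_trans (flat_le_sqr k h)).
    rewrite -[h ^+ 2]ger0_norm ?sqr_ge0// normrX expr2 mulrA mulrC ler_wpM2l//.
    have f1 : 0 < (k.+2)`!%:R :> R by rewrite ltr0n fact_gt0.
    rewrite mulrC -ler_pdivlMr//; apply/ltW; near: h.
    apply: dnbhs0_lt; exact: divr_gt0.
  have cv' : (fun h : R => h^-1 *: ((flat k \o shift 0) (h *: 1) - flat k 0)) @ 0^' --> (0 : R) by [].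
  apply: DeriveDef; first by apply/cvg_ex; exists 0.
  exact: cvg_lim cv'.
Unshelve. all: by end_near. Qed.

End Flat.

Section Projections.
Context {R : realType}.

Lemma differentiable_fst (z : R * R) : differentiable (fst : R * R -> R) z.
Proof. by apply: linear_differentiable => w; exact: cvg_fst. Qed.

Lemma differentiable_snd (z : R * R) : differentiable (snd : R * R -> R) z.
Proof. by apply: linear_differentiable => w; exact: cvg_snd. Qed.

Lemma derive_fst (z v : R * R) : 'D_v (fst : R * R -> R) z = v.1.
Proof.
rewrite deriveE; last exact: differentiable_fst.
by rewrite (@diff_lin R _ _ (fst : {linear (R * R)%type -> R}))// => w; exact: cvg_fst.
Qed.

Lemma derive_snd (z v : R * R) : 'D_v (snd : R * R -> R) z = v.2.
Proof.
rewrite deriveE; last exact: differentiable_snd.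
by rewrite (@diff_lin R _ _ (snd : {linear (R * R)%type -> R}))// => w; exact: cvg_snd.
Qed.

End Projections.

Section BumpAlgebra.
Context {R : realType}.
Local Notation e := (@unit_vector R).

(** Every bump below belongs to this class. As it is given by its construction rules, its
    stability under partial derivatives, and with it smoothness, is an induction. *)
Inductive bump_algebra : (R * R -> R) -> Prop :=
| bump_cst c : bump_algebra (cst c)
| bump_fst : bump_algebra fst
| bump_snd : bump_algebra snd
| bump_add f g : bump_algebra f -> bump_algebra g -> bump_algebra (f \+ g)
| bump_mul f g : bump_algebra f -> bump_algebra g -> bump_algebra (f \* g)
| bump_flat k f : bump_algebra f -> bump_algebra (flat k \o f).

Lemma bump_algebra_differentiable f : bump_algebra f -> forall z, differentiable f z.
Proof.
elim => [c|||g h _ Hg _ Hh|g h _ Hg _ Hh|k g _ Hg] z.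
- exact: differentiable_cst.
- exact: differentiable_fst.
- exact: differentiable_snd.
- exact: differentiableD.
- exact: differentiableM.
- apply: differentiable_comp => //; apply/derivable1_diffP.
  exact: (@ex_derive _ _ _ _ _ _ _ (is_derive_flat k (g z))).
Qed.

Lemma bump_algebra_derive f i : bump_algebra f ->
  exists2 g, bump_algebra g & forall z, 'D_(e i) f z = g z.
Proof.
elim => [c|||g h bg [g' bg' Hg] bh [h' bh' Hh]|g h bg [g' bg' Hg] bh [h' bh' Hh]|k g bg [g' bg' Hg]].
- by exists (cst 0); [constructor|move=> z; rewrite derive_cst].
- exists (cst (e i).1); first by constructor.
  by move=> z; rewrite derive_fst.
- exists (cst (e i).2); first by constructor.
  by move=> z; rewrite derive_snd.
- exists (g' \+ h'); first by constructor.
  move=> z; rewrite deriveD ?Hg ?Hh//; apply: diff_derivable; exact: bump_algebra_differentiable.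
- exists ((g \* h') \+ (h \* g')); first by do !constructor.
  move=> z; rewrite deriveM ?Hg ?Hh//; apply: diff_derivable; exact: bump_algebra_differentiable.
- exists (((flat k.+2 \o g) \+ (cst (- k%:R) \* (flat k.+1 \o g))) \* g').
    by do !constructor.
  move=> z; have dg := bump_algebra_differentiable bg z.
  have dk := is_derive_flat k (g z).
  have dfk : differentiable (flat k) (g z) by apply/derivable1_diffP; exact: ex_derive.
  rewrite deriveE; last exact: differentiable_comp.
  rewrite diff_comp//= -(deriveE _ dg) Hg.
  rewrite deriv1E /=; last exact: ex_derive.
  by rewrite derive1E derive_val /GRing.scale/= mulNr mulrC.
Qed.

Lemma bump_algebra_smooth f : bump_algebra f -> smooth f.
Proof.
move=> bf s.
have [g bg gE] : exists2 g, bump_algebra g & iter_partial s f =1 g.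
  elim: s => [|i s [g bg gE]]; first by exists f.
  have [g' bg' g'E] := bump_algebra_derive i bg; exists g' => // z.
  by rewrite -g'E /=; congr derive; apply/funext.
have -> : iter_partial s f = g by exact/funext.
split=> [z|i z]; last exact/diff_derivable/bump_algebra_differentiable.
exact/differentiable_continuous/bump_algebra_differentiable.
Qed.

End BumpAlgebra.

(** * Series of translates of a bump *)

Section WeightedSums.
Context {R : realType}.
Variable c : nat -> R.
Hypothesis sc : cvgn (series (fun j => `|c j|)).

Definition wsum (x : nat -> R) : R := limn (series (fun j => c j * x j)).

Lemma cvg_wsum_norm (x : nat -> R) C : (forall j, `|x j| <= C) ->
  cvgn [normed series (fun j => c j * x j)].
Proof.
move=> xC; apply: (@series_le_cvg _ _ (fun j => C * `|c j|)) => [n|n|n|].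
- exact: normr_ge0.
- by rewrite mulr_ge0// (le_trans (normr_ge0 (x 0%N))).
- by rewrite /= normrM mulrC ler_wpM2r.
- exact: is_cvg_seriesZ.
Qed.

Lemma cvg_wsum (x : nat -> R) C : (forall j, `|x j| <= C) ->
  cvgn (series (fun j => c j * x j)).
Proof. by move=> xC; apply: normed_cvg; exact: cvg_wsum_norm xC. Qed.

Lemma wsum_bound (x : nat -> R) C : (forall j, `|x j| <= C) ->
  `|wsum x| <= C * limn (series (fun j => `|c j|)).
Proof.
move=> xC; apply: (le_trans (lim_series_norm (cvg_wsum_norm xC))).
have -> : C * limn (series (fun j => `|c j|)) = limn (series (C *: (fun j => `|c j|))).
  by rewrite lim_seriesZ.
apply: lim_series_le.
- exact: cvg_wsum_norm xC.
- exact: is_cvg_seriesZ.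
- by move=> n /=; rewrite normrM /GRing.scale/= mulrC ler_wpM2r.
Qed.

Lemma wsumB (x y : nat -> R) C D : (forall j, `|x j| <= C) -> (forall j, `|y j| <= D) ->
  wsum (fun j => x j - y j) = wsum x - wsum y.
Proof.
move=> xC yD; rewrite /wsum -(lim_seriesB (cvg_wsum xC) (cvg_wsum yD)); congr (limn (series _)).
by apply/funext => j /=; rewrite !fctE mulrBr.
Qed.

Lemma wsumZ (x : nat -> R) k C : (forall j, `|x j| <= C) ->
  wsum (fun j => k * x j) = k * wsum x.
Proof.
move=> xC; rewrite /wsum -[RHS](lim_seriesZ _ (cvg_wsum xC)); congr (limn (series _)).
by apply/funext => j /=; rewrite !fctE /GRing.scale/= mulrCA.
Qed.

End WeightedSums.

Section BoundedSmooth.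
Context {R : realType}.
Local Notation e := (@unit_vector R).

Lemma is_derive_line (f : R * R -> R) (z v : R * R) (t : R) :
  derivable f (z + t *: v) v ->
  is_derive t 1 (fun s => f (z + s *: v)) ('D_v f (z + t *: v)).
Proof.
move=> df.
have E : (fun h : R => h^-1 *: (((fun s => f (z + s *: v)) \o shift t) (h *: 1) - f (z + t *: v))) =
         (fun h : R => h^-1 *: ((f \o shift (z + t *: v)) (h *: v) - f (z + t *: v))).
  apply/funext => h /=; congr (_ *: (f _ - _)).
  by rewrite scaler1 scalerDl addrCA.
by apply: DeriveDef; rewrite /derivable /derive E.
Qed.

Lemma MVT_centred (f df : R -> R) (t : R) : (forall s : R, is_derive s 1 f (df s)) ->
  exists2 s, `|s| <= `|t| & f t - f 0 = df s * t.
Proof.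
move=> fdf.
have cf (a b : R) : {within `[a, b], continuous f}.
  apply: derivable_within_continuous => x _.
  exact: (@ex_derive _ _ _ _ _ _ _ (fdf x)).
have [t0|t0] := leP 0 t.
  have [s] := MVT_segment t0 (fun x _ => fdf x) (cf _ _).
  rewrite in_itv/= subr0 => /andP[s0 st] ->; exists s => //.
  by rewrite !ger0_norm.
have [s] := MVT_segment (ltW t0) (fun x _ => fdf x) (cf _ _).
rewrite in_itv/= sub0r mulrN => /andP[ts s0] E; exists s.
  by rewrite !ler0_norm ?lerN2// ltW.
by rewrite -[LHS]opprB E opprK.
Qed.

(** Bounds on the derivatives of every order are what allows a series of translates to be
    differentiated term by term any number of times. *)
Definition bsmooth (F : R * R -> R) := forall s,
  (forall i z, derivable (iter_partial s F) z (e i)) /\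
  exists C, forall z, `|iter_partial s F z| <= C.

Lemma iter_partial_rcons (F : R * R -> R) s i :
  iter_partial s (fun z => 'D_(e i) F z) = iter_partial (rcons s i) F.
Proof. by rewrite /iter_partial foldr_rcons. Qed.

Lemma bsmooth_partial F i : bsmooth F -> bsmooth (fun z => 'D_(e i) F z).
Proof. by move=> bF s; rewrite iter_partial_rcons; exact: bF. Qed.

Lemma bsmooth_bound F : bsmooth F -> exists C, forall z, `|F z| <= C.
Proof. by move=> /(_ [::])[]. Qed.

Lemma bsmooth_derivable F i z : bsmooth F -> derivable F z (e i).
Proof. by move=> /(_ [::])[+ _]; exact. Qed.

Lemma bsmooth_lipschitz F : bsmooth F -> exists2 C, 0 <= C & forall i z t,
  `|F (z + t *: e i) - F z| <= C * `|t|.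
Proof.
move=> bF.
have [C1 h1] := bsmooth_bound (bsmooth_partial true bF).
have [C2 h2] := bsmooth_bound (bsmooth_partial false bF).
have C10 : 0 <= C1 by apply: le_trans (h1 0).
have C20 : 0 <= C2 by apply: le_trans (h2 0).
exists (C1 + C2) => [|i z t]; first exact: addr_ge0.
have [s _ E] := MVT_centred t (fun s => is_derive_line (@bsmooth_derivable F i (z + s *: e i) bF)).
move: E; rewrite scale0r addr0 => ->; rewrite normrM ler_wpM2r//.
case: i; first by apply: (le_trans (h1 _)); rewrite lerDl.
by apply: (le_trans (h2 _)); rewrite lerDr.
Qed.

Lemma bsmooth_taylor F i : bsmooth F -> exists2 C, 0 <= C & forall z t,
  `|F (z + t *: e i) - F z - t * 'D_(e i) F z| <= C * t ^+ 2.
Proof.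
move=> bF; have [C C0 h] := bsmooth_lipschitz (bsmooth_partial i bF).
exists C => // z t.
have [s st E] := MVT_centred t (fun s => is_derive_line (@bsmooth_derivable F i (z + s *: e i) bF)).
move: E; rewrite scale0r addr0 => ->; rewrite (mulrC t) -mulrBl normrM.
rewrite -(real_normK (num_real t)) expr2 mulrA ler_wpM2r//.
by apply: (le_trans (h i z s)); rewrite ler_wpM2l.
Qed.

Lemma lipschitz_continuous2 (f : R * R -> R) (C : R) : 0 <= C ->
  (forall i z t, `|f (z + t *: e i) - f z| <= C * `|t|) -> continuous f.
Proof.
move=> C0 h z; apply/cvgrPdist_le => eps eps0.
have d0 : 0 < eps / (2 * (C + 1)) by rewrite divr_gt0// mulr_gt0// ltr_wpDl.
apply/nbhs_boxP; exists (eps / (2 * (C + 1))) => // w [w1 w2].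
have E1 := h true z (w.1 - z.1).
have E2 := h false (z + (w.1 - z.1) *: e true) (w.2 - z.2).
have wE : z + (w.1 - z.1) *: e true + (w.2 - z.2) *: e false = w.
  rewrite [RHS]surjective_pairing; congr pair; rewrite /= /GRing.scale/=.
    by rewrite mulr0 mulr1 addr0 addrC subrK.
  by rewrite mulr0 mulr1 addr0 addrC subrK.
rewrite wE in E2; rewrite distrC.
rewrite (_ : f w - f z = (f w - f (z + (w.1 - z.1) *: e true)) +
   (f (z + (w.1 - z.1) *: e true) - f z)); last by rewrite addrA subrK.
apply: (le_trans (ler_normD _ _)).
have := ler_wpM2l C0 w1; have := ler_wpM2l C0 w2.
set d := eps / _ in d0 *.
have : C * d <= eps / 2.
  rewrite /d mulrC -mulrA -ler_pdivlMl//.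
  have -> : eps^-1 * (eps / 2) = 2^-1 by rewrite mulrA mulVf ?gt_eqF// mul1r.
  by rewrite mulrC ler_pdivrMr ?mulr_gt0 ?ltr_wpDl//; lra.
by move=> *; lra.
Qed.

Lemma smooth_class (P : (R * R -> R) -> Prop) :
  (forall f, P f -> continuous f /\ forall i, (forall z, derivable f z (e i)) /\
     P (fun z => 'D_(e i) f z)) ->
  forall f, P f -> smooth f.
Proof.
move=> HP f Pf s.
have : P (iter_partial s f).
  by elim: s => //= i s /HP[_ /(_ i)[]].
by move=> /HP[cf h]; split => // i z; have [] := h i.
Qed.

Section Series.
Variables (c : nat -> R) (p : nat -> R * R).
Hypothesis sc : cvgn (series (fun j => `|c j|)).

Definition ser (F : R * R -> R) (z : R * R) : R := wsum c (fun j => F (z - p j)).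

(** The quadratic bound on the Taylor remainder of [F] is uniform over the plane, so the
    difference quotients of the terms converge uniformly, wherever the points [p j]
    are. *)
Lemma is_derive_ser F i z : bsmooth F ->
  is_derive z (e i) (ser F) (ser (fun z => 'D_(e i) F z) z).
Proof.
move=> bF; have [C C0 h] := bsmooth_taylor i bF.
have [D hD] := bsmooth_bound bF.
have [E hE] := bsmooth_bound (bsmooth_partial i bF).
have cv : (fun t : R => t^-1 *: ((ser F \o shift z) (t *: e i) - ser F z)) @ 0^'
    --> ser (fun z => 'D_(e i) F z) z.
  set A := limn (series (fun j => `|c j|)).
  have A0 : 0 <= A.
    have := @wsum_bound _ c sc (cst 0) 1; rewrite mul1r => /(_ _)/(le_trans _)-> //.
    by move=> j; rewrite normr0.
  have CA : 0 < C * A + 1 by rewrite ltr_wpDl// mulr_ge0.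
  apply/cvgrPdist_le => eps eps0.
  have d0 : 0 < eps / (C * A + 1) by exact: divr_gt0.
  near=> t.
  have t0 : t != 0 by near: t; exact: nbhs_dnbhs_neq.
  rewrite distrC /= /ser.
  rewrite -(@wsumB _ c sc _ _ D D)// /GRing.scale/=.
  rewrite -(@wsumZ _ c sc _ _ (D + D)); last first.
    by move=> j; apply: (le_trans (ler_normB _ _)); exact: lerD.
  rewrite -(@wsumB _ c sc _ _ (`|t^-1| * (D + D)) E)//; last first.
    move=> j; rewrite normrM ler_wpM2l//.
    by apply: (le_trans (ler_normB _ _)); exact: lerD.
  apply: (le_trans (@wsum_bound _ c sc _ (C * `|t|) _)) => //.
    move=> j; have := h (z - p j) t.
    rewrite (_ : z - p j + t *: e i = t *: e i + z - p j); last by rewrite addrC addrA.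
    move=> hj.
    have -> : t^-1 * (F (t *: e i + z - p j) - F (z - p j)) - 'D_(e i) F (z - p j)
      = t^-1 * (F (t *: e i + z - p j) - F (z - p j) - t * 'D_(e i) F (z - p j)).
      by rewrite [RHS]mulrBr mulrA mulVf// mul1r.
    rewrite normrM normfV ler_pdivrMl ?normr_gt0//.
    by apply: (le_trans hj); rewrite -(real_normK (num_real t)) expr2 mulrCA.
  have : `|t| <= eps / (C * A + 1).
    by apply/ltW; near: t; exact: dnbhs0_lt.
  rewrite ler_pdivlMr// => tA; rewrite mulrAC mulrC; apply: le_trans tA.
  by rewrite ler_wpM2l// lerDl.
apply: DeriveDef; first by apply/cvg_ex; exists (ser (fun z => 'D_(e i) F z) z).
exact: cvg_lim cv.
Unshelve. all: by end_near. Qed.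

Lemma smooth_ser F : bsmooth F -> smooth (ser F).
Proof.
move=> bF; apply: (@smooth_class (fun f => exists2 G, bsmooth G & f = ser G)); last by exists F.
move=> _ [G bG ->]; split.
  have [C C0 h] := bsmooth_lipschitz bG.
  have [D hD] := bsmooth_bound bG.
  set A := limn (series (fun j => `|c j|)).
  apply: (@lipschitz_continuous2 _ (C * A)).
    have := @wsum_bound _ c sc (fun=> C) C; rewrite -/A => /(_ _)/(le_trans _)-> //.
    by move=> j; rewrite ger0_norm.
  move=> i z t; rewrite /ser -(@wsumB _ c sc _ _ D D)// mulrAC.
  apply: (@wsum_bound _ c sc _ (C * `|t|)) => j.
  by rewrite (_ : z + t *: e i - p j = z - p j + t *: e i) ?h// addrAC.
move=> i; split => [z|].
  exact: (@ex_derive _ _ _ _ _ _ _ (is_derive_ser i z bG)).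
exists (fun z => 'D_(e i) G z); first exact: bsmooth_partial.
by apply/funext => z; exact: (@derive_val _ _ _ _ _ _ _ (is_derive_ser i z bG)).
Qed.

End Series.

(** The complement of the box being open, every derivative vanishes there, and it attains
    its maximum modulus on the box. *)
Lemma smooth_compact_bsmooth (F : R * R -> R) (q : R * R) (r : R) : 0 <= r -> smooth F ->
  (forall z, ~ box q r z -> F z = 0) -> bsmooth F.
Proof.
move=> r0 sF F0 s; have [cF dF] := sF s; split => //.
have cB : closed (box q r).
  exact: (compact_closed (@norm_hausdorff _ (R * R)%type) (compact_box (p := q) (r := r))).
have Fs0 z : ~ box q r z -> iter_partial s F z = 0.
  elim: s {cF dF} z => [|i s IH] z; first exact: F0.
  move=> qz; rewrite /= (@near_eq_derive _ _ _ _ (cst 0)) ?derive_cst//.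
  have : nbhs z (~` box q r) by apply: open_nbhs_nbhs; split => //; exact: closed_openC.
  by apply: filterS => w /IH.
have [|||m _ hm] := @compact_EVT_max _ R (fun z => `|iter_partial s F z|) (box q r).
- by exists q; split; rewrite subrr normr0.
- exact: compact_box.
- apply: continuous_subspaceT => z; apply: continuous_comp; first exact: cF.
  exact: norm_continuous.
exists `|iter_partial s F m| => z.
have [qz|qz] := pselect (box q r z); first by apply: hm; rewrite inE.
by rewrite Fs0// normr0.
Qed.

Lemma test_function_of_support (S : set (R * R)) (F : R * R -> R) (K : set (R * R)) :
  closed K -> compact K -> K `<=` S -> smooth F ->
  (forall z, ~ K z -> F z = 0) -> test_function S F.
Proof.
move=> clK cK KS sF F0.
have sub : closure [set z | F z != 0] `<=` K.
  apply: (@subset_trans _ (closure K)); last by rewrite -((closure_id K).1 clK).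
  by apply: closure_subset => z /=; apply: contraNP => /F0 ->.
split => //; last exact: subset_trans KS.
exact: (subclosed_compact (@closed_closure _ _) cK sub).
Qed.

End BoundedSmooth.

(** * Means over long intervals *)

Section BoundedIntegrals.
Context {R : realType}.
Local Notation mu := (@lebesgue_measure R).
Local Notation J f a b := (\int[mu]_(x in `[a, b]) f x).

Definition bounded_measurable (f : R -> R) : Prop :=
  measurable_fun setT f /\ exists M, forall x, `|f x| <= M.

Lemma itv_measure (a b : R) : a <= b -> mu `[a, b]%classic = (b - a)%:E.
Proof.
rewrite lebesgue_measure_itv/= lte_fin le_eqVlt => /predU1P[->|->//].
by rewrite ltxx subrr.
Qed.

Lemma bm_integrable f a b : bounded_measurable f ->
  mu.-integrable `[a, b] (EFin \o f).
Proof.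
move=> [mf [M fM]]; apply: measurable_bounded_integrable => //.
- have [ab|ab] := leP a b; first by rewrite [ltLHS](itv_measure ab) ltry.
  by rewrite set_itv_ge ?measure0// bnd_simp -ltNge.
- exact: measurable_funTS.
- by exists M; split => [|x Mx y _ /=]; [exact: num_real|exact: le_trans (fM y) (ltW Mx)].
Qed.

Lemma bmD f g : bounded_measurable f -> bounded_measurable g ->
  bounded_measurable (fun x => f x + g x).
Proof.
move=> [mf [M fM]] [mg [N gN]]; split; first exact: measurable_funD.
by exists (M + N) => x; apply: (le_trans (ler_normD _ _)); exact: lerD.
Qed.

Lemma bmM f g : bounded_measurable f -> bounded_measurable g ->
  bounded_measurable (fun x => f x * g x).
Proof.
move=> [mf [M fM]] [mg [N gN]]; split; first exact: measurable_funM.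
by exists (M * N) => x; rewrite normrM; exact: ler_pM.
Qed.

Lemma bm_cst r : bounded_measurable (cst r).
Proof. by split => //; exists `|r| => x. Qed.

Lemma bmB f g : bounded_measurable f -> bounded_measurable g ->
  bounded_measurable (fun x => f x - g x).
Proof.
move=> bf bg; have := bmD bf (bmM (bm_cst (-1)) bg).
by under eq_fun do rewrite mulN1r.
Qed.

Lemma bm_shift f c : bounded_measurable f -> bounded_measurable (fun x => f (x + c)).
Proof.
move=> [mf [M fM]]; split; last by exists M => x.
by apply: measurableT_comp => //; exact: measurable_funD.
Qed.

Lemma J_split f a b c : bounded_measurable f -> a <= b -> b <= c ->
  J f a c = J f a b + J f b c.
Proof.
move=> bf ab bc; rewrite -[X in _ + X]Rintegral_itv_obnd_cbnd; last first.
  by apply: integrableS (bm_integrable b c bf) => // x /=; rewrite !in_itv/= => /andP[/ltW-> ->].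
rewrite -(@Rintegral_itvB _ f (BLeft a) (BRight c) b) ?bnd_simp//; last exact: bm_integrable.
by rewrite addrC subrK.
Qed.

Lemma J_bound f a b M : bounded_measurable f -> a <= b -> (forall x, `|f x| <= M) ->
  `|J f a b| <= M * (b - a).
Proof.
move=> bf ab fM; apply: (le_trans (le_normr_Rintegral _ (bm_integrable a b bf))) => //.
have := Rintegral_cst mu (measurable_itv `[a, b]) M.
rewrite [X in fine X](_ : _ = (b - a)%:E)/=; last exact: itv_measure.
move=> <-; apply: le_Rintegral => //.
- by apply: integrable_norm; exact: bm_integrable.
- exact: (bm_integrable a b (bm_cst M)).
Qed.

Lemma J_shift f a b c : bounded_measurable f ->
  J f (a + c) (b + c) = J (fun x => f (x + c)) a b.
Proof.
move=> [mf _].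
have sh (g : R -> \bar R) : measurable_fun setT g -> (forall x, 0 <= g x)%E ->
    (\int[mu]_(x in `[(a + c)%R, (b + c)%R]) g x = \int[mu]_(x in `[a, b]) g (x + c)%R)%E.
  move=> mg g0; rewrite integral_mkcond [RHS]integral_mkcond.
  rewrite -(ge0_integralDx c)/=; last 2 first.
  - by apply/(measurable_restrictT _ _).1 => //; exact: measurable_funTS.
  - by move=> x; apply: erestrict_ge0.
  by apply: eq_integral => x _; rewrite /patch !mem_setE !in_itv/= !lerD2r.
rewrite /Rintegral integralE [in RHS]integralE; congr (fine (_ - _)).
  rewrite sh//; last by apply: measurable_funepos; exact/measurable_EFinP.
  by apply: eq_integral => x _; rewrite !funeposE.
rewrite sh//; last by apply: measurable_funeneg; exact/measurable_EFinP.
by apply: eq_integral => x _; rewrite !funenegE.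
Qed.

Lemma J_dist f g a b M : bounded_measurable f -> bounded_measurable g -> a <= b ->
  (forall x, `|f x - g x| <= M) -> `|J f a b - J g a b| <= M * (b - a).
Proof.
move=> bf bg ab fg; rewrite -RintegralB//; [|exact: bm_integrable..].
by apply: J_bound => //; exact: bmB.
Qed.

(** The integral of [h] over [[- T, T]] obeys the same two bounds as [B] up to the end
    pieces, which have length [r] each. *)
Lemma J_squeeze h T r D B : bounded_measurable h -> (forall t, `|h t| <= D) ->
  0 < r -> r <= T -> J h (- (T - r)) (T - r) <= B -> B <= J h (- (T + r)) (T + r) ->
  `|B - J h (- T) T| <= 2 * r * D.
Proof.
move=> bh hD r0 rT lo up.
have [l1 l2 l3 l4] : [/\ - T <= - (T - r), - (T - r) <= T, - (T - r) <= T - r & T - r <= T].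
  by split; lra.
have [l5 l6 l7 l8] : [/\ - (T + r) <= - T, - T <= T + r, - T <= T & T <= T + r] by split; lra.
have s1 := J_split bh l1 l2; have s2 := J_split bh l3 l4.
have s3 := J_split bh l5 l6; have s4 := J_split bh l7 l8.
have b1 := J_bound bh l1 hD; have b2 := J_bound bh l4 hD.
have b3 := J_bound bh l5 hD; have b4 := J_bound bh l8 hD.
move: b1 b2 b3 b4 lo up; rewrite s3 s4 s1 s2 !ler_norml.
move: (J h (- T) (- (T - r))) (J h (- (T - r)) (T - r)) (J h (T - r) T)
  (J h (- (T + r)) (- T)) (J h T (T + r)) => j1 j2 j3 j4 j5.
move=> /andP[b1 b1'] /andP[b2 b2'] /andP[b3 b3'] /andP[b4 b4'] lo up.
by apply/andP; split; lra.
Qed.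

End BoundedIntegrals.

Section Means.
Context {R : realType}.
Local Notation mu := (@lebesgue_measure R).
Local Notation J f a b := (\int[mu]_(x in `[a, b]) f x).

Lemma uniform_cvgP (F : nat -> R -> R) (h : R -> R) : {uniform, F @ \oo --> h} ->
  forall e, 0 < e -> exists N, forall n, (N <= n)%N -> forall s, `|h s - F n s| < e.
Proof.
move=> Fh eps e0.
have : nbhs (h : {uniform R -> R}) [set k : R -> R | forall s, `|h s - k s| < eps].
  apply/uniform_nbhs; exists [set xy : R * R | ball xy.1 eps xy.2]; split.
    exact: entourage_ball (PosNum e0).
  by move=> k /= H s; exact: H.
by move=> /Fh[N _ H]; exists N => n Nn; exact: H.
Qed.

(** If [g] is unbounded, there are translates whose values at the origin tend to infinity,
    and these have no convergent subsequence. *)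
Lemma uap_bounded_measurable (g : R -> R) : uniformly_almost_periodic g -> bounded_measurable g.
Proof.
move=> [cg ap]; split; first exact: continuous_measurable_fun.
apply: contrapT => nb.
have /choice[t ht] : forall n : nat, exists t, n%:R < `|g t|.
  move=> n; apply: contrapT => H; apply: nb; exists n%:R => x.
  by rewrite leNgt; apply/negP => xn; apply: H; exists x.
have [k [h [kmono /uniform_cvgP/(_ 1 ltr01)[N HN]]]] := ap t.
have kge n : (n <= k n)%N.
  by elim: n => // n IH; exact: (leq_ltn_trans IH (kmono _ _ (ltnSn n))).
pose n := maxn N (Num.bound (`|h 0| + 1)).
have := HN n (leq_maxl _ _) 0; rewrite add0r => hn.
have := ht (k n); have := archi_boundP (addr_ge0 (normr_ge0 (h 0)) ler01).
have : (Num.bound (`|h 0| + 1))%:R <= (k n)%:R :> R.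
  by rewrite ler_nat (leq_trans _ (kge n))// leq_maxr.
have := ler_distD (h 0) (g (t (k n))) 0; rewrite !subr0 distrC.
by move=> *; lra.
Qed.

(** All the blocks of some length [L] have almost the same mean [A], which then is almost
    the mean over any long interval. *)
Definition equimean (f : R -> R) := forall eps : R, 0 < eps -> exists L A : R,
  0 < L /\ forall k : int, `|J f (k%:~R * L) (k%:~R * L + L) - L * A| <= eps * L.

(** The interval [[- n L, n L]] consists of [2 n] blocks, and the rest of [[- T, T]]
    contributes [O (L / T)] to the mean. *)
Lemma equimean_cvg f : bounded_measurable f -> equimean f ->
  cvg ((2 * T)^-1 * J f (- T) T @[T --> +oo]).
Proof.
move=> bf ef; have [_ [M fM]] := bf.
have M0 : 0 <= M by apply: le_trans (fM 0).
apply/cauchy_cvgP/cauchy_exP => eps eps0.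
have e3 : 0 < eps / 3 by rewrite divr_gt0.
have [L [A [L0 hL]]] := ef _ e3.
exists A.
pose B := M + `|A|.
have B0 : 0 <= B by rewrite addr_ge0.
have blocks n : `|J f (- (n%:R * L)) (n%:R * L) - 2 * n%:R * L * A| <= 2 * n%:R * L * (eps / 3).
  elim: n => [|n IH].
    rewrite !mul0r oppr0 mulr0 !mul0r subr0.
    by apply: (le_trans (J_bound bf (lexx 0) fM)); rewrite subrr mulr0.
  have := hL (Posz n); have := hL (- (Posz n.+1)).
  rewrite mulrNz !mulNr -!pmulrn (_ : - (n.+1%:R * L) + L = - (n%:R * L)); last first.
    by rewrite -natr1; ring.
  rewrite (_ : n%:R * L + L = n.+1%:R * L); last by rewrite -natr1; ring.
  have nL : 0 <= n%:R * L by rewrite mulr_ge0// ltW.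
  have nSL : n%:R * L <= n.+1%:R * L by rewrite ler_wpM2r ?ler_nat// ltW.
  rewrite (J_split (a := - (n.+1%:R * L)) (b := - (n%:R * L)) (c := n.+1%:R * L) bf) ?lerN2//; last by lra.
  rewrite (J_split (a := - (n%:R * L)) (b := n%:R * L) (c := n.+1%:R * L) bf)//; last by lra.
  move: (J f (- (n%:R * L)) (n%:R * L)) IH (J f (n%:R * L) _) (J f _ (- (n%:R * L))) => j0 IH j1 j2 h2 h1.
  rewrite -!(@natr1 _ n); move: IH h1 h2; rewrite !ler_norml.
  move: (n%:R * L) (eps / 3) => nl e IH h1 h2.
  rewrite (_ : 2 * (n%:R + 1) * L = 2 * n%:R * L + 2 * L); last by ring.
  lra.
suff : \forall T \near +oo, ball A eps ((2 * T)^-1 * J f (- T) T) by [].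
near=> T.
have TL : L < T by near: T; apply: nbhs_pinfty_gt; exact: num_real.
have T0 : 0 < T by exact: lt_trans TL.
have TB : 3 * L * B / eps < T by near: T; apply: nbhs_pinfty_gt; exact: num_real.
pose n := Num.truncn (T / L).
have /andP[nT Tn] : n%:R <= T / L < n.+1%:R by apply: truncn_itv; rewrite divr_ge0// ltW.
move: nT Tn; rewrite ler_pdivlMr// ltr_pdivrMr// -natr1 mulrDl mul1r => nT Tn.
have nL : 0 <= n%:R * L by rewrite mulr_ge0// ltW.
have := blocks n.
rewrite /ball/= (J_split (a := - T) (b := - (n%:R * L)) (c := T) bf) ?lerN2//; last by lra.
rewrite (J_split (a := - (n%:R * L)) (b := n%:R * L) (c := T) bf)//; last by lra.
have h1 : `|J f (n%:R * L) T| <= M * (T - n%:R * L) by exact: J_bound.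
have h2 : `|J f (- T) (- (n%:R * L))| <= M * (- (n%:R * L) - - T).
  by apply: J_bound => //; rewrite lerN2.
rewrite -(mulrA 2) -(mulrA 2).
move: (n%:R * L) nT Tn nL h1 h2 => nl nT Tn nL.
move: (J f (- nl) nl) (J f nl _) (J f _ (- nl)) => j0 j1 j2 h1 h2 h0.
have -> : A - (2 * T)^-1 * (j2 + (j0 + j1)) = (2 * T)^-1 * (2 * T * A - (j2 + (j0 + j1))).
  by field; rewrite gt_eqF.
rewrite normrM gtr0_norm ?invr_gt0 ?mulr_gt0// mulrC ltr_pdivrMr ?mulr_gt0//.
have Aa : `|2 * (T - nl) * A| <= 2 * (T - nl) * `|A|.
  by rewrite normrM ger0_norm// mulr_ge0// subr_ge0.
apply: (@le_lt_trans _ _ (2 * nl * (eps / 3) + 2 * (T - nl) * B)).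
  rewrite (_ : 2 * T * A - (j2 + (j0 + j1)) = (2 * nl * A - j0) + (2 * (T - nl) * A - j1 - j2)); last by ring.
  apply: (le_trans (ler_normD _ _)); apply: lerD; first by rewrite distrC -(mulrA 2 nl).
  rewrite /B.
  have := ler_normB (2 * (T - nl) * A - j1) j2; have := ler_normB (2 * (T - nl) * A) j1.
  by move=> *; lra.
have : 2 * (T - nl) * B <= 2 * L * B by rewrite ler_wpM2r//; lra.
have : 2 * nl * (eps / 3) <= 2 * T * (eps / 3) by apply: ler_wpM2r; [exact: ltW|lra].
move: TB; rewrite ltr_pdivrMr// => TB *.
have : 0 < T * eps by rewrite mulr_gt0.
lra.
Unshelve. all: by end_near. Qed.

Definition periodic (c : R -> R) (p : R) := forall x, c (x + p) = c x.

Lemma periodic_mul c p (k : int) x : periodic c p -> c (x + k%:~R * p) = c x.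
Proof.
move=> cp; have pos (n : nat) y : c (y + n%:R * p) = c y.
  elim: n y => [|n IH] y; first by rewrite mul0r addr0.
  by rewrite -natr1 mulrDl mul1r addrA cp IH.
case: k => n; first exact: pos.
by rewrite NegzE mulrNz mulNr -pmulrn -[LHS](pos n.+1) subrK.
Qed.

(** Translations by multiples of [p] act on [g] alone. If no block length worked, there
    would be multiples [t n] of [p] such that the blocks of length [(n + 1) p] starting at
    [t n] and at [0] have means at distance more than [eps]. Along a subsequence the
    translates [g (x + t n)] stay uniformly close to a single one of them, so that in
    these blocks [t n] may be replaced by a fixed [tau], and a fixed translation is
    negligible for long blocks. *)
Lemma uap_equimean (g c : R -> R) (p : R) : uniformly_almost_periodic g ->
  bounded_measurable c -> 0 < p -> periodic c p -> equimean (fun x => g x * c x).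
Proof.
move=> ag bc p0 cp; have bg := uap_bounded_measurable ag.
have bf := bmM bg bc; set f := fun x => _ in bf *.
have [_ [M fM]] := bf; have [_ [C cC]] := bc.
have M0 : 0 <= M by apply: le_trans (fM 0).
have C0 : 0 <= C by apply: le_trans (cC 0).
move=> eps eps0.
suff [N N0 hN] : exists2 N : nat, (0 < N)%N & forall k : int,
    `|J f (k%:~R * (N%:R * p)) (k%:~R * (N%:R * p) + N%:R * p) - J f 0 (N%:R * p)|
      <= eps * (N%:R * p).
  have L0 : 0 < N%:R * p by rewrite mulr_gt0// ltr0n.
  exists (N%:R * p), ((N%:R * p)^-1 * J f 0 (N%:R * p)); split => // k.
  by rewrite mulVKf ?gt_eqF.
apply: contrapT => H.
have /choice[k hk] : forall n : nat, exists k : int, eps * (n.+1%:R * p) <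
    `|J f (k%:~R * (n.+1%:R * p)) (k%:~R * (n.+1%:R * p) + n.+1%:R * p) - J f 0 (n.+1%:R * p)|.
  move=> n; apply: contrapT => Hn; apply: H; exists n.+1 => // k.
  by rewrite leNgt; apply/negP => Hk; apply: Hn; exists k.
pose t n := (k n)%:~R * (n.+1%:R * p).
have [_ /(_ t)[ph [h [phmono /uniform_cvgP hcv]]]] := ag.
have phge n : (n <= ph n)%N.
  by elim: n => // n IH; exact: (leq_ltn_trans IH (phmono _ _ (ltnSn n))).
pose d := eps / (8 * (C + 1)).
have d0 : 0 < d by rewrite divr_gt0// mulr_gt0// ltr_wpDl.
have [N HN] := hcv d d0.
have ft n x : f (x + t n) = g (x + t n) * c x.
  rewrite /f; congr (_ * _); rewrite /t mulrA -[n.+1%:R]/(Posz n.+1)%:~R -intrM.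
  exact: periodic_mul.
have sh n L : 0 <= L -> J f (t n) (t n + L) = J (fun x => f (x + t n)) 0 L.
  by move=> L0; rewrite -[X in J f X _]add0r (addrC (t n) L) J_shift.
pose tau := t (ph N).
have close n L : (N <= n)%N -> 0 <= L ->
    `|J f (t (ph n)) (t (ph n) + L) - J f tau (tau + L)| <= eps / 4 * L.
  move=> Nn L0; rewrite !sh//.
  have := @J_dist _ (fun x => f (x + t (ph n))) (fun x => f (x + tau)) 0 L (eps / 4)
    (bm_shift _ bf) (bm_shift _ bf) L0; rewrite subr0; apply => x.
  rewrite /tau !ft -mulrBl normrM.
  have h1 := HN n Nn x; have h2 := HN N (leqnn N) x.
  have h3 : `|g (x + t (ph n)) - g (x + t (ph N))| <= 2 * d.
    by have := ler_distD (h x) (g (x + t (ph n))) (g (x + t (ph N)));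
      rewrite (distrC _ (h x)) => ?; lra.
  apply: (le_trans (ler_pM (normr_ge0 _) (normr_ge0 _) h3 (cC x))).
  rewrite /d; apply: (@le_trans _ _ (2 * (eps / (8 * (C + 1))) * (C + 1))).
    by rewrite ler_wpM2l ?lerDl//; apply: mulr_ge0 => //; exact: ltW.
  by rewrite le_eqVlt; apply/orP; left; apply/eqP; field; rewrite gt_eqF// ltr_wpDl.
have fixed L : 0 <= L -> `|J f tau (tau + L) - J f 0 L| <= 2 * M * `|tau|.
  move=> L0; have [tau0|tau0] := leP 0 tau.
    have e1 : J f 0 (tau + L) = J f 0 tau + J f tau (tau + L).
      by apply: J_split => //; rewrite lerDl.
    have e2 : J f 0 (tau + L) = J f 0 L + J f L (tau + L).
      by apply: J_split => //; rewrite lerDr.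
    have b1 : `|J f 0 tau| <= M * (tau - 0) by exact: J_bound.
    have b2 : `|J f L (tau + L)| <= M * (tau + L - L) by apply: J_bound => //; rewrite lerDr.
    have -> : J f tau (tau + L) - J f 0 L = J f L (tau + L) - J f 0 tau by lra.
    by apply: (le_trans (ler_normB _ _)); rewrite (ger0_norm tau0); lra.
  have e1 : J f tau L = J f tau 0 + J f 0 L by apply: J_split => //; exact: ltW.
  have e2 : J f tau L = J f tau (tau + L) + J f (tau + L) L.
    by apply: J_split => //; [rewrite lerDl|rewrite gerDr ltW].
  have b1 : `|J f tau 0| <= M * (0 - tau) by apply: J_bound => //; exact: ltW.
  have b2 : `|J f (tau + L) L| <= M * (L - (tau + L)) by apply: J_bound => //; rewrite gerDr ltW.
  have -> : J f tau (tau + L) - J f 0 L = J f tau 0 - J f (tau + L) L by lra.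
  by apply: (le_trans (ler_normB _ _)); rewrite (ltr0_norm tau0); lra.
pose n := maxn N (Num.bound (4 * M * `|tau| / (eps * p))).
have ep : 0 < eps * p by rewrite mulr_gt0.
have nb : 4 * M * `|tau| <= eps * ((ph n).+1%:R * p).
  rewrite mulrCA -ler_pdivrMr//; apply/ltW/(lt_le_trans (archi_boundP _)).
    by rewrite divr_ge0// ?mulr_ge0// ltW.
  by rewrite ler_nat (leq_trans (leq_maxr N _))// (leq_trans (phge n)).
set L := (ph n).+1%:R * p in nb.
have L0 : 0 <= L by rewrite mulr_ge0// ltW.
have := hk (ph n); rewrite -/L -/(t (ph n)).
have := close n L (leq_maxl _ _) L0; have := fixed L L0.
have := ler_distD (J f tau (tau + L)) (J f (t (ph n)) (t (ph n) + L)) (J f 0 L).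
move: `|_ - _| `|_ - _| `|_ - _| => x1 x2 x3 *.
have : 0 < eps * L by rewrite mulr_gt0// mulr_gt0// ltr0n.
by lra.
Qed.

Lemma uap_approx_equimean (V c : R -> R) (p : R) : bounded_measurable V ->
  bounded_measurable c -> 0 < p -> periodic c p ->
  (forall eps, 0 < eps -> exists2 g, uniformly_almost_periodic g &
     forall x, `|V x - g x| <= eps) ->
  equimean (fun x => V x * c x).
Proof.
move=> bV bc p0 cp app eps eps0; have [_ [C cC]] := bc.
have C0 : 0 <= C by apply: le_trans (cC 0).
have e2 : 0 < eps / 2 by rewrite divr_gt0.
have d0 : 0 < eps / (2 * (C + 1)) by rewrite divr_gt0// mulr_gt0// ltr_wpDl.
have [g ag Vg] := app _ d0.
have [L [A [L0 hL]]] := uap_equimean ag bc p0 cp e2.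
exists L, A; split => // k.
have bg := uap_bounded_measurable ag.
have := @J_dist _ _ _ (k%:~R * L) (k%:~R * L + L) (eps / 2) (bmM bV bc) (bmM bg bc).
rewrite lerDl ltW// addrAC subrr add0r => /(_ erefl) h.
have {}h := h _; have /h : forall x, `|V x * c x - g x * c x| <= eps / 2.
  move=> x; rewrite -mulrBl normrM; apply: (le_trans (ler_pM (normr_ge0 _) (normr_ge0 _) (Vg x) (cC x))).
  apply: (@le_trans _ _ (eps / (2 * (C + 1)) * (C + 1))).
    by rewrite ler_wpM2l// ?lerDl// ltW.
  by rewrite le_eqVlt; apply/orP; left; apply/eqP; field; rewrite gt_eqF// ltr_wpDl.
have := hL k.
move=> h1 h2; apply: (le_trans (ler_distD (J (fun x => g x * c x) _ _) _ _)).
by apply: (le_trans (lerD h2 h1)); lra.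
Qed.

End Means.

(** * The standard bump on the line and its semiconvexity *)

Section Profile.
Context {R : realType}.

Lemma is_derive_nondecreasing (f df : R -> R) (h : R) : 0 <= h ->
  (forall x, 0 <= x <= h -> is_derive x 1 f (df x)) ->
  (forall x, 0 <= x <= h -> 0 <= df x) -> f 0 <= f h.
Proof.
move=> h0 fdf df0.
have sub x : x \in `]0, h[ -> 0 <= x <= h by rewrite in_itv/= => /andP[/ltW-> /ltW->].
have cf : {within `[0, h], continuous f}.
  apply: derivable_within_continuous => x xh.
  by apply: (@ex_derive _ _ _ _ _ _ _ (fdf x _)); move: xh; rewrite in_itv.
have [x] := MVT_segment h0 (fun x xh => fdf x (sub x xh)) cf.
rewrite in_itv/= subr0 => xh E; rewrite -subr_ge0 E mulr_ge0//; exact: df0.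
Qed.

(** Sturm comparison with [w x = 1 - K x ^ 2 / 2]. While [0 < w <= 1] one has
    [w'' = - K <= - K w], so the Wronskian [g' w - g w'] is nondecreasing; it starts at
    [0], and therefore [g / w] is nondecreasing. *)
Lemma sturm (g g1 g2 : R -> R) (K h : R) : 0 <= K -> 0 <= h ->
  (forall x : R, is_derive x 1 g (g1 x)) -> (forall x : R, is_derive x 1 g1 (g2 x)) ->
  (forall x, 0 <= g x) -> (forall x, - K * g x <= g2 x) -> g1 0 = 0 ->
  (1 - K * h ^+ 2 / 2) * g 0 <= g h.
Proof.
move=> K0 h0 dg dg1 gge0 gK g10.
pose w (x : R) := 1 - K * x ^+ 2 / 2.
have [wh|wh] := leP (w h) 0.
  by apply: le_trans (gge0 h); rewrite mulr_le0_ge0.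
have wpos x : 0 <= x <= h -> 0 < w x.
  move=> /andP[x0 xh]; apply: (lt_le_trans wh); rewrite /w lerD2l lerN2 ler_wpM2r//.
  by rewrite ler_wpM2l// ler_pXn2r// nnegrE.
have dw (x : R) : is_derive x 1 w (- (K * x)).
  have d2 : is_derive x 1 (fun x : R => x ^+ 2) (2 * x).
    apply: DeriveDef; first exact: exprn_derivable.
    by rewrite exp_derive /GRing.scale/= expr1 mulr1.
  have := is_deriveB (is_derive_cst (1 : R) x 1) (is_deriveZ (K / 2) d2).
  rewrite sub0r /GRing.scale/= => H.
  have -> : - (K * x) = - (K / 2 * (2 * x)) by field.
  suff <- : (cst 1 - (K / 2) *: (fun x : R => x ^+ 2)) = w by [].
  by apply/funext => y; rewrite /w !fctE/= /GRing.scale/=; ring.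
pose psi x := g1 x * w x - g x * - (K * x).
have psi0 x : 0 <= x <= h -> 0 <= psi x.
  move=> /andP[x0 xh].
  have dK (y : R) : is_derive y 1 (fun z : R => - (K * z)) (- K).
    have := is_deriveN (is_deriveZ K (is_derive_id y (1 : R))).
    by rewrite /GRing.scale/= mulr1.
  have dpsi (y : R) : is_derive y 1 psi (g2 y * w y + K * g y).
    have := is_deriveB (is_deriveM (dg1 y) (dw y)) (is_deriveM (dg y) (dK y)).
    rewrite /GRing.scale/=; set d := (X in is_derive _ _ _ X) => H.
    suff <- : d = g2 y * w y + K * g y by exact: H.
    by rewrite /d; ring.
  have <- : psi 0 = 0 by rewrite /psi g10 !mulr0 oppr0 mulr0 subr0 mul0r.
  apply: (is_derive_nondecreasing x0 (fun y _ => dpsi y)) => y /andP[y0 yx].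
  have wy : 0 < w y by apply: wpos; rewrite y0 (le_trans yx).
  have w1 : w y <= 1 by rewrite /w gerBl// mulr_ge0// mulr_ge0// sqr_ge0.
  have := ler_wpM2r (ltW wy) (gK y).
  have : 0 <= K * g y * (1 - w y) by rewrite !mulr_ge0// subr_ge0.
  by move=> *; lra.
have dq x : 0 <= x <= h -> is_derive x 1 (fun y => g y * (w y)^-1) (psi x / w x ^+ 2).
  move=> xh; have wx := wpos x xh; have wn0 : w x != 0 by rewrite gt_eqF.
  have dV : is_derive x 1 (fun y => (w y)^-1) (- (w x) ^- 2 * - (K * x)).
    exact: (is_deriveV wn0 (dw x)).
  have := is_deriveM (dg x) dV.
  rewrite /GRing.scale/=; set d := (X in is_derive _ _ _ X) => H.
  suff <- : d = psi x / w x ^+ 2 by exact: H.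
  by rewrite /d /psi; field.
have := is_derive_nondecreasing h0 dq.
have w0 : w 0 = 1 by rewrite /w expr0n/= mulr0 mul0r subr0.
rewrite w0 invr1 mulr1 ler_pdivlMr// -/(w h) mulrC; apply => x xh.
by rewrite divr_ge0 ?psi0// sqr_ge0.
Qed.

(** The standard bump [exp (- 1 / (1 - x ^ 2))]. *)
Definition hat (x : R) : R := flat 0 (1 - x ^+ 2).

Lemma hat_ge0 x : 0 <= hat x. Proof. exact: flat_ge0. Qed.

Lemma hat_out x : 1 <= `|x| -> hat x = 0.
Proof.
move=> x1; apply: flat_le0; rewrite subr_le0 -(real_normK (num_real x)).
by rewrite -(expr1n R 2) ler_pXn2r// nnegrE.
Qed.

Lemma hat_in x : `|x| < 1 -> 0 < hat x.
Proof.
move=> x1; apply: flat_gt0; rewrite subr_gt0 -(real_normK (num_real x)).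
by rewrite -[ltRHS](expr1n R 2) ltr_pXn2r// nnegrE.
Qed.

Lemma hatN x : hat (- x) = hat x. Proof. by rewrite /hat sqrrN. Qed.

Let hat1 (x : R) := - 2 * x * flat 2 (1 - x ^+ 2).
Let hat2 (x : R) := - 2 * flat 2 (1 - x ^+ 2) +
  4 * x ^+ 2 * (flat 4 (1 - x ^+ 2) - 2 * flat 3 (1 - x ^+ 2)).

Let is_derive_flat_comp k (x : R) : is_derive x 1 (fun y => flat k (1 - y ^+ 2))
  ((flat k.+2 (1 - x ^+ 2) - k%:R * flat k.+1 (1 - x ^+ 2)) * (- (2 * x))).
Proof.
have d2 : is_derive x 1 (fun x : R => x ^+ 2) (2 * x).
  apply: DeriveDef; first exact: exprn_derivable.
  by rewrite exp_derive /GRing.scale/= expr1 mulr1.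
have d : is_derive x 1 (fun x : R => 1 - x ^+ 2) (- (2 * x)).
  by have := is_deriveB (is_derive_cst (1 : R) x 1) d2; rewrite sub0r.
exact: (is_derive1_comp (is_derive_flat k _) d).
Qed.

Let is_derive_hat (x : R) : is_derive x 1 hat (hat1 x).
Proof.
have := is_derive_flat_comp 0 x; rewrite mul0r subr0.
by rewrite (_ : _ * _ = hat1 x)// /hat1; ring.
Qed.

Let is_derive_hat1 (x : R) : is_derive x 1 hat1 (hat2 x).
Proof.
have dl : is_derive x 1 (fun y : R => - 2 * y) (- 2).
  by have := is_deriveZ (- 2) (is_derive_id x (1 : R)); rewrite /GRing.scale/= mulr1.
have := is_deriveM dl (is_derive_flat_comp 2 x).
rewrite /GRing.scale/=; set d := (X in is_derive _ _ _ X) => H.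
suff <- : d = hat2 x by exact: H.
by rewrite /d /hat2; ring.
Qed.

(** [hat] is convex near the ends of its support; this is why its second derivative
    is bounded below by a multiple of [hat] itself. *)
Let hat2_ge x : - 16 * hat x <= hat2 x.
Proof.
rewrite /hat2 /hat; have [q0|q0] := leP (1 - x ^+ 2) 0.
  by rewrite !flat_le0// !mulr0 subr0 mulr0 addr0.
rewrite /flat q0; move: (expR_gt0 (- (1 - x ^+ 2)^-1)); move: (expR _) => E E0.
have -> : x ^+ 2 = 1 - (1 - x ^+ 2) by ring.
move: (1 - x ^+ 2) q0 => q q0; rewrite (_ : 1 - (1 - q) = q); last by ring.
rewrite -subr_ge0.
have -> : - 2 * (q ^- 2 * E) + 4 * (1 - q) * (q ^- 4 * E - 2 * (q ^- 3 * E)) - - 16 * (q ^- 0 * E)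
  = E / q ^+ 4 * (16 * q ^+ 4 + 6 * q ^+ 2 - 12 * q + 4).
  by field; rewrite gt_eqF.
apply: mulr_ge0; first by rewrite divr_ge0 ?exprn_ge0// ltW.
(* The last factor is [(4 q ^ 2 - 1) ^ 2 + 14 (q - 3 / 7) ^ 2 + 3 / 7]. *)
have := sqr_ge0 (4 * q ^+ 2 - 1); have := sqr_ge0 (q - 3 / 7).
by rewrite !exprS !expr0 => *; nra.
Qed.

(** As a function of [h], the right-hand side is even and satisfies the differential
    inequality of [sturm] with [K = 16], by [hat2_ge]. *)
Lemma hat_semiconvex x h : (1 - 16 * h ^+ 2 / 2) * (2 * hat x) <= hat (x - h) + hat (x + h).
Proof.
wlog h0 : h / 0 <= h.
  move=> H; have [/H//|h0] := leP 0 h.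
  by have := H (- h); rewrite oppr_ge0 sqrrN opprK (addrC (hat _)) => ->//; exact: ltW.
have dm (t : R) : is_derive t 1 (fun s => x - s) (- 1).
  by have := is_deriveB (is_derive_cst x t 1) (is_derive_id t (1 : R)); rewrite sub0r.
have dp (t : R) : is_derive t 1 (fun s => x + s) 1.
  by have := is_deriveD (is_derive_cst x t 1) (is_derive_id t (1 : R)); rewrite add0r.
pose g s := hat (x - s) + hat (x + s).
pose g1 s := hat1 (x + s) - hat1 (x - s).
pose g2 s := hat2 (x - s) + hat2 (x + s).
have dg (t : R) : is_derive t 1 g (g1 t).
  have := is_deriveD (@is_derive1_comp R hat (fun s => x - s) t _ _ (is_derive_hat (x - t)) (dm t))
    (@is_derive1_comp R hat (fun s => x + s) t _ _ (is_derive_hat (x + t)) (dp t)).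
  by rewrite (_ : _ + _ = g1 t)// /g1; ring.
have dg1 (t : R) : is_derive t 1 g1 (g2 t).
  have := is_deriveB (@is_derive1_comp R hat1 (fun s => x + s) t _ _ (is_derive_hat1 (x + t)) (dp t))
    (@is_derive1_comp R hat1 (fun s => x - s) t _ _ (is_derive_hat1 (x - t)) (dm t)).
  by rewrite (_ : _ - _ = g2 t)// /g2; ring.
have K0 : 0 <= 16 :> R by [].
have g0 : g 0 = 2 * hat x by rewrite /g subr0 addr0; ring.
have := sturm K0 h0 dg dg1; rewrite g0; apply.
- by move=> t; rewrite addr_ge0// hat_ge0.
- by move=> t; rewrite /g /g2 mulrDr lerD// hat2_ge.
- by rewrite /g1 subr0 addr0 subrr.
Qed.

End Profile.

(** * A Harnack inequality on the line *)

Section Comparison.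
Context {R : realType}.
Local Notation mu := (@lebesgue_measure R).

Lemma integral_sin_poly (c0 c1 c2 : R) :
  (\int[mu]_(t in `[0%R, (2 * pi)%R]) (c0 + c1 * sin t + c2 * sin t ^+ 2)%:E =
   (2 * pi * c0 + pi * c2)%:E)%E.
Proof.
pose F (t : R) := (c0 + c2 / 2) * t - c1 * cos t - (c2 / 2) * (sin t * cos t).
have dF (t : R) : is_derive t 1 F (c0 + c1 * sin t + c2 * sin t ^+ 2).
  have := is_deriveB (is_deriveB (is_deriveZ (c0 + c2 / 2) (is_derive_id t (1 : R)))
    (is_deriveZ c1 (is_derive_cos t)))
    (is_deriveZ (c2 / 2) (is_deriveM (is_derive_sin t) (is_derive_cos t))).
  rewrite /GRing.scale/=; set d := (X in is_derive _ _ _ X) => H.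
  suff <- : d = c0 + c1 * sin t + c2 * sin t ^+ 2 by exact: H.
  rewrite /d; have := cos2Dsin2 t; rewrite !exprS !expr0 => E.
  have -> : cos t * cos t = 1 - sin t * sin t :> R by lra.
  by field.
have pi0 : 0 < 2 * pi :> R by rewrite mulr_gt0// pi_gt0.
have cF : continuous F.
  move=> t; apply/differentiable_continuous/derivable1_diffP.
  exact: (@ex_derive _ _ _ _ _ _ _ (dF t)).
rewrite (@continuous_FTC2 _ _ F)//.
- rewrite /F sin0 cos0 mulr_natl sin2pi cos2pi -EFinB; congr EFin.
  by rewrite -mulr_natl; field.
- apply: continuous_subspaceT => t; apply: differentiable_continuous.
  apply/derivable1_diffP.
  by apply: derivableD; [apply: derivableD => //; apply: derivableM => //; exact: derivable_sin
    |apply: derivableM => //; apply: derivableX; exact: derivable_sin].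
- split=> [t _||].
  + exact: (@ex_derive _ _ _ _ _ _ _ (dF t)).
  + by apply: cvg_at_right_filter; exact: cF.
  + by apply: cvg_at_left_filter; exact: cF.
- by move=> t _; rewrite derive1E; exact: (@derive_val _ _ _ _ _ _ _ (dF t)).
Qed.

(** The barrier is the quadratic polynomial [G s = A (1 - s) (1 - s / 2)] with
    [A < N y1]. Averaging it over [x + d sin t] gains [A d ^ 2 / 4], which is more than
    the factor [1 - K rho ^ 2 / 2], [rho = l d], can lose. Hence [N - G] has no negative
    minimum at a point where such averages are allowed. Near [y1] lower semicontinuity
    keeps [N] above [A], and near the other end [G] is small and [N] nonnegative. As the
    minimum need not be attained, the proof uses a point where [N - G] is close to its
    infimum [- m]. *)
Lemma supermean_comparison (N : R -> \bar R) (K y1 l sg : R) :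
  measurable_fun [set: R] N -> (forall y, (0 <= N y)%E) ->
  0 <= K -> 0 < l -> K * l ^+ 2 <= 4^-1 -> sg ^+ 2 = 1 ->
  (forall A : R, (A%:E < N y1)%E -> \forall y \near y1, (A%:E < N y)%E) ->
  (forall s rho, 0 < rho -> rho <= l * s -> rho <= l * (1 - s) ->
    ((1 - K * rho ^+ 2 / 2)%:E *
      \int[mu]_(t in `[0%R, (2 * pi)%R]) N (y1 + sg * l * s + rho * sin t)%R <=
     (2 * pi)%:E * N (y1 + sg * l * s)%R)%E) ->
  forall s, 0 <= s <= 1 ->
    (((1 - s) * (1 - s / 2))%:E * N y1 <= N (y1 + sg * l * s)%R)%E.
Proof.
move=> mN N0 K0 l0 Kl sg1 lsc sm s /andP[s0 s1].
have qle1 (x : R) : 0 <= x <= 1 -> (1 - x) * (1 - x / 2) <= 1.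
  by move=> /andP[x0 x1]; have := ler_piMl x0 x1; lra.
have q0 : 0 <= (1 - s) * (1 - s / 2) by apply: mulr_ge0; lra.
have q1 : (1 - s) * (1 - s / 2) <= 1 by apply: qle1; rewrite s0.
suff main (A : R) : 0 < A -> (A%:E < N y1)%E ->
    ((A * ((1 - s) * (1 - s / 2)))%:E <= N (y1 + sg * l * s)%R)%E.
  have := N0 y1; case E : (N y1) main => [x||]// main.
    rewrite lee_fin le_eqVlt => /predU1P[<-|x0]; first by rewrite mule0.
    case E2 : (N (y1 + sg * l * s)) (N0 (y1 + sg * l * s)) main => [z||]//; last first.
      by move=> *; rewrite leey.
    rewrite !lee_fin => z0 main; apply/ler_addgt0Pr => e e0.
    have [xe|xe] := leP x e.
      apply: (@le_trans _ _ (1 * x)); last by rewrite mul1r; lra.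
      exact: (ler_wpM2r (ltW x0) q1).
    have := main (x - e); rewrite subr_gt0 lte_fin lee_fin ltrBlDr ltrDl => /(_ xe e0).
    rewrite mulrBl => h; have := ler_wpM2l (ltW e0) q1.
    by move: h; move: (_ * (1 - s / 2)) => q *; lra.
  move=> _; have [q00|q00] := eqVneq ((1 - s) * (1 - s / 2)) 0.
    by rewrite q00 mul0e.
  have qp : 0 < (1 - s) * (1 - s / 2) by rewrite lt_def q00.
  case E2 : (N (y1 + sg * l * s)) (N0 (y1 + sg * l * s)) main => [z||]//; last first.
    by move=> *; rewrite leey.
  rewrite lee_fin => z0 /(_ ((z + 1) / ((1 - s) * (1 - s / 2)))).
  rewrite ltry divfK// lee_fin => /(_ _ isT); have : 0 < (z + 1) / ((1 - s) * (1 - s / 2)).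
    by rewrite divr_gt0//; lra.
  by move=> p /(_ p); rewrite -subr_ge0 opprD addNKr oppr_ge0 ler10.
move=> A0 AN; rewrite leNgt; apply/negP => bad.
pose G (s : R) := A * ((1 - s) * (1 - s / 2)).
pose n (s : R) := N (y1 + sg * l * s).
pose E := [set d : R | exists2 s, 0 <= s <= 1 & (n s < (G s + d)%:E)%E].
have GA (x : R) : 0 <= x <= 1 -> 0 <= G x <= A.
  move=> /andP[x0 x1]; rewrite /G; have : 0 <= (1 - x) * (1 - x / 2) by apply: mulr_ge0; lra.
  have := qle1 x; rewrite x0 x1 => /(_ isT).
  move: (_ * (1 - x / 2)) => q q1' q0'; rewrite mulr_ge0 ?(ltW A0)//=.
  by rewrite -[leRHS]mulr1; apply: ler_wpM2l => //; exact: ltW.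
have hE : has_inf E.
  split; first by exists 0, s; rewrite ?s0// addr0.
  exists (- A) => d [x x01]; have := N0 (y1 + sg * l * x); rewrite -/(n x) => nx0.
  move=> /(le_lt_trans nx0); rewrite lte_fin; have := GA x x01; lra.
have iE0 : inf E < 0.
  have [d dn d0] : exists2 d : R, (n s < (G s + d)%:E)%E & d < 0.
    have := N0 (y1 + sg * l * s); move: bad; rewrite -/(n s) -/(G s).
    case: (n s) => [x||]//; rewrite lte_fin => xG _.
    by exists ((x - G s) / 2); rewrite ?lte_fin; lra.
  by apply: le_lt_trans d0; apply: ge_inf; [exact: hE.2|exists s; rewrite ?s0].
pose m := - inf E.
have m0 : 0 < m by rewrite oppr_gt0.
have nG x : 0 <= x <= 1 -> ((G x - m)%:E <= n x)%E.
  move=> x01; rewrite leNgt; apply/negP; rewrite /m opprK => nlt.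
  have [d dn dE] : exists2 d : R, (n x < (G x + d)%:E)%E & d < inf E.
    have := N0 (y1 + sg * l * x); rewrite -/(n x); move: nlt.
    case: (n x) => [v||]//; rewrite lte_fin => vG _.
    by exists ((v - G x + inf E) / 2); rewrite ?lte_fin; lra.
  have : inf E <= d by apply: ge_inf; [exact: hE.2|exists x].
  by rewrite leNgt dE.
have mA : m <= A.
  rewrite /m lerNl; apply: lb_le_inf; first exact: hE.1.
  move=> d [x x01]; have := N0 (y1 + sg * l * x); rewrite -/(n x) => nx0.
  move=> /(le_lt_trans nx0); rewrite lte_fin; have := GA x x01; lra.
have [d1 [d10 d11] hd1] : exists2 d : R, 0 < d /\ d <= 1 & forall x, 0 <= x <= d -> (A%:E <= n x)%E.
  have /nbhs_ballP[e /= e0 he] := lsc A AN.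
  exists (Num.min 1 (e / 2 / l)).
    by rewrite lt_min ltr01 !divr_gt0//= ge_min lexx.
  move=> x /andP[x0]; rewrite le_min ler_pdivlMr// => /andP[_ xe].
  apply/ltW/he; rewrite /ball/= opprD addrA subrr sub0r normrN !normrM.
  have -> : `|sg| = 1 by apply/eqP; rewrite -sqr_norm_eq1 sg1.
  rewrite mul1r !ger0_norm//; last exact: ltW.
  by rewrite mulrC; apply: (le_lt_trans xe); lra.
(* On [[0, d]] one has [N >= A >= G], and on [[1 - d, 1]] one has [G < m / 2]. So the
   points where [N - G] is close to [- m] are at distance at least [d] from the ends. *)
pose d := Num.min d1 (m / (2 * A)) / 2.
have dp : 0 < d by rewrite divr_gt0// lt_min d10 divr_gt0// mulr_gt0.
have dd1 : d < d1.
  have : Num.min d1 (m / (2 * A)) <= d1 by rewrite ge_min lexx.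
  by rewrite /d => ?; lra.
have dmA : d * (2 * A) < m.
  have : Num.min d1 (m / (2 * A)) <= m / (2 * A) by rewrite ge_min lexx orbT.
  rewrite ler_pdivlMr ?mulr_gt0// /d; move: (Num.min _ _) => v hv.
  have : v / 2 * (2 * A) = v * (2 * A) / 2 by field.
  by move=> ->; lra.
clearbody d.
(* Below the net gain [A d ^ 2 / 4 - (d ^ 2 / 8) (5 A / 4) = 3 A d ^ 2 / 32] of the
   averages. *)
pose eta := Num.min (A * d ^+ 2 / 16) (m / 2).
have eta0 : 0 < eta.
  rewrite lt_min; apply/andP; split; last by rewrite divr_gt0.
  by rewrite divr_gt0// mulr_gt0// exprn_gt0.
have [x x01 nx] : exists2 x, 0 <= x <= 1 & (n x < (G x - m + eta)%:E)%E.
  have [e [x x01 nx] ex] := inf_adherent eta0 hE.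
  exists x => //; apply: (lt_trans nx); rewrite lte_fin; move: ex; rewrite /m; lra.
have etaA : eta <= A * d ^+ 2 / 16 by rewrite ge_min lexx.
have etam : eta <= m / 2 by rewrite ge_min lexx orbT.
have dx : d <= x.
  rewrite leNgt; apply/negP => xd; move: nx; apply/negP; rewrite -leNgt.
  have xd1 : 0 <= x <= d1 by case/andP: x01 => -> _; rewrite ltW// (lt_trans xd).
  apply: (le_trans _ (hd1 x xd1)); rewrite lee_fin.
  by have := GA x x01; lra.
have dx1 : d <= 1 - x.
  rewrite leNgt; apply/negP => xd; move: nx; apply/negP; rewrite -leNgt.
  apply: (le_trans _ (N0 _)); rewrite lee_fin.
  have : G x <= A * (1 - x).
    by rewrite /G; apply: ler_wpM2l; [exact: ltW|case/andP: x01 => ? ?; nra].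
  have : A * (1 - x) <= A * d by apply: ler_wpM2l; exact: ltW.
  by move=> *; lra.
have rho0 : 0 < l * d by exact: mulr_gt0.
have := sm x (l * d) rho0 (ler_wpM2l (ltW l0) dx) (ler_wpM2l (ltW l0) dx1).
apply/negP; rewrite -ltNge.
have d_le1 : d <= 1 by lra.
have pi0 : 0 < 2 * pi :> R by rewrite mulr_gt0// pi_gt0.
pose X := G x - m.
have Kd : K * (l * d) ^+ 2 / 2 <= d ^+ 2 / 8.
  have -> : K * (l * d) ^+ 2 / 2 = K * l ^+ 2 * (d ^+ 2 / 2) by rewrite exprMn; ring.
  apply: (@le_trans _ _ (4^-1 * (d ^+ 2 / 2))); last lra.
  by apply: ler_wpM2r => //; rewrite divr_ge0// sqr_ge0.
have Kd0 : 0 <= K * (l * d) ^+ 2 / 2.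
  by apply: divr_ge0 => //; apply: mulr_ge0 => //; exact: sqr_ge0.
have d2 : 0 < d ^+ 2 by rewrite exprn_gt0.
have d21 : d ^+ 2 <= 1 by rewrite expr_le1// ltW.
have lower : ((2 * pi * (X + A * d ^+ 2 / 4))%:E <=
  \int[mu]_(t in `[0%R, (2 * pi)%R]) N (y1 + sg * l * x + l * d * sin t)%R)%E.
  pose g (t : R) := N (y1 + sg * l * x + l * d * sin t).
  have mg : measurable_fun [set: R] g.
    apply: measurableT_comp => //; apply: measurable_funD => //.
    apply: measurable_funM => //; apply: continuous_measurable_fun; exact: continuous_sin.
  have Gg (t : R) : ((G x + (sg * d * A * (x - 3 / 2)) * sin t + (A * d ^+ 2 / 2) * sin t ^+ 2)%:E
      <= g t + m%:E)%E /\ 0 <= G x + (sg * d * A * (x - 3 / 2)) * sin t + (A * d ^+ 2 / 2) * sin t ^+ 2.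
    have -> : G x + (sg * d * A * (x - 3 / 2)) * sin t + (A * d ^+ 2 / 2) * sin t ^+ 2
        = G (x + sg * d * sin t).
      have -> : A * d ^+ 2 / 2 * sin t ^+ 2 = A * sg ^+ 2 * d ^+ 2 / 2 * sin t ^+ 2.
        by rewrite sg1 mulr1.
      by rewrite /G; field.
    have -> : g t = n (x + sg * d * sin t).
      rewrite /g /n; congr N.
      have -> : sg * l * (x + sg * d * sin t) = sg * l * x + sg ^+ 2 * (l * d * sin t) by ring.
      by rewrite sg1 mul1r addrA.
    have : 0 <= x + sg * d * sin t <= 1.
      have : `|sg * d * sin t| <= d.
        have sgn : `|sg| = 1 by apply/eqP; rewrite -sqr_norm_eq1 sg1.
        rewrite !normrM sgn mul1r (gtr0_norm dp); apply: ler_piMr; first exact: ltW.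
        by rewrite ler_norml sin_geN1 sin_le1.
      by rewrite ler_norml => /andP[? ?]; apply/andP; split; lra.
    move=> h; split; last by case/andP: (GA _ h).
    by have := nG _ h; rewrite -leeBlDr// -EFinB.
  have : (\int[mu]_(t in `[0%R, (2 * pi)%R]) (G x + (sg * d * A * (x - 3 / 2)) * sin t +
      (A * d ^+ 2 / 2) * sin t ^+ 2)%:E <= \int[mu]_(t in `[0%R, (2 * pi)%R]) (g t + m%:E))%E.
    apply: ge0_le_integral => //.
    - by move=> t _; rewrite lee_fin; have [] := Gg t.
    - apply/measurable_EFinP; apply: measurable_funTS.
      have ms : measurable_fun [set: R] (@sin R).
        by apply: continuous_measurable_fun; exact: continuous_sin.
      apply: measurable_funD; first by apply: measurable_funD => //; exact: measurable_funM.
      by apply: measurable_funM => //; exact: measurable_funX.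
    - by apply: emeasurable_funD => //; exact: measurable_funTS.
    - by move=> t _; have [] := Gg t.
  rewrite integral_sin_poly ge0_integralD//; last 3 first.
  - by move=> t _; exact: N0.
  - exact: measurable_funTS.
  - by move=> t _; rewrite lee_fin ltW.
  have mI : (mu `[0%R, (2 * pi)%R]%classic = (2 * pi)%:E)%E.
    by rewrite lebesgue_measure_itv/= lte_fin pi0 oppr0 adde0.
  rewrite integral_cst// [X in (m%:E * X)%E](_ : _ = (2 * pi)%:E); last exact: mI.
  rewrite -EFinM -leeBlDr// -EFinB; apply: le_trans.
  by rewrite lee_fin le_eqVlt /X; apply/orP; left; apply/eqP; field.
case En : (n x) nx (N0 (y1 + sg * l * x)) => [v||]; rewrite -/(n x) En//.
rewrite lte_fin lee_fin => nx v0.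
apply: (@lt_le_trans _ _ ((1 - K * (l * d) ^+ 2 / 2) * (2 * pi * (X + A * d ^+ 2 / 4)))%:E); last first.
  by rewrite EFinM; apply: lee_wpmul2l => //; rewrite lee_fin; lra.
rewrite -EFinM lte_fin (mulrCA _ (2 * pi)) ltr_pM2l//.
have XA : X < A by have := GA x x01; rewrite /X; lra.
have vX : v < X + A * d ^+ 2 / 16 by rewrite /X; lra.
have Ad : 0 < A * d ^+ 2 by exact: mulr_gt0.
move: Kd Kd0; move: (K * (l * d) ^+ 2 / 2) => k kd k0.
have X0 : 0 <= X + A * d ^+ 2 / 4 by lra.
have : k * (X + A * d ^+ 2 / 4) <= d ^+ 2 / 8 * (A * (5 / 4)).
  by apply: ler_pM => //; nra.
by move=> *; lra.
Qed.

End Comparison.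

(** * Horizontal slices of a superharmonic function *)

Section CircleReflection.
Context {R : realType}.
Local Notation mu := (@lebesgue_measure R).

Lemma ge0_integral_flip (k : R -> \bar R) (p : R) : measurable_fun [set: R] k ->
  (forall x, (0 <= k x)%E) ->
  (\int[mu]_(t in `[0%R, p]) k (p - t)%R = \int[mu]_(t in `[0%R, p]) k t)%E.
Proof.
move=> mk k0; rewrite integral_mkcond [RHS]integral_mkcond.
have mK : measurable_fun [set: R] (k \_ `[0, p]).
  by apply/(measurable_restrictT _ _).1 => //; exact: measurable_funTS.
have K0 x : (0 <= (k \_ `[0%R, p]) x)%E by apply: erestrict_ge0.
rewrite -[RHS](ge0_integralDx p)// -[RHS]ge0_integralNx//; last first.
  by apply: measurableT_comp => //; exact: measurable_funD.
apply: eq_integral => x _; rewrite /patch (addrC p) !mem_setE !in_itv/=.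
by rewrite (_ : (0 <= - x + p) && (- x + p <= p) = (0 <= x <= p))//; apply/idP/idP; lra.
Qed.

(** On angles, [pi - t] is the reflection of the plane in the vertical axis. *)
Lemma ge0_integral_circle_reflect (g : R -> \bar R) : measurable_fun [set: R] g ->
  (forall x, (0 <= g x)%E) -> (forall x, g (x + 2 * pi) = g x) ->
  (\int[mu]_(t in `[0%R, (2 * pi)%R]) g (pi - t)%R = \int[mu]_(t in `[0%R, (2 * pi)%R]) g t)%E.
Proof.
move=> mg g0 gp; have p0 : 0 <= pi :> R := pi_ge0 R.
rewrite -(ge0_integral_period_shift (c := pi) mg g0 gp); last first.
  by rewrite p0 mulr_natl mulr2n lerDl.
rewrite -[RHS]ge0_integral_flip//; last first.
  by apply: measurableT_comp => //; exact: measurable_funD.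
apply: eq_integral => t _; rewrite -[in RHS]gp.
rewrite -[LHS]gp -[LHS]gp; congr g; ring.
Qed.

End CircleReflection.

Section Slice.
Context {R : realType}.
Local Notation mu := (@lebesgue_measure R).
Variables (f : R * R -> \bar R) (chi : R -> R) (K : R).
Hypotheses (mf : measurable_fun setT f) (f0 : forall z, (0 <= f z)%E).
Hypotheses (mchi : measurable_fun setT chi) (chi0 : forall x, 0 <= chi x).
Hypotheses (K0 : 0 <= K)
  (chiK : forall x h, (1 - K * h ^+ 2 / 2) * (2 * chi x) <= chi (x - h) + chi (x + h)).

Definition slice (y : R) : \bar R := (\int[mu]_x ((chi x)%:E * f (x, y)))%E.

Let mfy y : measurable_fun setT (fun x => f (x, y)).
Proof. exact: measurableT_comp mf (pair2_measurable y). Qed.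

Let mcf y : measurable_fun setT (fun x => (chi x)%:E * f (x, y))%E.
Proof. by apply: emeasurable_funM => //; apply/measurable_EFinP. Qed.

Let cf0 x y : (0 <= (chi x)%:E * f (x, y))%E.
Proof. by apply: mule_ge0 => //; rewrite lee_fin. Qed.

Let sliceZ (k : R) y : 0 <= k ->
  (\int[mu]_x (k%:E * ((chi x)%:E * f (x, y))) = k%:E * slice y)%E.
Proof.
move=> k0; apply: ge0_integralZl => //; exact: mcf.
Qed.

Lemma measurable_slice : measurable_fun [set: R] slice.
Proof.
apply: (@measurable_fun_fubini_tonelli_G _ _ _ _ R mu (fun z : R * R => (chi z.1)%:E * f z)%E).
  by apply: emeasurable_funM => //; apply/measurable_EFinP; exact: measurableT_comp.
by move=> z; apply: mule_ge0 => //; rewrite lee_fin.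
Qed.

Lemma slice_ge0 y : (0 <= slice y)%E.
Proof. by apply: integral_ge0 => x _; apply: mule_ge0 => //; rewrite lee_fin. Qed.

(** In the mean of [f] over the circle, integrated against [chi], the horizontal
    displacement [rho cos t] is moved from [f] to [chi] by translation. The two points of
    the circle at the same height have opposite displacements, so that [chi] enters as
    [chi (x - rho cos t) + chi (x + rho cos t)], which semiconvexity bounds from below by
    a multiple of [chi x]. *)
Lemma slice_supermean y rho : 0 < rho -> K * rho ^+ 2 / 2 <= 1 ->
  (forall x, (\int[mu]_(t in `[0%R, (2 * pi)%R]) f (circle_point (x, y) rho t) <=
     (2 * pi)%:E * f (x, y))%E) ->
  ((1 - K * rho ^+ 2 / 2)%:E *
    \int[mu]_(t in `[0%R, (2 * pi)%R]) slice (y + rho * sin t)%R <=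
    (2 * pi)%:E * slice y)%E.
Proof.
move=> rho0 Krho smf.
have pi0 : 0 < 2 * pi :> R by rewrite mulr_gt0// pi_gt0.
have msin : measurable_fun [set: R] (@sin R).
  by apply: continuous_measurable_fun; exact: continuous_sin.
have mcos : measurable_fun [set: R] (@cos R).
  by apply: continuous_measurable_fun; exact: continuous_cos.
have ms : measurable_fun [set: R] (fun t => slice (y + rho * sin t)).
  apply: (measurableT_comp measurable_slice).
  by apply: measurable_funD => //; exact: measurable_funM.
have ptw x t : ((2 * (1 - K * rho ^+ 2 / 2))%:E * ((chi x)%:E * f (x, y + rho * sin t)%R) <=
    (chi (x - rho * cos t)%R)%:E * f (x, y + rho * sin t)%R +
    (chi (x + rho * cos t)%R)%:E * f (x, y + rho * sin t)%R)%E.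
  rewrite muleA -ge0_muleDl ?lee_fin//; apply: lee_wpmul2r => //.
  rewrite -EFinM -EFinD lee_fin; apply: le_trans (chiK x (rho * cos t)).
  have h : K * (rho * cos t) ^+ 2 <= K * rho ^+ 2.
    have c1 : cos t ^+ 2 <= 1 by rewrite -(cos2Dsin2 t) lerDl sqr_ge0.
    by apply: ler_wpM2l => //; rewrite exprMn; apply: ler_piMr; rewrite ?sqr_ge0.
  have : 0 <= chi x * (K * rho ^+ 2 - K * (rho * cos t) ^+ 2) by rewrite mulr_ge0// subr_ge0.
  by lra.
have mch s : measurable_fun setT (fun x : R => (chi (x + s)%R)%:E).
  apply/measurable_EFinP; apply: (measurableT_comp mchi).
  exact: measurable_funD.
pose g (z : R * R) : \bar R := ((chi (z.1 - rho * cos z.2))%:E * f (z.1, y + rho * sin z.2)%R)%E.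
have g0 z : (0 <= g z)%E by apply: mule_ge0 => //; rewrite lee_fin.
have m1 : measurable_fun setT (fun z : R * R => z.1 - rho * cos z.2).
  apply: measurable_funB => //; apply: measurable_funM => //.
  exact: measurableT_comp.
have mg : measurable_fun setT g.
  apply: emeasurable_funM; first by apply/measurable_EFinP; exact: measurableT_comp.
  apply: (measurableT_comp mf); apply: measurable_fun_pair => //.
  apply: measurable_funD => //; apply: measurable_funM => //; exact: measurableT_comp.
(* [Q t] and, further down, [P t] belong to the two opposite displacements; reflecting
   the circle exchanges them. *)
pose Q (t : R) : \bar R := (\int[mu]_x g (x, t))%E.
have mQ : measurable_fun [set: R] Q.
  exact: (@measurable_fun_fubini_tonelli_G _ _ _ _ R mu g).
have Q0 t : (0 <= Q t)%E by exact: integral_ge0.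
have Qp t : Q (t + 2 * pi) = Q t.
  by apply: eq_integral => x _; rewrite /g/= mulr_natl cosD2pi sinD2pi.
have Qle : (\int[mu]_(t in `[0%R, (2 * pi)%R]) Q t <= (2 * pi)%:E * slice y)%E.
  pose I : set R := `[0, 2 * pi]%classic.
  pose H (z : R * R) : \bar R := ((\1_I z.2)%:E *
    ((chi z.1)%:E * f (z.1 + rho * cos z.2, y + rho * sin z.2)%R))%E.
  have mI1 : measurable_fun setT (\1_I : R -> R).
    by apply: measurable_indic; exact: measurable_itv.
  have mcirc : measurable_fun setT (fun z : R * R =>
      f (z.1 + rho * cos z.2, y + rho * sin z.2)%R).
    apply: (measurableT_comp mf); apply: measurable_fun_pair.
      apply: measurable_funD => //; apply: measurable_funM => //; exact: measurableT_comp.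
    apply: measurable_funD => //; apply: measurable_funM => //; exact: measurableT_comp.
  have mH : measurable_fun setT H.
    apply: emeasurable_funM; first by apply/measurable_EFinP; exact: measurableT_comp.
    by apply: emeasurable_funM => //; apply/measurable_EFinP; exact: measurableT_comp.
  have H0 z : (0 <= H z)%E.
    by apply: mule_ge0; rewrite ?lee_fin//; apply: mule_ge0; rewrite ?lee_fin.
  have -> : (\int[mu]_(t in `[0%R, (2 * pi)%R]) Q t = \int[mu]_t \int[mu]_x H (x, t))%E.
    rewrite integral_mkcond; apply: eq_integral => t _; rewrite patchE /H/=.
    case: ifPn => tI; last first.
      by under eq_integral do rewrite indicE (negbTE tI) mul0e; rewrite integral0.
    under [RHS]eq_integral do rewrite indicE tI mul1e.
    rewrite /Q -[LHS](ge0_integralDx (rho * cos t)); last 2 first.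
    - exact: measurableT_comp mg (pair2_measurable t).
    - by move=> x.
    by apply: eq_integral => x _; rewrite /g/= addrK.
  have FT : (\int[mu]_x \int[mu]_t H (x, t) = \int[mu]_t \int[mu]_x H (x, t))%E.
    exact: (@fubini_tonelli _ _ _ _ R mu mu H).
  rewrite -sliceZ; last exact: ltW.
  rewrite -FT {FT}.
  apply: ge0_le_integral => //.
  - by move=> x _; exact: integral_ge0.
  - exact: (@measurable_fun_fubini_tonelli_F _ _ _ _ R mu H).
  - apply: emeasurable_funM; [exact: measurable_cst|exact: mcf].
  move=> x _; rewrite muleCA.
  have HE : (\int[mu]_t H (x, t) = (chi x)%:E * \int[mu]_(t in I) f (circle_point (x, y) rho t))%E.
    transitivity (\int[mu]_(t in I) ((chi x)%:E * f (circle_point (x, y) rho t)))%E; last first.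
      apply: ge0_integralZl => //; [exact: measurable_itv| |by rewrite lee_fin].
      apply: measurable_funTS; apply: (measurableT_comp mf).
      exact: (measurable_circle_point (x, y) rho).
    rewrite [RHS]integral_mkcond; apply: eq_integral => t _; rewrite patchE /H/= indicE.
    by case: ifPn => tI; rewrite ?mul1e// mul0e.
  by rewrite HE; apply: lee_wpmul2l; rewrite ?lee_fin.
pose P (t : R) : \bar R := (\int[mu]_x ((chi (x + rho * cos t))%:E * f (x, y + rho * sin t)%R))%E.
have PQ t : P t = Q (pi - t).
  apply: eq_integral => x _; rewrite /g/=.
  have -> : cos (pi - t) = - cos t :> R by rewrite -cosN opprB -(@cosDpi _ t) -(@cosD2pi _ (t - pi)); congr cos; ring.
  have -> : sin (pi - t) = sin t :> R by rewrite -[LHS]opprK -sinN opprB -[RHS]opprK -(@sinDpi _ t) -(@sinD2pi _ (t - pi)); congr (- sin _); ring.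
  by rewrite mulrN opprK.
have mP : measurable_fun [set: R] P.
  rewrite (_ : P = Q \o (fun t => pi - t)); last by apply/funext => t; exact: PQ.
  by apply: measurableT_comp => //; exact: measurable_funB.
have P0 t : (0 <= P t)%E by rewrite PQ.
have IPQ : (\int[mu]_(t in `[0%R, (2 * pi)%R]) P t = \int[mu]_(t in `[0%R, (2 * pi)%R]) Q t)%E.
  by under eq_integral do rewrite PQ; exact: ge0_integral_circle_reflect.
have w0 : 0 <= 1 - K * rho ^+ 2 / 2 by lra.
have low t : ((2 * (1 - K * rho ^+ 2 / 2))%:E * slice (y + rho * sin t) <= Q t + P t)%E.
  rewrite -sliceZ; last by rewrite mulr_ge0.
  have m1' : measurable_fun setT (fun x : R => (chi (x - rho * cos t)%R)%:E * f (x, y + rho * sin t)%R)%E.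
    apply: emeasurable_funM; [exact: mch|exact: mfy].
  have m2' : measurable_fun setT (fun x : R => (chi (x + rho * cos t)%R)%:E * f (x, y + rho * sin t)%R)%E.
    apply: emeasurable_funM; [exact: mch|exact: mfy].
  rewrite /Q /P /g /= -ge0_integralD; [|by []|by move=> x _; apply: mule_ge0; [rewrite lee_fin; exact: chi0|exact: f0]|exact: m1'|by move=> x _; apply: mule_ge0; [rewrite lee_fin; exact: chi0|exact: f0]|exact: m2'].
  apply: ge0_le_integral; [exact: measurableT| | | |].
  - by move=> x _; apply: mule_ge0; [rewrite lee_fin mulr_ge0|].
  - by apply: emeasurable_funM; [exact: measurable_cst|exact: mcf].
  - exact: emeasurable_funD.
  by move=> x _; exact: ptw.
clearbody P; clearbody Q.
have two : ((2 : R)%:E * ((1 - K * rho ^+ 2 / 2)%:E *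
    \int[mu]_(t in `[0%R, (2 * pi)%R]) slice (y + rho * sin t)%R) <=
    2%:E * ((2 * pi)%:E * slice y))%E.
  rewrite muleA -EFinM -ge0_integralZl//; last 3 first.
  - exact: measurable_funTS.
  - by move=> t _; exact: slice_ge0.
  - by rewrite lee_fin mulr_ge0.
  apply: (@le_trans _ _ (\int[mu]_(t in `[0%R, (2 * pi)%R]) (Q t + P t))%E).
    apply: ge0_le_integral; [exact: measurable_itv| | | |].
    - by move=> t _; apply: mule_ge0; [rewrite lee_fin mulr_ge0|exact: slice_ge0].
    - by apply: emeasurable_funM => //; exact: measurable_funTS.
    - by apply: emeasurable_funD; exact: measurable_funTS.
    by move=> t _; exact: low.
  rewrite ge0_integralD//; [|exact: measurable_funTS..].
  rewrite IPQ (_ : 2%:E = 1 + 1)%E// ge0_muleDl// mul1e.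
  exact: leeD.
by move: two; rewrite lee_pmul2l// lte_fin.
Qed.

(** Fatou's lemma along a sequence of heights that tends to [y]. *)
Lemma slice_lsc y :
  (forall x (c : R), (c%:E < f (x, y))%E -> \forall y' \near y, (c%:E < f (x, y'))%E) ->
  forall A : R, (A%:E < slice y)%E -> \forall y' \near y, (A%:E < slice y')%E.
Proof.
move=> lf A; apply: contraPP => nA; apply/negP; rewrite -leNgt.
have /choice[s hs] : forall n : nat, exists t, `|y - t| < n.+1%:R^-1 /\ (slice t <= A%:E)%E.
  move=> n; apply: contrapT => H; apply: nA; apply/nbhs_ballP; exists n.+1%:R^-1 => /=.
    by rewrite invr_gt0.
  move=> t; rewrite /ball/= => yt; rewrite ltNge; apply/negP => tA; apply: H.
  by exists t.
have sy : s n @[n --> \oo] --> y.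
  apply/cvgrPdist_lt => e e0; near=> n; apply: (lt_trans (hs n).1).
  near: n; exact: near_infty_natSinv_lt (PosNum e0).
have Fa := @fatou _ _ R mu setT measurableT (fun n x => (chi x)%:E * f (x, s n))%E.
apply: (@le_trans _ _ (limn_einf (fun n => slice (s n)))); last first.
  rewrite limn_einf_lim; apply: lime_le; first exact: is_cvg_einfs.
  apply: nearW => n; apply: (le_trans _ (hs n).2).
  by apply: ereal_inf_lbound; exists n => //=.
apply: (le_trans _ (Fa _ _)); last 2 first.
- by move=> n; exact: mcf.
- by move=> n x _; exact: cf0.
apply: ge0_le_integral => //.
- exact: mcf.
- rewrite (_ : (fun x => _) = (fun x =>
      - limn_esup (fun n => - ((chi x)%:E * f (x, s n))))%E); last first.
    by apply/funext => x; rewrite -limn_einfN; congr limn_einf; apply/funext => n /=; rewrite oppeK.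
  apply: measurableT_comp; first exact: oppe_measurable.
  apply: measurable_fun_limn_esup => n.
  apply: measurableT_comp; [exact: oppe_measurable|exact: mcf].
move=> x _.
have key (c : R) : (c%:E < (chi x)%:E * f (x, y))%E ->
    (c%:E <= limn_einf (fun n => (chi x)%:E * f (x, s n)))%E.
  move=> cf; have [N _ hN] : \forall n \near \oo, (c%:E <= (chi x)%:E * f (x, s n))%E.
    have := chi0 x; rewrite le_eqVlt => /predU1P[x0|x0].
      by move: cf; rewrite -x0 mul0e => cf; apply: nearW => n; rewrite mul0e ltW.
    have h : ((chi x)^-1%:E * c%:E < f (x, y))%E.
      by rewrite -[ltRHS]mul1e -(mulVf (lt0r_neq0 x0)) EFinM -muleA lte_pmul2l// lte_fin invr_gt0.
    have Hn : \forall n \near \oo, (((chi x)^-1 * c)%:E < f (x, s n))%E.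
      exact: (sy _ (lf x ((chi x)^-1 * c) h)).
    apply: filterS Hn => n /= hn.
    by rewrite -[leLHS]mul1e -(mulfV (lt0r_neq0 x0)) EFinM -muleA lee_pmul2l ?lte_fin// -EFinM ltW.
  rewrite limn_einf_lim; apply: lime_ge; first exact: is_cvg_einfs.
  exists N => // n /= Nn; apply: le_ereal_inf_tmp => _ [m /= nm <-].
  by apply: hN; exact: leq_trans nm.
have : (0 <= (chi x)%:E * f (x, y))%E by apply: mule_ge0; rewrite ?lee_fin.
case: ((chi x)%:E * f (x, y))%E key => [r||]// key _.
  by apply/lee_subgt0Pr => e e0; apply: key; rewrite lte_fin ltrBlDr ltrDl.
by rewrite (eq_infty (x := limn_einf _))// => r; apply: key; rewrite ltry.
Unshelve. all: by end_near. Qed.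

End Slice.

(** * The gliding hump *)

Section GlidingHump.
Context {R : realType}.
Variable a : nat -> nat -> R.

Let w (j : nat) : R := 3^-1 ^+ j.

Let sg (k : nat) (e : nat -> R) : R := if 0 <= e k * a k k then 1 else -1.

(** The partial sums of the series of the [c_j a_ij], where [|c_j| = 3 ^- j] and the sign
    of [c_j] is chosen so that in row [j] the term [c_j a_jj] does not decrease the
    modulus of the sum of the terms before it. *)
Fixpoint hump_sum (k : nat) : nat -> R :=
  if k is k'.+1 then
    fun i => hump_sum k' i + sg k' (hump_sum k') * w k' * a i k'
  else fun=> 0.

Definition hump_coef (k : nat) : R := sg k (hump_sum k) * w k.

Lemma hump_sumE i k : hump_sum k i = series (fun j => hump_coef j * a i j) k.
Proof.
elim: k => [|k IH]; first by rewrite /series/= big_nil.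
by rewrite seriesSr -IH.
Qed.

Lemma norm_hump_coef k : `|hump_coef k| = w k.
Proof.
by rewrite /hump_coef /sg normrM [X in _ * X]ger0_norm ?exprn_ge0 ?invr_ge0//; case: ifP;
  rewrite ?normrN normr1 mul1r.
Qed.

Lemma hump_coef_summable : cvgn (series (fun j => `|hump_coef j|)).
Proof.
under eq_fun do rewrite norm_hump_coef.
rewrite (_ : (fun j => w j) = geometric 1 3^-1); last by apply/funext => j; rewrite /= mul1r.
by apply: is_cvg_geometric_series; rewrite ger0_norm ?invr_ge0// invf_lt1// ltr1n.
Qed.

(** In row [k] the terms up to the diagonal sum to at least [3 ^- k |a_kk|] in modulus, by
    the choice of signs. The terms after the diagonal sum to at most [3 / 4] of this,
    since [3 / 2 (1 / 3 + 1 / 9 + ...) = 3 / 4]. What remains is at least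
    [(4 / 3) ^ k / 4]. *)
Lemma gliding_hump :
  (forall k j, `|a k j| <= 3 / 2 * `|a k k|) -> (forall k, 4 ^+ k <= `|a k k|) ->
  forall M, exists k, M < `|wsum hump_coef (a k)|.
Proof.
move=> adom abig M.
have tail k n : `|series (fun j => hump_coef j * a k j) (k.+1 + n)%N -
    series (fun j => hump_coef j * a k j) k.+1| <=
    `|a k k| * w k * (3 / 4) * (1 - w n).
  elim: n => [|n IH]; first by rewrite addn0 subrr normr0 /w expr0 subrr mulr0.
  rewrite addnS seriesSr addrAC; apply: (le_trans (ler_normD _ _)).
  have h : `|hump_coef (k.+1 + n)%N * a k (k.+1 + n)%N| <= w (k.+1 + n)%N * (3 / 2 * `|a k k|).
    by rewrite normrM norm_hump_coef ler_wpM2l// exprn_ge0// invr_ge0.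
  have E : w (k.+1 + n)%N = w k * w n / 3 by rewrite /w addSn exprS exprD; ring.
  have F : w n.+1 = w n / 3 by rewrite /w exprS; ring.
  move: h; rewrite E F; move: IH; set s := `|series _ _ - _|; set b := `|hump_coef _ * _|.
  by move=> h1 h2; apply: (le_trans (lerD h1 h2)); rewrite le_eqVlt; apply/orP; left; apply/eqP; field.
have low k : `|a k k| * w k / 4 <= `|wsum hump_coef (a k)|.
  have w0 : 0 < w k by rewrite exprn_gt0// invr_gt0.
  have h1 : `|a k k| * w k <= `|hump_sum k.+1 k|.
    have same (h s : R) : 0 <= h * s -> `|s| <= `|h + s|.
      move=> hs; rewrite -ler_sqr ?nnegrE// !real_normK ?num_real// sqrrD.
      by have := sqr_ge0 h; lra.
    have n1 : `|a k k| * w k = `|hump_coef k * a k k| by rewrite normrM norm_hump_coef mulrC.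
    rewrite n1 /= -/(hump_coef k); apply: same.
    rewrite /hump_coef /sg; case: ifPn => s.
      by rewrite mul1r mulrCA mulr_ge0// ltW.
    rewrite mulN1r mulNr mulrN mulrCA oppr_ge0 pmulr_rle0//.
    by rewrite leNgt; apply: contra s => /ltW.
  have h2 : `|wsum hump_coef (a k) - hump_sum k.+1 k| <= `|a k k| * w k * (3 / 4).
    have c := cvg_wsum hump_coef_summable (adom k).
    have c2 : series (fun j => hump_coef j * a k j) (n + k.+1)%N @[n --> \oo] --> wsum hump_coef (a k).
      by rewrite (@cvg_shiftn k.+1).
    rewrite hump_sumE.
    have c3 : `|series (fun j => hump_coef j * a k j) (n + k.+1)%N -
        series (fun j => hump_coef j * a k j) k.+1| @[n --> \oo] -->
        `|wsum hump_coef (a k) - series (fun j => hump_coef j * a k j) k.+1|.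
      by apply: cvg_norm; apply: cvgB => //; exact: cvg_cst.
    rewrite -(cvg_lim _ c3)//; apply: limr_le; first by apply/cvg_ex; eexists; exact: c3.
    apply: nearW => n; rewrite addnC; apply: (le_trans (tail k n)).
    by apply: ler_piMr; [rewrite !mulr_ge0// ltW|rewrite lerBlDr lerDl exprn_ge0// invr_ge0].
  move: h1 h2; move: (hump_sum k.+1 k) (wsum hump_coef (a k)) (`|a k k| * w k) => x y A h1 h2.
  by have := ler_normD (x - y) y; rewrite subrK (distrC x y); lra.
have [k kM] : exists k : nat, M < (4 / 3) ^+ k / 4.
  have [k kE] : exists k : nat, 12 * (`|M| + 1) < k%:R.
    by exists (Num.truncn (12 * (`|M| + 1))).+1; exact: truncnS_gt.
  exists k.
  have : 1 + k%:R * 3^-1 <= (4 / 3 : R) ^+ k.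
    rewrite (_ : 4 / 3 = 1 + 3^-1 :> R); last by field.
    elim: k {kE} => [|n IH]; first by rewrite mul0r addr0.
    rewrite exprS; apply: (@le_trans _ _ ((1 + 3^-1) * (1 + n%:R * 3^-1))); last by rewrite ler_wpM2l.
    have : 0 <= n%:R :> R by []. rewrite -(@natr1 _ n); move: (n%:R) => x; lra.
  by have := ler_norm M; lra.
exists k; apply: (lt_le_trans kM); apply: le_trans (low k).
rewrite ler_pM2r ?invr_gt0// expr_div_n -exprVn; by apply: ler_wpM2r.
Qed.

End GlidingHump.

(** * Pairings with test functions *)

Section WeightedIntegrals.
Context d (T : measurableType d) {R : realType} (m : {measure set T -> \bar R}).
Variables (D : set T) (mD : measurable D).

Lemma integrable_fine (u : T -> \bar R) : m.-integrable D u ->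
  m.-integrable D (fun x => (fine (u x))%:E).
Proof.
move=> iu; apply: (le_integrable _ _ _ iu) => //.
  by apply/measurable_EFinP; apply: measurableT_comp => //; exact: measurable_int iu.
by move=> x _ /=; case: (u x) => [r||] //=; rewrite normr0 leey.
Qed.

Lemma integral_fine_weight (u : T -> \bar R) (psi : T -> R) : m.-integrable D u ->
  measurable_fun D psi ->
  (\int[m]_(x in D) (u x * (psi x)%:E) = \int[m]_(x in D) (fine (u x) * psi x)%:E)%E.
Proof.
move=> iu mpsi; have mu := measurable_int _ iu.
apply: ae_eq_integral => //.
- by apply: emeasurable_funM => //; exact/measurable_EFinP.
- apply/measurable_EFinP; apply: measurable_funM => //; exact: measurableT_comp.
have := integrable_ae mD iu; apply: filterS => x h Dx.
by rewrite EFinM fineK// h.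
Qed.

Lemma Rintegral_fine_gap (u f : T -> \bar R) (M : R) (psi : T -> R) :
  (forall x, D x -> u x = (M%:E - f x)%E) -> m.-integrable D u -> m.-integrable D f ->
  measurable_fun D psi ->
  \int[m]_(x in D) (fine (u x) * psi x) = \int[m]_(x in D) (M * psi x - fine (f x) * psi x).
Proof.
move=> uf iu jf mpsi.
have mfine g : m.-integrable D g -> measurable_fun D (fine \o g).
  by move=> ig; apply: measurableT_comp => //; exact: measurable_int ig.
congr fine; apply: ae_eq_integral => //.
- by apply/measurable_EFinP; apply: measurable_funM => //; exact: mfine.
- apply/measurable_EFinP; apply: measurable_funB; apply: measurable_funM => //.
  exact: mfine.
have := integrable_ae mD jf; apply: filterS => x h Dx.
by rewrite uf//; case: (f x) (h Dx) => [v||]// _; rewrite /= mulrBl.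
Qed.

Lemma integrable_eweight (u : T -> \bar R) (psi : T -> R) C : m.-integrable D u ->
  measurable_fun D psi -> (forall x, D x -> `|psi x| <= C) ->
  m.-integrable D (fun x => u x * (psi x)%:E)%E.
Proof.
move=> iu mpsi psiC; apply: integrableMl => //.
exists C; split; first exact: num_real.
by move=> y Cy x /= Dx; apply: (le_trans (psiC x Dx)); exact: ltW.
Qed.

Lemma integrable_weight (V psi : T -> R) C : m.-integrable D (EFin \o V) ->
  measurable_fun D psi -> (forall x, D x -> `|psi x| <= C) ->
  m.-integrable D (EFin \o (fun x => V x * psi x)).
Proof. exact: integrable_eweight. Qed.

Lemma weight_bound (V psi : T -> R) C : 0 <= C -> m.-integrable D (EFin \o V) ->
  measurable_fun D psi -> (forall x, D x -> `|psi x| <= C) ->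
  `|\int[m]_(x in D) (V x * psi x)| <= C * \int[m]_(x in D) `|V x|.
Proof.
move=> C0 iV mpsi psiC; have iVp := integrable_weight iV mpsi psiC.
have iaV : m.-integrable D (EFin \o (fun x => `|V x|)) by exact: integrable_norm.
apply: (le_trans (le_normr_Rintegral mD iVp)).
rewrite -RintegralZl//; apply: le_Rintegral => //.
- exact: (integrable_norm iVp).
- by have := integrableZl mD C iaV; apply: eq_integrable => // x _ /=; rewrite EFinM.
by move=> x Dx; rewrite normrM mulrC ler_wpM2r// psiC.
Qed.

Lemma integral_support (E : set T) (h : T -> \bar R) : D `<=` E ->
  (forall x, E x -> ~ D x -> h x = 0%E) ->
  (\int[m]_(x in E) h x = \int[m]_(x in D) h x)%E.
Proof.
move=> DE h0; rewrite integral_mkcond [RHS]integral_mkcond; apply: eq_integral => x _.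
rewrite !patchE; case: ifPn => xE; case: ifPn => xD //.
- by apply: h0; [exact: set_mem|move=> /mem_set; exact/negP].
- by move: xE; rewrite (mem_set (DE _ (set_mem xD))).
Qed.

End WeightedIntegrals.

Section Pairings.
Context {R : realType}.
Local Notation mu := (@lebesgue_measure R).
Local Notation mu2 := (mu \x mu)%E.
Variables (a b : \bar R) (u : R * R -> \bar R).
Hypothesis su : subharmonic (strip a b) u.

Lemma integrable_fine_strip (K : set (R * R)) : compact K -> measurable K ->
  K `<=` strip a b -> mu2.-integrable K (EFin \o (fine \o u)).
Proof.
by move=> cK mK KS; apply: integrable_fine => //; exact: integrable_strip su _ cK mK KS.
Qed.

Lemma shifted_pairingE (K : set (R * R)) (phi : R * R -> R) (t : R) :
  compact K -> measurable K -> K `<=` strip a b ->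
  measurable_fun setT phi ->
  (forall z, ~ K z -> phi (z.1 - t, z.2) = 0) ->
  shifted_pairing (strip a b) u phi t =
    \int[mu2]_(z in K) (fine (u z) * phi (z.1 - t, z.2)).
Proof.
move=> cK mK KS mphi phi0; congr fine.
rewrite (integral_support mu2 KS); last by move=> z _ nK; rewrite phi0// mule0.
apply: integral_fine_weight => //; first exact: integrable_strip su _ cK mK KS.
apply: measurable_funTS; apply: (measurableT_comp mphi).
by apply: measurable_fun_pair => //; exact: measurable_funB.
Qed.

(** Trades an integral of [M - u], which makes sense for any nonnegative weight, for a
    pairing with [u], which almost periodicity controls. *)
Lemma integral_gap_weight (K D : set (R * R)) (M C : R) (psi : R * R -> R) :
  compact K -> measurable K -> (mu2 K < +oo)%E -> K `<=` D -> D `<=` strip a b ->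
  measurable_fun K psi -> (forall z, 0 <= psi z) -> (forall z, psi z <= C) ->
  (forall z, ~ K z -> psi z = 0) ->
  (\int[mu2]_z ((psi z)%:E * gap u D M z) =
    (M * \int[mu2]_(z in K) psi z - \int[mu2]_(z in K) (fine (u z) * psi z))%:E)%E.
Proof.
move=> cK mK fK KD DS mpsi psi0 psiC out; have KS : K `<=` strip a b by move=> z /KD/DS.
have iu := integrable_strip su cK mK KS.
have psiC' z : K z -> `|psi z| <= C by rewrite ger0_norm.
have ir : mu2.-integrable K (EFin \o psi).
  apply: measurable_bounded_integrable => //.
  exists C; split; first exact: num_real.
  by move=> r Cr x Kx /=; apply: (le_trans (psiC' x Kx)); exact: ltW.
have iur : mu2.-integrable K (fun w => u w * (psi w)%:E)%E.
  exact: (@integrable_eweight _ _ R mu2 K mK u psi C).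
rewrite (integral_support mu2 (D := K))//; last by move=> w _ /out ->; rewrite mul0e.
transitivity (\int[mu2]_(w in K) (M%:E * (psi w)%:E - u w * (psi w)%:E))%E.
  apply: eq_integral => w /set_mem Kw; rewrite gapE//; last exact: KD.
  have : (u w < +oo)%E by case: su => ltu _ _ _; apply: ltu; exact: KS.
  case: (u w) => [r||]// _; first by rewrite -EFinB -!EFinM -EFinB; congr EFin; ring.
  have := psi0 w; rewrite le_eqVlt => /predU1P[<-|r0]; first by rewrite mul0e !mule0 sube0.
  by rewrite gt0_mulNye ?lte_fin//; apply: gt0_muley; rewrite lte_fin.
rewrite integralB//; last by exact: integrableZl.
rewrite EFinB EFinM; congr (_ - _)%E.
  by rewrite integralZl// /Rintegral fineK//; exact: integrable_fin_num.
rewrite integral_fine_weight// /Rintegral fineK//.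
apply: integrable_fin_num => //.
have iV : mu2.-integrable K (EFin \o (fun w => fine (u w))) by exact: integrable_fine.
exact: (@integrable_weight _ _ R mu2 K mK (fun w => fine (u w)) psi C).
Qed.

End Pairings.

(** The factor [3 / 2] replaces a maximum, which need not be attained. *)
Lemma near_maximizer (R : realType) (X : Type) (P : X -> Prop) (g : X -> R) (L : R) (x0 : X) :
  (exists B, forall x, P x -> `|g x| <= B) -> 0 <= L -> P x0 -> L < `|g x0| ->
  exists x, [/\ P x, L <= `|g x| & forall y, P y -> `|g y| <= 3 / 2 * `|g x|].
Proof.
move=> [B gB] L0 Px0 Lx0.
pose A := [set r | exists2 x, P x & r = `|g x|].
have hA : has_sup A.
  split; first by exists `|g x0|, x0.
  by exists B => _ [x Px ->]; exact: gB.
have ub x : P x -> `|g x| <= sup A.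
  by move=> Px; apply: (ub_le_sup hA.2); exists x.
have Ls : L < sup A by apply: (lt_le_trans Lx0); exact: ub.
pose e := Num.min (sup A / 3) (sup A - L).
have e0 : 0 < e by rewrite lt_min divr_gt0 ?subr_gt0// (le_lt_trans L0).
have [_ [x Px ->] xe] := sup_adherent e0 hA.
have [e1 e2] : e <= sup A / 3 /\ e <= sup A - L.
  by split; rewrite /e ge_min lexx ?orbT.
exists x; split => //; first by lra.
by move=> y Py; have := ub y Py; lra.
Qed.

Lemma integral_gt0 d (T : measurableType d) (R : realType) (m : {measure set T -> \bar R})
    (h : T -> \bar R) (B : set T) : measurable_fun setT h -> (forall x, (0 <= h x)%E) ->
  measurable B -> (0 < m B)%E -> (forall x, B x -> (0 < h x)%E) ->
  (0 < \int[m]_x h x)%E.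
Proof.
move=> mh h0 mB mB0 hB; rewrite lt0e integral_ge0 ?andbT; last by move=> x _.
apply/negP => /eqP ih.
have : (\int[m]_x `|h x| = 0)%E.
  by rewrite -ih; apply: eq_integral => x _; rewrite gee0_abs.
move=> /(ae_eq_integral_abs m measurableT mh) [N [mN N0 hN]].
have : (m B <= m N)%E.
  apply: le_measure; rewrite ?inE// => x Bx; apply: hN => /= /(_ I) hx.
  by have := hB x Bx; rewrite hx ltxx.
by rewrite N0 leNgt mB0.
Qed.

Section RadialBump.
Context {R : realType}.
Local Notation mu := (@lebesgue_measure R).
Local Notation mu2 := (mu \x mu)%E.
Variables (del : R) (d0 : 0 < del).

(** A function of the squared distance, the form in which [area_supermean] takes its
    weights. *)
Definition radial_profile (q : R) : R := flat 0 (1 - q / del ^+ 2).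

Definition radial (z : R * R) : R := radial_profile (z.1 ^+ 2 + z.2 ^+ 2).

Lemma radial_profile_ge0 q : 0 <= radial_profile q.
Proof. exact: flat_ge0. Qed.

Lemma radial_profile_out q : del ^+ 2 < q -> radial_profile q = 0.
Proof.
move=> dq; apply: flat_le0; rewrite subr_le0 ler_pdivlMr ?exprn_gt0// mul1r.
exact: ltW.
Qed.

Lemma measurable_radial_profile : measurable_fun [set: R] radial_profile.
Proof.
apply: continuous_measurable_fun => q.
apply: differentiable_continuous; apply/derivable1_diffP.
have := is_derive_flat 0 (1 - q / del ^+ 2); set d := (X in is_derive _ _ _ X) => df.
have dg : is_derive q 1 (fun q : R => 1 - q / del ^+ 2) (- (del ^+ 2)^-1).
  have := is_deriveB (is_derive_cst (1 : R) q 1)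
    (is_deriveM (is_derive_id q (1 : R)) (is_derive_cst (del ^+ 2)^-1 q 1)).
  set e := (X in is_derive _ _ _ X) => H; suff <- : e = - (del ^+ 2)^-1 by exact: H.
  by rewrite /e; rewrite /GRing.scale/=; ring.
exact: (@ex_derive _ _ _ _ _ _ _ (@is_derive1_comp R (flat 0) (fun q => 1 - q / del ^+ 2) q _ _ df dg)).
Qed.

Lemma smooth_radial : smooth radial.
Proof.
apply: bump_algebra_smooth.
have E : radial = flat 0 \o (cst 1 \+ (cst (- (del ^+ 2)^-1) \* ((fst \* fst) \+ (snd \* snd)))).
  by apply/funext => z; rewrite /radial /radial_profile/=; congr flat; ring.
by rewrite E; apply: bump_flat; apply: bump_add; [exact: bump_cst|apply: bump_mul;
  [exact: bump_cst|apply: bump_add; apply: bump_mul; [exact: bump_fst|exact: bump_fst|exact: bump_snd|exact: bump_snd]]].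
Qed.

Lemma radial_out z : ~ box (0, 0) del z -> radial z = 0.
Proof.
move=> nz; apply: radial_profile_out; rewrite ltNge; apply/negP => h; apply: nz.
split => /=; rewrite subr0 -ler_sqr ?nnegrE ?(ltW d0)// real_normK ?num_real//.
  by have := sqr_ge0 z.2; lra.
by have := sqr_ge0 z.1; lra.
Qed.

Lemma bsmooth_radial : bsmooth radial.
Proof. exact: smooth_compact_bsmooth (ltW d0) smooth_radial radial_out. Qed.

Lemma measurable_radial : measurable_fun setT radial.
Proof. by apply: continuous_measurable2; have [] := smooth_radial [::]. Qed.

Lemma radial_mass : exists2 W : R, 0 < W & (\int[mu2]_w (radial w)%:E = W%:E)%E.
Proof.
have mr : measurable_fun setT (fun w => (radial w)%:E).
  by apply/measurable_EFinP; exact: measurable_radial.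
have r0 w : (0 <= (radial w)%:E)%E by rewrite lee_fin; exact: radial_profile_ge0.
have h0 : 0 < del / 2 by rewrite divr_gt0.
have mB : (0 < mu2 (box (0%R, 0%R) (del / 2)))%E.
  by rewrite mu2_box ?(ltW h0)// lte_fin exprn_gt0// mulr_gt0.
have pos : (0 < \int[mu2]_w (radial w)%:E)%E.
  apply: (@integral_gt0 _ _ R mu2 _ (box (0, 0) (del / 2)) mr r0).
    exact: measurable_box.
    exact: mB.
  move=> w [/= w1 w2]; rewrite lte_fin; apply: flat_gt0.
  rewrite subr_gt0 ltr_pdivrMr ?exprn_gt0// mul1r.
  have sq (x : R) : `|x - 0| <= del / 2 -> x ^+ 2 <= (del / 2) ^+ 2.
    by rewrite subr0 => h; rewrite -(real_normK (num_real x)) ler_sqr// nnegrE ltW.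
  have := sq _ w1; have := sq _ w2; have : 0 < del ^+ 2 by rewrite exprn_gt0.
  by rewrite expr_div_n; lra.
have [C hC] := bsmooth_bound bsmooth_radial.
have fin : (\int[mu2]_w (radial w)%:E < +oo)%E.
  rewrite (integral_support mu2 (D := box (0, 0) del))//; last by move=> w _ nw; rewrite radial_out.
  apply: (@le_lt_trans _ _ (\int[mu2]_(w in box (0%R, 0%R) del) C%:E)%E).
    apply: ge0_le_integral => //.
    - exact: measurable_box.
    - exact: measurable_funTS.
    - by move=> w _; rewrite lee_fin (le_trans _ (hC w))// ler_norm.
  have mBd : (mu2 (box (0%R, 0%R) del) < +oo)%E by rewrite mu2_box ?(ltW d0)// ltry.
  rewrite integral_cst; last exact: measurable_box.
  have C0 : 0 <= C by apply: (le_trans _ (hC (0, 0))).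
  by apply: lte_mul_pinfty; rewrite ?lee_fin//; exact: mBd.
exists (fine (\int[mu2]_w (radial w)%:E)).
  by apply: fine_gt0; rewrite pos fin.
by rewrite fineK// fin_real// fin (lt_trans _ pos)// ltNyr.
Qed.

End RadialBump.

(** * A uniform upper bound on a slab *)

Section UniformBound.
Context {R : realType}.
Local Notation mu := (@lebesgue_measure R).
Local Notation mu2 := (mu \x mu)%E.
Variables (a b : \bar R) (u : R * R -> \bar R) (hu : WAP (strip a b) u).
Variables (y0 del : R) (d0 : 0 < del).
Hypothesis slab : forall x y, `|y - y0| <= 8 * del -> strip a b (x, y).

Let su : subharmonic (strip a b) u := hu.1.
Let K (t : R) : set (R * R) := box (t, y0) (6 * del).

Let Ksub t : K t `<=` strip a b.
Proof. by move=> [x y] [/= _ h]; apply: slab; apply: (le_trans h); rewrite ler_pM2r// ler_nat. Qed.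

Let iV t : mu2.-integrable (K t) (EFin \o (fine \o u)).
Proof. by apply: integrable_fine_strip su _ _ _ (@Ksub t); [exact: compact_box|exact: measurable_box]. Qed.

(** The pairing of [u] with the bump centred at [(t, y)]. For [|y - y0| <= 4 del] the
    support of the bump lies in the box [K t], which does not depend on [y]; so series of
    bumps at different heights can be paired with [u] on one compact set. *)
Let F (t y : R) : R := \int[mu2]_(z in K t) (fine (u z) * radial del (z - (t, y))).

Let measurable_radial_shift t (p : R * R) :
  measurable_fun setT (fun z : R * R => radial del ((z.1 - t, z.2) - p)).
Proof.
rewrite (_ : (fun z => _) = radial del \o (fun z : R * R => (z.1 - t - p.1, z.2 - p.2))).
  apply: measurableT_comp; first exact: measurable_radial.
  by apply: measurable_fun_pair; apply: measurable_funB => //; exact: measurable_funB.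
by apply/funext => z; case: p.
Qed.

Let shiftE (z : R * R) t y : z - (t, y) = (z.1 - t, z.2) - (0, y).
Proof. by case: z => z1 z2; congr pair; rewrite /= subr0. Qed.

Let F_bounded t : exists B, forall y, `|F t y| <= B.
Proof.
have [C hC] := bsmooth_bound (bsmooth_radial d0).
have C0 : 0 <= C by apply: le_trans (hC 0).
exists (C * \int[mu2]_(z in K t) `|fine (u z)|) => y.
apply: weight_bound => //; first exact: measurable_box.
under eq_fun do rewrite shiftE; apply: measurable_funTS; exact: measurable_radial_shift.
Qed.

Let ser_out (c y : nat -> R) z : (forall j, `|y j - y0| <= 4 * del) ->
  ~ box (0, y0) (5 * del) z -> ser c (fun j => (0, y j)) (radial del) z = 0.
Proof.
move=> yj nz; rewrite /ser /wsum.
suff -> : (fun j => c j * radial del (z - (0, y j))) = (fun=> 0).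
  by rewrite (_ : series _ = cst 0) ?lim_cst//; apply/funext => n; rewrite /series/= big1.
apply/funext => j; rewrite radial_out ?mulr0// => -[/= h1 h2]; apply: nz; split => /=.
  by rewrite subr0; move: h1; rewrite !subr0 => h1; apply: (le_trans h1); rewrite ler_peMl// ?ler1n// ltW.
have -> : z.2 - y0 = (z.2 - y j - 0) + (y j - y0) by ring.
apply: (le_trans (ler_normD _ _)); apply: (le_trans (lerD h2 (yj j))); lra.
Qed.

(** Dominated convergence: the partial sums of the series of bumps are uniformly bounded,
    and [u] is integrable on [K t]. *)
Let pairing_ser (c y : nat -> R) (sc : cvgn (series (fun j => `|c j|))) t :
  (forall j, `|y j - y0| <= 4 * del) ->
  shifted_pairing (strip a b) u (ser c (fun j => (0, y j)) (radial del)) t = wsum c (fun j => F t (y j)).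
Proof.
move=> yj; set phi := ser _ _ _.
have [C hC] := bsmooth_bound (bsmooth_radial d0).
have [B FB] := F_bounded t.
have sphi : smooth phi by apply: smooth_ser sc _ (bsmooth_radial d0).
have phi0 := ser_out c yj.
rewrite (shifted_pairingE su (K := K t)); last 5 first.
- exact: compact_box.
- exact: measurable_box.
- exact: Ksub.
- by apply: continuous_measurable2; have [] := sphi [::].
- move=> z nz; apply: phi0 => -[/= h1 h2]; apply: nz; split => /=.
    by rewrite subr0 in h1; apply: (le_trans h1); rewrite ler_pM2r// ler_nat.
  by apply: (le_trans h2); rewrite ler_pM2r// ler_nat.
pose sn n (z : R * R) : R := series (fun j => c j * radial del ((z.1 - t, z.2) - (0, y j))) n.
have msn n : measurable_fun setT (sn n).
  elim: n => [|n IH].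
    rewrite (_ : sn 0%N = cst 0)//; apply/funext => z; by rewrite /sn /series/= big_nil.
  rewrite (_ : sn n.+1 = (fun z => sn n z + c n * radial del ((z.1 - t, z.2) - (0, y n)))); last first.
    by apply/funext => z; rewrite /sn seriesSr.
  by apply: measurable_funD => //; apply: measurable_funM => //; exact: measurable_radial_shift.
set A := limn (series (fun j => `|c j|)).
have snA n z : `|sn n z| <= C * A.
  apply: (@le_trans _ _ (series (fun j => C * `|c j|) n)).
    rewrite /sn /series/=; apply: (le_trans (ler_norm_sum _ _ _)); apply: ler_sum => j _.
    by rewrite normrM mulrC ler_wpM2r.
  rewrite (_ : series _ n = C * series (fun j => `|c j|) n); last first.
    by rewrite /series/= big_distrr.
  apply: ler_wpM2l; first exact: (le_trans _ (hC 0)).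
  by apply: nondecreasing_cvgn_le => //; apply: nondecreasing_series.
have mK : measurable (K t) := measurable_box (t, y0) (6 * del).
have isn n : mu2.-integrable (K t) (EFin \o (fun z => fine (u z) * sn n z)).
  apply: (@integrable_weight _ _ R mu2 (K t) mK (fun z => fine (u z)) (sn n) (C * A)) => //.
  exact: measurable_funTS (msn n).
have ir j : mu2.-integrable (K t) (EFin \o (fun z => fine (u z) * radial del (z - (t, y j)))).
  apply: (@integrable_weight _ _ R mu2 (K t) mK (fun z => fine (u z)) (fun z => radial del (z - (t, y j))) C) => //.
  by under eq_fun do rewrite shiftE; apply: measurable_funTS; exact: measurable_radial_shift.
have Isn n : \int[mu2]_(z in K t) (fine (u z) * sn n z) = series (fun j => c j * F t (y j)) n.
  elim: n => [|n IH].
    transitivity (\int[mu2]_(z in K t) (0 : R)).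
      by apply: eq_Rintegral => z _; rewrite /sn /series/= big_nil mulr0.
    by rewrite Rintegral_cst// mul0r /series/= big_nil.
  have Z : \int[mu2]_(z in K t) (c n * (fine (u z) * radial del (z - (t, y n)))) = c n * F t (y n).
    by apply: RintegralZl => //; exact: ir.
  rewrite seriesSr -IH -Z -RintegralD//; last first.
    have := @integrableZl _ _ R mu2 (K t) mK (c n) _ (ir n).
    by apply: eq_integrable => // z _ /=; rewrite EFinM.
  apply: eq_Rintegral => z _; rewrite /sn seriesSr mulrDr -shiftE; congr (_ + _); ring.
have cv : (series (fun j => c j * F t (y j)) n)%:E @[n --> \oo] -->
    (\int[mu2]_(z in K t) (fine (u z) * phi (z.1 - t, z.2)))%:E.
  have mf n : measurable_fun (K t) (fun z => (fine (u z) * sn n z)%:E).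
    exact: (measurable_int _ (isn n)).
  have mphi : measurable_fun (K t) (fun z => (fine (u z) * phi (z.1 - t, z.2))%:E).
    apply/measurable_EFinP; apply: measurable_funM.
      by have := measurable_int _ (iV t); move/measurable_EFinP.
    apply: measurable_funTS; apply: (@measurableT_comp _ _ _ _ _ _ phi).
      by apply: continuous_measurable2; have [] := sphi [::].
    by apply: measurable_fun_pair => //; exact: measurable_funB.
  have ig : mu2.-integrable (K t) (fun z => (`|fine (u z)| * (C * A))%:E).
    apply: (@integrable_weight _ _ _ mu2 _ mK (fun z => `|fine (u z)|) (cst (C * A)) (`|C * A|)) => //.
    exact: integrable_norm.
  have fcv : {ae mu2, forall z, K t z ->
      (fine (u z) * sn n z)%:E @[n --> \oo] --> (fine (u z) * phi (z.1 - t, z.2))%:E}.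
    apply: aeW => z _; apply: cvg_EFin; first exact: nearW.
    apply: cvgMr; exact: (cvg_wsum sc (x := fun j => _) (fun j => hC _)).
  have fg : {ae mu2, forall z n, K t z ->
      (`|(fine (u z) * sn n z)%:E| <= (`|fine (u z)| * (C * A))%:E)%E}.
    by apply: aeW => z n _; rewrite abse_EFin lee_fin normrM ler_wpM2l.
  have [fi _] := @dominated_convergence _ _ R mu2 (K t) mK _ _ _ mf mphi fcv ig fg.
  rewrite /Rintegral fineK; last by apply: integrable_fin_num.
  rewrite (_ : [sequence _]_n = (fun n => (series (fun j => c j * F t (y j)) n)%:E))//.
  by apply/funext => n; rewrite -Isn /Rintegral fineK//; apply: integrable_fin_num => //; exact: isn.
rewrite /wsum; apply/esym; apply: cvg_lim => //.
by move/fine_cvgP: cv => [_]; exact.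
Qed.

(** Otherwise there are points [p k] at which [|F|] exceeds [4 ^ k] and is almost maximal
    among the points of the slab on the same vertical line. By the gliding hump a
    combination of the bumps at the heights [(p k).2] is a test function whose shifted
    pairings with [u] are unbounded, but they are almost periodic. *)
Let pairing_bounded : exists B, forall t y, `|y - y0| <= 4 * del -> `|F t y| <= B.
Proof.
apply: contrapT => nB.
have /choice[p hp] : forall k : nat, exists p : R * R, [/\ `|p.2 - y0| <= 4 * del,
   4 ^+ k <= `|F p.1 p.2| & forall y, `|y - y0| <= 4 * del -> `|F p.1 y| <= 3 / 2 * `|F p.1 p.2|].
  move=> k.
  have [t [y [hy hF]]] : exists t y, `|y - y0| <= 4 * del /\ 4 ^+ k < `|F t y|.
    apply: contrapT => H; apply: nB; exists (4 ^+ k) => t y hy; rewrite leNgt; apply/negP => h.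
    by apply: H; exists t, y.
  have [B hB] := F_bounded t.
  have [||y' [h1 h2 h3]] := @near_maximizer R R (fun y => `|y - y0| <= 4 * del) (F t) (4 ^+ k) y _ _ hy hF.
  - by exists B => *; exact: hB.
  - by rewrite exprn_ge0.
  by exists (t, y').
pose A k j := F (p k).1 (p j).2.
have Adom k j : `|A k j| <= 3 / 2 * `|A k k| by have [_ _ h] := hp k; apply: h; have [] := hp j.
have Abig k : 4 ^+ k <= `|A k k| by have [] := hp k.
pose c := hump_coef A; have sc : cvgn (series (fun j => `|c j|)) := hump_coef_summable (a := A).
have yj j : `|(p j).2 - y0| <= 4 * del by have [] := hp j.
pose phi := ser c (fun j => (0, (p j).2)) (radial del).
have tphi : test_function (strip a b) phi.
  apply: (@test_function_of_support _ _ _ (box (0, y0) (5 * del))).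
  - by apply: compact_closed; [exact: norm_hausdorff|exact: compact_box].
  - exact: compact_box.
  - by move=> [x y] [/= _ h]; apply: slab; apply: (le_trans h); rewrite ler_pM2r// ler_nat.
  - by apply: smooth_ser sc _ (bsmooth_radial d0).
  - by move=> z; exact: ser_out.
have [_ [M hM]] := uap_bounded_measurable (hu.2 phi tphi).
have [k] := gliding_hump Adom Abig M; rewrite ltNge => /negP; apply.
by rewrite -(pairing_ser sc (p k).1 yj); exact: hM.
Qed.

(** By the sub-mean-value inequality, [u z] is at most its pairing with the radial bump
    centred at [z], divided by the mass of the bump. *)
Lemma slab_upper_bound : exists M : R, forall z, `|z.2 - y0| <= 4 * del -> (u z <= M%:E)%E.
Proof.
have [B hB] := pairing_bounded.
have [W W0 WE] := radial_mass d0.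
have h : del + 4 * del <= 6 * del by rewrite -[X in X + _]mul1r -mulrDl ler_pM2r//; lra.
exists (B / W) => -[t y] /= hy.
pose z : R * R := (t, y).
have oS : open (strip a b) by exact: open_strip.
have [M uM] := subharmonic_ub oS su (compact_box (p := (t, y0)) (r := 6 * del)) (@Ksub t).
have mK : measurable (K t) := measurable_box (t, y0) (6 * del).
pose f := gap u (K t) M.
have mf : measurable_fun setT f by exact: (measurable_gap oS su M mK (@Ksub t)).
have f0 w : (0 <= f w)%E by exact: gap_ge0.
have iu : mu2.-integrable (K t) u.
  by apply: integrable_strip su _ _ mK (@Ksub t); exact: compact_box.
have mr : measurable_fun (K t) (fun w => radial del (w - z)).
  by under eq_fun do rewrite shiftE; apply: measurable_funTS; exact: measurable_radial_shift.
have [C hC] := bsmooth_bound (bsmooth_radial d0).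
have Kz : K t z.
  by split => /=; rewrite ?subrr ?normr0 ?mulr_ge0 ?(ltW d0)//; apply: (le_trans hy); rewrite ler_pM2r// ler_nat.
have mean := @area_supermean_centred R f (radial_profile del) z del mf f0
  (measurable_radial_profile del) (radial_profile_ge0 del) d0 (radial_profile_out d0).
have {mean} : (\int[mu2]_w ((radial del (w - z))%:E * f w) <= f z * W%:E)%E.
  rewrite -WE; apply: mean => r r0 rd; apply: (@supermean_gap _ _ u oS su _ M (@Ksub t) uM) => //.
  move=> w /(closed_disc_sub_box (ltW r0)) [/= w1 w2]; split => /=.
    by apply: (le_trans w1); apply: (le_trans rd); rewrite ler_peMl ?ler1n// ltW.
  have -> : w.2 - y0 = (w.2 - y) + (y - y0) by ring.
  by apply: (le_trans (ler_normD _ _)); apply: (le_trans (lerD w2 hy)); lra.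
have out w : ~ K t w -> radial del (w - z) = 0.
  move=> nw; apply: (radial_out d0) => -[/= w1 w2]; apply: nw; split => /=.
    by rewrite subr0 in w1; apply: (le_trans w1); rewrite ler_peMl ?ler1n// ltW.
  have -> : w.2 - y0 = (w.2 - y - 0) + (y - y0) by ring.
  by apply: (le_trans (ler_normD _ _)); apply: (le_trans (lerD w2 hy)); exact: h.
have fK : (mu2 (K t) < +oo)%E by rewrite mu2_box ?ltry// mulr_ge0// ltW.
have mass : \int[mu2]_(w in K t) radial del (w - z) = W.
  rewrite /Rintegral -(integral_support mu2 (E := setT))//; last by move=> w _ /out ->.
  rewrite -[RHS]/(fine W%:E) -WE; congr fine.
  rewrite -(ge0_integral_translate2 (- z))//.
  - by apply/measurable_EFinP; exact: measurable_radial.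
  - by move=> w; rewrite lee_fin; exact: radial_profile_ge0.
have rC w : radial del (w - z) <= C by apply: (le_trans _ (hC _)); exact: ler_norm.
have rge0 w : 0 <= radial del (w - z) by exact: radial_profile_ge0.
rewrite (@integral_gap_weight _ _ _ _ su (K t) (K t) M C)//; last exact: compact_box.
rewrite mass -/(F t y).
rewrite /f gapE//.
have : (u z < +oo)%E by case: su => ltu _ _ _; apply: ltu; exact: Ksub Kz.
rewrite -/z; case: (u z) => [r||]// _; last by rewrite leNye.
rewrite (_ : (M%:E - r%:E) * W%:E = ((M - r) * W)%:E)%E// !lee_fin ler_pdivlMr//.
by have := hB t y hy => /ler_normlW; lra.
Qed.

End UniformBound.

(** * Windows and layers *)

Lemma uap_affine (R : realType) (g : R -> R) (a b : R) : uniformly_almost_periodic g ->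
  uniformly_almost_periodic (fun t => a * g t + b).
Proof.
move=> [cg ap]; split.
  by move=> x; apply: cvgD; [apply: cvgM; [exact: cvg_cst|exact: cg]|exact: cvg_cst].
move=> t; have [k [h [kh /uniform_cvgP gh]]] := ap t.
exists k, (fun x => a * h x + b); split => // A.
move=> /uniform_nbhs[E [+ EA]]; rewrite -entourage_ballE => -[e /= e0 eE].
have [N hN] := gh (e / (`|a| + 1)) ltac:(by rewrite divr_gt0// ltr_wpDl).
exists N => // n /= Nn; apply: EA => s _; apply: eE.
rewrite /ball/= opprD addrACA subrr addr0 -mulrBr normrM.
have := hN n Nn s; rewrite ltr_pdivlMr ?ltr_wpDl// => h1.
by have := normr_ge0 (h s - g (s + t (k n))); lra.
Qed.

Section Window.
Context {R : realType}.
Local Notation mu := (@lebesgue_measure R).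
Variables (r : R) (r0 : 0 < r).

Definition window (t x : R) : R := hat ((x - t) / r).

Lemma window_ge0 t x : 0 <= window t x. Proof. exact: hat_ge0. Qed.

Lemma hat_le1 (x : R) : hat x <= 1.
Proof.
rewrite /hat /flat; case: ifP => // x0; rewrite expr0 invr1 mul1r.
by rewrite -[leRHS]expR0 ler_expR oppr_le0 invr_ge0 ltW.
Qed.

Lemma measurable_hat : measurable_fun [set: R] (@hat R).
Proof.
have -> : @hat R = radial_profile 1 \o (fun x => x ^+ 2).
  by apply/funext => x; rewrite /hat /radial_profile/= expr1n divr1.
apply: measurableT_comp; first exact: measurable_radial_profile.
exact: measurable_funX.
Qed.

Lemma measurable_window : measurable_fun [set: R * R] (fun z => window z.1 z.2).
Proof.
apply: (measurableT_comp measurable_hat); apply: measurable_funM => //.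
exact: measurable_funB.
Qed.

Lemma window_semiconvex t x h :
  (1 - (16 / r ^+ 2) * h ^+ 2 / 2) * (2 * window t x) <= window t (x - h) + window t (x + h).
Proof.
have := hat_semiconvex ((x - t) / r) (h / r); rewrite /window.
rewrite (_ : (x - h - t) / r = (x - t) / r - h / r); last by ring.
rewrite (_ : (x + h - t) / r = (x - t) / r + h / r); last by ring.
by rewrite expr_div_n (_ : 16 * (h ^+ 2 / r ^+ 2) / 2 = 16 / r ^+ 2 * h ^+ 2 / 2)//; ring.
Qed.

Lemma window_out t x : r <= `|x - t| -> window t x = 0.
Proof.
by move=> h; apply: hat_out; rewrite normrM (gtr0_norm (x := r^-1)) ?invr_gt0// ler_pdivlMr// mul1r.
Qed.

Lemma window_in t x : `|x - t| < r -> 0 < window t x.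
Proof.
by move=> h; apply: hat_in; rewrite normrM (gtr0_norm (x := r^-1)) ?invr_gt0// ltr_pdivrMr// mul1r.
Qed.

Lemma window_mass t : exists2 X : R, 0 < X & (\int[mu]_x (window t x)%:E = X%:E)%E.
Proof.
have mw : measurable_fun [set: R] (window t).
  exact: measurableT_comp measurable_window (pair1_measurable t).
have mr : measurable_fun [set: R] (fun x => (window t x)%:E) by exact/measurable_EFinP.
have w0 x : (0 <= (window t x)%:E)%E by rewrite lee_fin window_ge0.
have mI (s : R) : 0 < s -> mu `[t - s, t + s]%classic = (2 * s)%:E.
  by move=> s0; rewrite itv_measure; [congr EFin; ring|lra].
have pos : (0 < \int[mu]_x (window t x)%:E)%E.
  apply: (@integral_gt0 _ _ R mu _ `[t - r / 2, t + r / 2]%classic mr w0) => //.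
    have h : (0 < mu `[(t - r / 2)%R, (t + r / 2)%R]%classic)%E.
      by rewrite mI ?divr_gt0// lte_fin mulr_gt0// divr_gt0.
    exact: h.
  move=> x /=; rewrite in_itv/= -ler_distl lte_fin => h; apply: window_in.
  by apply: (le_lt_trans h); rewrite ltr_pdivrMr// ltr_pMr// ltr1n.
have fin : (\int[mu]_x (window t x)%:E < +oo)%E.
  rewrite (integral_support mu (D := `[t - r, t + r]%classic))//; last first.
    move=> x _ /= nx; rewrite window_out// leNgt; apply/negP => h; apply: nx.
    by rewrite in_itv/= -ler_distl ltW.
  apply: (@le_lt_trans _ _ (\int[mu]_(x in `[(t - r)%R, (t + r)%R]) 1%:E)%E).
    apply: ge0_le_integral => //; first exact: measurable_funTS.
    by move=> x _; rewrite lee_fin hat_le1.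
  rewrite integral_cst//= mul1e.
  have h : (mu `[(t - r)%R, (t + r)%R]%classic < +oo)%E by rewrite mI// ltry.
  exact: h.
exists (fine (\int[mu]_x (window t x)%:E)); first by apply: fine_gt0; rewrite pos fin.
by rewrite fineK// fin_real// fin (lt_trans _ pos)// ltNyr.
Qed.

End Window.

Lemma window_bump_algebra (R : realType) (e c : R) (f : R * R -> R) : bump_algebra f ->
  bump_algebra (window e c \o f).
Proof.
move=> bf.
have -> : window e c \o f = flat 0 \o (cst 1 \+ (cst (- 1) \* (((f \+ cst (- c)) \* cst e^-1) \*
    ((f \+ cst (- c)) \* cst e^-1)))).
  by apply/funext => z; rewrite /window /hat/= mulN1r expr2.
have bg : bump_algebra ((f \+ cst (- c)) \* cst e^-1).
  by apply: bump_mul; [apply: bump_add => //; exact: bump_cst|exact: bump_cst].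
by apply: bump_flat; apply: bump_add; [exact: bump_cst|apply: bump_mul; [exact: bump_cst|exact: bump_mul]].
Qed.

Section Slab.
Context {R : realType}.
Local Notation mu := (@lebesgue_measure R).
Local Notation mu2 := (mu \x mu)%E.
Variables (a b : \bar R) (u : R * R -> \bar R) (hu : WAP (strip a b) u).
Variables (y0 del M r : R).
Hypotheses (d0 : 0 < del) (r0 : 0 < r).
Hypothesis slabS : forall x y, `|y - y0| <= 4 * del -> strip a b (x, y).
Hypothesis uM : forall z, `|z.2 - y0| <= 4 * del -> (u z <= M%:E)%E.

Let su : subharmonic (strip a b) u := hu.1.

Definition slab : set (R * R) := [set z | `|z.2 - y0| <= 4 * del].

Let slab_sub : slab `<=` strip a b.
Proof. by move=> [x y] /= h; apply: slabS. Qed.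

Let measurable_slab : measurable slab.
Proof.
rewrite (_ : slab = setT `*` `[y0 - 4 * del, y0 + 4 * del]%classic).
  by apply: measurableX.
apply/seteqP; split => z; rewrite /slab/= in_itv/= ler_distl; first by [].
by case.
Qed.

Definition depth : R * R -> \bar R := gap u slab M.

Lemma measurable_depth : measurable_fun setT depth.
Proof.
have oS : open (strip a b) by exact: open_strip.
exact: (measurable_gap oS su M measurable_slab slab_sub).
Qed.

Lemma depth_ge0 z : (0 <= depth z)%E.
Proof. by apply: gap_ge0 => w; exact: uM. Qed.

Lemma depth_lsc x y (c : R) : `|y - y0| < 4 * del -> (c%:E < depth (x, y))%E ->
  \forall y' \near y, (c%:E < depth (x, y'))%E.
Proof.
move=> hy; rewrite /depth gapE; last exact: ltW.
move=> cu; have {cu} uc : (u (x, y) < (M - c)%:E)%E.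
  by move: cu; case: (u (x, y)) => [v||]//=; rewrite ?ltNyr// -EFinB !lte_fin => ?; lra.
have [_ usc _ _] := su.
have /nbhs_boxP[s s0 hs] := usc _ _ (slabS x (ltW hy)) uc.
have e0 : 0 < Num.min s (4 * del - `|y - y0|) by rewrite lt_min s0 subr_gt0.
apply/nbhs_ballP; exists (Num.min s (4 * del - `|y - y0|)) => // y'.
rewrite /ball/= lt_min => /andP[h1 h2].
have hy' : `|y' - y0| <= 4 * del.
  have -> : y' - y0 = - (y - y') + (y - y0) by ring.
  by apply: (le_trans (ler_normD _ _)); rewrite normrN; lra.
rewrite gapE//; have : (u (x, y') < (M - c)%:E)%E.
  by apply: hs; split => /=; rewrite ?subrr ?normr0 ?(ltW s0)// distrC ltW.
by case: (u (x, y')) => [v||]//=; rewrite ?ltry// -EFinB !lte_fin => ?; lra.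
Qed.

Lemma depth_supermean (z : R * R) (rho : R) : 0 < rho -> `|z.2 - y0| + rho <= 4 * del ->
  (\int[mu]_(t in `[0%R, (2 * pi)%R]) depth (circle_point z rho t) <=
     (2 * pi)%:E * depth z)%E.
Proof.
move=> rho0 h; apply: (@supermean_gap _ _ u _ su _ M slab_sub) => //.
  exact: open_strip.
move=> w /(closed_disc_sub_box (ltW rho0)) [/= w1 w2]; rewrite /slab/=.
have -> : w.2 - y0 = (w.2 - z.2) + (z.2 - y0) by ring.
by apply: (le_trans (ler_normD _ _)); lra.
Qed.

(** The values of [depth] on a line may be infinite, and translates of them need not
    converge uniformly; the layers have neither defect. *)
Definition layer (t y : R) : \bar R := slice depth (window r t) y.

Let mw t : measurable_fun [set: R] (window r t).
Proof. exact: measurableT_comp (measurable_window r) (pair1_measurable t). Qed.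

Lemma measurable_layer t : measurable_fun [set: R] (layer t).
Proof.
apply: measurable_slice => //; [exact: measurable_depth|exact: depth_ge0|exact: window_ge0].
Qed.

Lemma layer_ge0 t y : (0 <= layer t y)%E.
Proof. by apply: slice_ge0 => //; [exact: depth_ge0|exact: window_ge0]. Qed.

(** The bound [del] keeps the circles used below inside the slab. The bound [r / 8]
    ensures [K reach ^ 2 <= 1 / 4] for the constant [K = 16 / r ^ 2] of
    [window_semiconvex]. *)
Definition reach : R := Num.min del (r / 8).

Lemma reach_gt0 : 0 < reach. Proof. by rewrite lt_min d0 divr_gt0. Qed.

Let curvature_reach (x : R) : 0 <= x <= reach -> 16 / r ^+ 2 * x ^+ 2 <= 4^-1.
Proof.
move=> /andP[x0 xl]; have xr : x <= r / 8 by apply: (le_trans xl); rewrite /reach ge_min lexx orbT.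
have h : x ^+ 2 <= (r / 8) ^+ 2 by rewrite ler_sqr ?nnegrE// (le_trans x0).
rewrite mulrAC ler_pdivrMr ?exprn_gt0//.
by move: h; rewrite expr_div_n; lra.
Qed.

Lemma layer_comparison (t y1 sg s : R) : sg ^+ 2 = 1 -> `|y1 - y0| <= 2 * del -> 0 <= s <= 1 ->
  (((1 - s) * (1 - s / 2))%:E * layer t y1 <= layer t (y1 + sg * reach * s)%R)%E.
Proof.
move=> sg1 hy hs.
have l0 := reach_gt0.
have [ld lr] : reach <= del /\ reach <= r / 8 by split; rewrite /reach ge_min lexx ?orbT.
have nsg : `|sg| = 1.
  by apply/eqP; rewrite -sqrp_eq1// real_normK ?num_real// sg1.
apply: (@supermean_comparison _ (layer t) (16 / r ^+ 2) y1 reach sg) => //.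
- exact: measurable_layer.
- exact: layer_ge0.
- by rewrite divr_ge0// exprn_ge0// ltW.
- by apply: curvature_reach; rewrite lexx ltW.
- apply: slice_lsc => //; [exact: measurable_depth|exact: depth_ge0|exact: window_ge0|].
  move=> x c; apply: depth_lsc; apply: (le_lt_trans hy); rewrite ltr_pM2r// ltr_nat//.
move=> {hs}s rho rho0 h1 h2.
have hrho : rho <= reach.
  by have [s1|s1] := lerP s 1; [apply: (le_trans h1); rewrite ler_piMr// ltW|
    have : reach * (1 - s) <= 0 by rewrite pmulr_rle0// subr_le0 ltW]; lra.
apply: slice_supermean => //.
- exact: measurable_depth.
- exact: depth_ge0.
- exact: window_ge0.
- by rewrite divr_ge0// exprn_ge0// ltW.
- by move=> x h; exact: window_semiconvex.
- by have := @curvature_reach rho; rewrite hrho (ltW rho0) => /(_ isT); lra.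
move=> x; apply: depth_supermean => //=.
have s0 : 0 <= s by rewrite -(pmulr_rge0 _ l0) (le_trans _ h1)// ltW.
have s1 : s <= 1 by rewrite -subr_ge0 -(pmulr_rge0 _ l0) (le_trans _ h2)// ltW.
have -> : y1 + sg * reach * s - y0 = (y1 - y0) + sg * reach * s by ring.
have : `|y1 - y0 + sg * reach * s| <= 2 * del + reach * s.
  apply: (le_trans (ler_normD _ _)); apply: lerD => //.
  by rewrite !normrM nsg mul1r !ger0_norm// ltW.
by move: h2; rewrite mulrBr mulr1; lra.
Qed.

(** Such an average of layers is the mass of a product of two windows, times [M], minus
    the pairing of [u] with a translate of this product. *)
Lemma uap_layer_mean (y1 e : R) : 0 < e -> `|y1 - y0| + e <= 4 * del ->
  exists2 g, uniformly_almost_periodic g &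
    forall t, (\int[mu]_y ((window e y1 y)%:E * layer t y) = (g t)%:E)%E.
Proof.
move=> e0 he.
pose phi (z : R * R) := window r 0 z.1 * window e y1 z.2.
have phit z t : phi (z.1 - t, z.2) = window r t z.1 * window e y1 z.2.
  by rewrite /phi /window/= subr0.
pose K (t : R) : set (R * R) := `[t - r, t + r]%classic `*` `[y1 - e, y1 + e]%classic.
have cK t : compact (K t) by apply: compact_setX; exact: segment_compact.
have mK t : measurable (K t) by apply: measurableX.
have r1 : 0 < r by [].
have fK t : (mu2 (K t) < +oo)%E by rewrite mu2_rect ?ltry//; lra.
have Kslab t : K t `<=` slab.
  move=> z [_] /=; rewrite in_itv/= -ler_distl => h; rewrite /slab/=.
  have -> : z.2 - y0 = (z.2 - y1) + (y1 - y0) by ring.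
  by apply: (le_trans (ler_normD _ _)); lra.
have out t z : ~ K t z -> phi (z.1 - t, z.2) = 0.
  move=> nK; rewrite phit; have [h1|h1] := lerP r `|z.1 - t|; first by rewrite window_out// mul0r.
  have [h2|h2] := lerP e `|z.2 - y1|; first by rewrite (window_out e0 h2) mulr0.
  by exfalso; apply: nK; split => /=; rewrite in_itv/= -ler_distl ltW.
have sphi : smooth phi.
  apply: bump_algebra_smooth; apply: (@bump_mul _ (window r 0 \o fst) (window e y1 \o snd)).
    by apply: window_bump_algebra; exact: bump_fst.
  by apply: window_bump_algebra; exact: bump_snd.
have mphi : measurable_fun setT phi by apply: continuous_measurable2; have [] := sphi [::].
have mphit t : measurable_fun setT (fun z : R * R => phi (z.1 - t, z.2)).
  apply: measurableT_comp mphi _.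
  by apply: measurable_fun_pair => //; exact: measurable_funB.
have phi0 z : 0 <= phi z by rewrite mulr_ge0// window_ge0.
have phi1 z : phi z <= 1.
  by rewrite -[leRHS]mul1r ler_pM ?window_ge0// hat_le1.
have tphi : test_function (strip a b) phi.
  have E z : phi z = phi (z.1 - 0, z.2) by rewrite subr0; case: z.
  apply: (@test_function_of_support _ _ _ (K 0)) => //.
  - by apply: compact_closed; [exact: norm_hausdorff|exact: cK].
  - by move=> z /Kslab /slab_sub.
  - by move=> z /out; rewrite -E.
pose m0 := fine (\int[mu2]_z (phi z)%:E).
have mass t : \int[mu2]_(z in K t) phi (z.1 - t, z.2) = m0.
  congr fine; transitivity (\int[mu2]_z (phi (z.1 - t, z.2))%:E)%E.
    apply/esym; apply: integral_support; first exact: subsetT.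
    by move=> z _ nz; rewrite (out t z nz).
  transitivity (\int[mu2]_z (phi ((z.1 + - t)%R, (z.2 + 0)%R))%:E)%E.
    by apply: eq_integral => z _; rewrite addr0.
  have mEphi : measurable_fun setT (fun z : R * R => (phi z)%:E) by exact/measurable_EFinP.
  have Ephi0 z : (0 <= (phi z)%:E)%E by rewrite lee_fin.
  exact: (ge0_integral_translate2 (- t, 0) mEphi Ephi0).
exists (fun t => -1 * shifted_pairing (strip a b) u phi t + M * m0).
  by apply: uap_affine; exact: hu.2.
move=> t.
have mG : measurable_fun setT (fun z : R * R => (phi (z.1 - t, z.2))%:E * depth z)%E.
  by apply: emeasurable_funM; [exact/measurable_EFinP|exact: measurable_depth].
have G0 z : (0 <= (phi (z.1 - t, z.2))%:E * depth z)%E.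
  by apply: mule_ge0; [rewrite lee_fin|exact: depth_ge0].
transitivity (\int[mu2]_z ((phi ((z.1 - t)%R, z.2))%:E * depth z))%E.
  rewrite (@fubini_tonelli2 _ _ _ _ R mu mu _ mG G0); apply: eq_integral => y _.
  rewrite -ge0_integralZl//; last 3 first.
  - apply: emeasurable_funM; first by apply/measurable_EFinP; exact: mw.
    exact: measurableT_comp measurable_depth (pair2_measurable y).
  - by move=> x _; apply: mule_ge0; [rewrite lee_fin window_ge0|exact: depth_ge0].
  - by rewrite lee_fin window_ge0.
  apply: eq_integral => x _; rewrite (phit (x, y) t)/= muleA -EFinM.
  by rewrite (mulrC (window e _ _)).
have mKt : measurable_fun (K t) (fun z : R * R => phi (z.1 - t, z.2)) by exact: measurable_funTS.
rewrite (@integral_gap_weight _ _ _ _ su (K t) slab M 1 _ (cK t) (mK t) (fK t) (@Kslab t)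
  slab_sub mKt (fun z => phi0 _) (fun z => phi1 _) (out t)).
rewrite mass (shifted_pairingE su (cK t) (mK t) _ mphi (out t)); last by move=> z /Kslab /slab_sub.
by congr EFin; ring.
Qed.

End Slab.

Section WindowAverage.
Context {R : realType}.
Local Notation mu := (@lebesgue_measure R).
Variables (e c X : R) (N : R -> \bar R) (k : \bar R).
Hypotheses (e0 : 0 < e) (XE : (\int[mu]_x (window e c x)%:E = X%:E)%E).
Hypotheses (mN : measurable_fun [set: R] N) (N0 : forall y, (0 <= N y)%E) (k0 : (0 <= k)%E).

Let mw : measurable_fun [set: R] (fun y => (window e c y)%:E).
Proof.
by apply/measurable_EFinP; exact: measurableT_comp (measurable_window e) (pair1_measurable c).
Qed.

Let w0 y : (0 <= (window e c y)%:E)%E. Proof. by rewrite lee_fin window_ge0. Qed.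

Let Xk : (X%:E * k = \int[mu]_y ((window e c y)%:E * k))%E.
Proof. by rewrite ge0_integralZr// XE. Qed.

Lemma window_average_ge : (forall y, `|y - c| < e -> (k <= N y)%E) ->
  (X%:E * k <= \int[mu]_y ((window e c y)%:E * N y))%E.
Proof.
move=> kN; rewrite Xk; apply: ge0_le_integral => //.
- by move=> y _; exact: mule_ge0.
- by apply: emeasurable_funM.
- by apply: emeasurable_funM.
move=> y _; have [h|h] := ltrP `|y - c| e; first by apply: lee_wpmul2l => //; exact: kN.
by rewrite (window_out e0 h) !mul0e.
Qed.

Lemma window_average_le : (forall y, `|y - c| < e -> (N y <= k)%E) ->
  (\int[mu]_y ((window e c y)%:E * N y) <= X%:E * k)%E.
Proof.
move=> kN; rewrite Xk; apply: ge0_le_integral => //.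
- by move=> y _; exact: mule_ge0.
- by apply: emeasurable_funM.
- by apply: emeasurable_funM.
move=> y _; have [h|h] := ltrP `|y - c| e; first by apply: lee_wpmul2l => //; exact: kN.
by rewrite (window_out e0 h) !mul0e.
Qed.

End WindowAverage.

(** * Harnack inequality and almost periodicity of the layers *)

Section LayerBounds.
Context {R : realType}.
Local Notation mu := (@lebesgue_measure R).
Local Notation mu2 := (mu \x mu)%E.
Variables (a b : \bar R) (u : R * R -> \bar R) (hu : WAP (strip a b) u).
Variables (y0 del M r : R).
Hypotheses (d0 : 0 < del) (r0 : 0 < r).
Hypothesis slabS : forall x y, `|y - y0| <= 4 * del -> strip a b (x, y).
Hypothesis uM : forall z, `|z.2 - y0| <= 4 * del -> (u z <= M%:E)%E.

Local Notation layer := (layer u y0 del M r).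
Local Notation reach := (reach del r).

Let mw t : measurable_fun [set: R] (window r t).
Proof. exact: measurableT_comp (measurable_window r) (pair1_measurable t). Qed.

Let mlayer t : measurable_fun [set: R] (layer t).
Proof. exact: (measurable_layer hu r slabS uM t). Qed.

Let layer0 t y : (0 <= layer t y)%E.
Proof. exact: layer_ge0. Qed.

Let reach0 : 0 < reach. Proof. exact: reach_gt0. Qed.

Let reachd : reach <= del. Proof. by rewrite /reach ge_min lexx. Qed.

(** [layer_comparison] upwards or downwards from [y]; the factor there is at least
    [1 - 3 s / 2]. *)
Lemma layer_harnack (t y y' : R) : `|y - y0| <= 2 * del -> `|y' - y| <= reach ->
  ((1 - 3 / 2 * (`|y' - y| / reach))%:E * layer t y <= layer t y')%E.
Proof.
move=> hy hyy.
set s := `|y' - y| / reach.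
have s0 : 0 <= s by rewrite divr_ge0// ltW.
have s1 : s <= 1 by rewrite ler_pdivrMr// mul1r.
have l1 : reach != 0 by rewrite gt_eqF.
apply: (@le_trans _ _ (((1 - s) * (1 - s / 2))%:E * layer t y)%E).
  by apply: lee_wpmul2r; [exact: layer0|rewrite lee_fin; have := sqr_ge0 s; lra].
have [yy|yy] := lerP y y'.
  have -> : y' = y + 1 * reach * s.
    by rewrite /s ger0_norm ?subr_ge0// mul1r mulrC divfK//; ring.
  by apply: (layer_comparison hu) => //; [rewrite expr1n|rewrite s0].
have -> : y' = y + (-1) * reach * s.
  by rewrite /s ltr0_norm ?subr_lt0// mulN1r mulNr (mulrC reach) divfK//; ring.
by apply: (layer_comparison hu) => //; [rewrite sqrrN expr1n|rewrite s0].
Qed.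

(** By the Harnack inequality a layer that is large at [y] is large at all heights close
    to [y0], but its averages over these heights are bounded, being almost periodic. *)
Lemma layer_bound : exists C : R, forall t y, `|y - y0| <= reach / 4 -> (layer t y <= C%:E)%E.
Proof.
have l0 : 0 < reach by []. have ld : reach <= del by []. have d1 : 0 < del by [].
pose e := reach / 4; have e0 : 0 < e by rewrite divr_gt0.
have he : `|y0 - y0| + e <= 4 * del by rewrite subrr normr0 /e; lra.
have [g ug gE] := uap_layer_mean hu r0 slabS uM e0 he.
have [X X0 XE] := window_mass e0 y0.
have [_ [B gB]] := uap_bounded_measurable ug.
exists (B / (1 / 4 * X)) => t y hy.
have key : (X%:E * ((1 / 4)%:E * layer t y) <= B%:E)%E.
  apply: (@le_trans _ _ (g t)%:E); last by rewrite lee_fin; apply: le_trans (gB t); exact: ler_norm.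
  rewrite -gE; apply: (window_average_ge e0 XE (mlayer t)); first by apply: mule_ge0.
  move=> y' hy'; have hyy : `|y' - y| <= reach / 2.
    have -> : y' - y = (y' - y0) - (y - y0) by ring.
    by apply: (le_trans (ler_normB _ _)); move: hy hy'; rewrite -/e /e; lra.
  apply: (@le_trans _ _ ((1 - 3 / 2 * (`|y' - y| / reach))%:E * layer t y)%E); last first.
    apply: layer_harnack; first by move: hy; lra.
    by apply: (le_trans hyy); lra.
  (* Within distance [reach / 2] a layer keeps a quarter of its value. *)
  have e1 : `|y' - y| / reach <= 1 / 2 by rewrite ler_pdivrMr//; move: hyy; lra.
  have e2 : 0 <= `|y' - y| / reach by rewrite divr_ge0// ltW.
  by apply: lee_wpmul2r => //; rewrite lee_fin; lra.
have p0 : 0 < 1 / 4 * X by rewrite mulr_gt0.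
rewrite -(@lee_pmul2l _ (1 / 4 * X)%:E)// ?lte_fin//.
rewrite -[in leRHS]EFinM (mulrC _ (B / _)) divfK ?gt_eqF//.
by move: key; rewrite muleA -EFinM (mulrC X).
Qed.

Variable C : R.
Hypothesis layerC : forall t y, `|y - y0| <= reach / 4 -> (layer t y <= C%:E)%E.

Lemma layer_fin t y : `|y - y0| <= reach / 4 -> layer t y = (fine (layer t y))%:E.
Proof. by move=> hy; rewrite fineK// ge0_fin_numE// (le_lt_trans (layerC t hy))// ltry. Qed.

(** Harnack inequality from the height where the layer is larger. *)
Lemma layer_lipschitz t y y' : `|y - y0| <= reach / 4 -> `|y' - y0| <= reach / 4 ->
  `|fine (layer t y) - fine (layer t y')| <= 3 / 2 * C / reach * `|y' - y|.
Proof.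
have l0 : 0 < reach by []. have ld : reach <= del by [].
wlog le : y y' / fine (layer t y') <= fine (layer t y) => [H hy hy'|hy hy'].
  have [h|h] := leP (fine (layer t y')) (fine (layer t y)); first by apply: H.
  by rewrite distrC (distrC y'); apply: H => //; exact: ltW.
have hyy : `|y' - y| <= reach.
  have -> : y' - y = (y' - y0) - (y - y0) by ring.
  by apply: (le_trans (ler_normB _ _)); lra.
have := @layer_harnack t y y' ltac:(lra) hyy.
have := layerC t hy; rewrite {1 2}(layer_fin t hy) (layer_fin t hy') -EFinM !lee_fin/=.
move: le; set v := fine (layer t y); set v' := fine (layer t y') => le; set q := `|y' - y| / reach => vC vv.
have q0 : 0 <= q by rewrite divr_ge0// ltW.
rewrite ger0_norm ?subr_ge0//.
rewrite (_ : 3 / 2 * C / reach * `|y' - y| = 3 / 2 * (q * C)); last by rewrite /q; ring.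
have : q * v <= q * C by rewrite ler_wpM2l.
by lra.
Qed.

Lemma bounded_measurable_layer y : `|y - y0| <= reach / 4 ->
  bounded_measurable (fun t => fine (layer t y)).
Proof.
move=> hy; split.
  apply: measurableT_comp => //.
  apply: (@measurable_fun_fubini_tonelli_F _ _ _ _ R mu
    (fun z : R * R => (window r z.1 z.2)%:E * depth u y0 del M (z.2, y))%E).
    apply: emeasurable_funM; first by apply/measurable_EFinP; exact: measurable_window.
    apply: measurableT_comp; first exact: (measurable_depth hu M slabS).
    exact: measurable_fun_pair.
  by move=> z; apply: mule_ge0; [rewrite lee_fin window_ge0|exact: depth_ge0].
exists C => t; rewrite ger0_norm ?fine_ge0//.
by rewrite -lee_fin -layer_fin// layerC.
Qed.

(** By the Lipschitz bound the averages of [uap_layer_mean] over heights close to [y]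
    approximate the layer at [y] uniformly in [t]. *)
Lemma layer_equimean (y p : R) (c : R -> R) : `|y - y0| < reach / 4 ->
  bounded_measurable c -> 0 < p -> periodic c p ->
  equimean (fun t => fine (layer t y) * c t).
Proof.
move=> hy bc p0 cp; apply: (@uap_approx_equimean _ _ c p) => //.
  by apply: bounded_measurable_layer; exact: ltW.
move=> eps eps0.
have l0 : 0 < reach by []. have ld : reach <= del by [].
have C0 : 0 <= C.
  by rewrite -lee_fin; apply: le_trans (layer0 0 y) (layerC 0 (ltW hy)).
set Lip := 3 / 2 * C / reach.
have Lip0 : 0 <= Lip by rewrite /Lip !mulr_ge0// invr_ge0 ltW.
pose e := Num.min (reach / 4 - `|y - y0|) (eps / (Lip + 1)).
have e0 : 0 < e by rewrite lt_min subr_gt0 hy divr_gt0// ltr_wpDl.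
have [e1 e2] : e <= reach / 4 - `|y - y0| /\ e <= eps / (Lip + 1).
  by split; rewrite /e ge_min lexx ?orbT.
have he : `|y - y0| + e <= 4 * del by lra.
have [g ug gE] := uap_layer_mean hu r0 slabS uM e0 he.
have [X X0 XE] := window_mass e0 y.
exists (fun t => X^-1 * g t + 0); first exact: uap_affine.
move=> t; rewrite addr0.
set v := fine _.
have near y' : `|y' - y| < e -> `|y' - y0| <= reach / 4 /\ `|v - fine (layer t y')| <= eps.
  move=> hy'; have h : `|y' - y0| <= reach / 4.
    have -> : y' - y0 = (y' - y) + (y - y0) by ring.
    by apply: (le_trans (ler_normD _ _)); lra.
  split => //; apply: (le_trans (layer_lipschitz t (ltW hy) h)); rewrite -/Lip.
  apply: (@le_trans _ _ (Lip * (eps / (Lip + 1)))).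
    by apply: ler_wpM2l => //; lra.
  rewrite mulrCA ler_piMr ?(ltW eps0)// ler_pdivrMr ?ltr_wpDl// mul1r; lra.
have up : g t <= X * (v + eps).
  rewrite -lee_fin -gE EFinM; apply: (window_average_le e0 XE (mlayer t) (layer0 t)).
    by rewrite lee_fin addr_ge0 ?fine_ge0// ltW.
  move=> y' /near[h1 h2]; rewrite (layer_fin t h1) lee_fin.
  by move: h2; rewrite ler_distl; lra.
have lo : X * v <= g t + X * eps.
  have mwe : measurable_fun [set: R] (fun y' => (window e y y')%:E).
    by apply/measurable_EFinP; exact: measurableT_comp (measurable_window e) (pair1_measurable y).
  have we0 y' : (0 <= (window e y y')%:E)%E by rewrite lee_fin window_ge0.
  have eps0' : (0 <= eps%:E)%E by rewrite lee_fin ltW.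
  have E : (\int[mu]_y' ((window e y y')%:E * (layer t y' + eps%:E)) = (g t + X * eps)%:E)%E.
    under eq_integral do rewrite ge0_muleDr//.
    rewrite ge0_integralD//.
    - by rewrite gE ge0_integralZr// XE.
    - by move=> y' _; exact: mule_ge0.
    - exact: emeasurable_funM mwe (mlayer t).
    - by move=> y' _; exact: mule_ge0.
    - by apply: emeasurable_funM => //; exact: measurable_cst.
  rewrite -lee_fin -E EFinM; apply: (window_average_ge e0 XE).
  - exact: emeasurable_funD.
  - by rewrite lee_fin fine_ge0.
  move=> y' /near[h1 h2]; rewrite (layer_fin t h1) -EFinD lee_fin.
  by move: h2; rewrite ler_distl; lra.
rewrite ler_distl; apply/andP; split.
  by rewrite lerBlDr -(ler_pM2l X0) mulrDr mulrA mulfV ?gt_eqF// mul1r; lra.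
by rewrite -(ler_pM2l X0) mulrDr mulrA mulfV ?gt_eqF// mul1r; lra.
Qed.

End LayerBounds.

(** * From layers to lines *)

Section Smear.
Context {R : realType}.
Local Notation mu := (@lebesgue_measure R).
Local Notation J f a b := (\int[mu]_(x in `[a, b]) f x).
Variables (f : R -> \bar R) (V w w' : R -> R) (r D : R).
Hypotheses (mf : measurable_fun [set: R] f) (f0 : forall x, (0 <= f x)%E) (r0 : 0 < r).
Hypotheses (bV : bounded_measurable V)
  (VE : forall t, (\int[mu]_x ((window r t x)%:E * f x) = (V t)%:E)%E).
Hypotheses (bw : bounded_measurable w) (w0 : forall t, 0 <= w t)
  (wE : forall x, (\int[mu]_t ((window r t x)%:E * (w t)%:E) = (w' x)%:E)%E).
Hypothesis VwD : forall t, `|V t * w t| <= D.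

Let mw2 : measurable_fun setT (fun z : R * R => (window r z.1 z.2)%:E).
Proof. by apply/measurable_EFinP; exact: measurable_window. Qed.

Let k0 t x : (0 <= (window r t x)%:E)%E. Proof. by rewrite lee_fin window_ge0. Qed.

Let ew0 t : (0 <= (w t)%:E)%E. Proof. by rewrite lee_fin. Qed.

Let kw0 t x : (0 <= (window r t x)%:E * (w t)%:E)%E. Proof. exact: mule_ge0. Qed.

Let mw : measurable_fun [set: R] w. Proof. by case: bw. Qed.

Let G (T : R) (z : R * R) : \bar R :=
  ((\1_`[(- T)%R, T]%classic z.1)%:E * (w z.1)%:E * ((window r z.1 z.2)%:E * f z.2))%E.

Let I (T x : R) : \bar R := (\int[mu]_(t in `[(- T)%R, T]) ((window r t x)%:E * (w t)%:E))%E.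

Let mkw x : measurable_fun [set: R] (fun t => (window r t x)%:E * (w t)%:E)%E.
Proof.
apply: emeasurable_funM; last exact/measurable_EFinP.
exact: measurableT_comp mw2 (pair2_measurable x).
Qed.

Let I_le T x : (I T x <= (w' x)%:E)%E.
Proof.
rewrite /I -wE; apply: ge0_subset_integral => //.
exact: mkw.
Qed.

Let I_full T x : `|x| <= T -> I (T + r) x = (w' x)%:E.
Proof.
move=> xT; rewrite /I -wE; apply/esym; apply: integral_support => // t _ nt.
rewrite (window_out r0) ?mul0e// leNgt; apply/negP => h; apply: nt.
rewrite /= in_itv/= -ler_norml.
have -> : t = x - (x - t) by ring.
by apply: (le_trans (ler_normB _ _)); rewrite lerD// ltW.
Qed.

Let I_out T x : T < `|x| -> I (T - r) x = 0%E.
Proof.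
move=> xT; rewrite /I; apply: integral0_eq => t /=; rewrite in_itv/= -ler_norml => tT.
rewrite (window_out r0) ?mul0e//.
have : `|x| <= `|x - t| + `|t| by rewrite -{1}(subrK t x) ler_normD.
by lra.
Qed.

Let w'0 x : (0 <= (w' x)%:E)%E.
Proof. by rewrite -wE; apply: integral_ge0 => t _; exact: kw0. Qed.

Let I0 T x : (0 <= I T x)%E.
Proof. by apply: integral_ge0 => t _; exact: kw0. Qed.

Let mG T : measurable_fun setT (G T).
Proof.
apply: emeasurable_funM.
  apply: emeasurable_funM; apply/measurable_EFinP; last exact: measurableT_comp.
  have m1 : measurable_fun setT (\1_`[(- T)%R, T]%classic : R -> R) by exact: measurable_indic.
  exact: measurableT_comp.
by apply: emeasurable_funM => //; exact: measurableT_comp.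
Qed.

Let G0 T z : (0 <= G T z)%E.
Proof. by apply: mule_ge0; apply: mule_ge0 => //; rewrite lee_fin. Qed.

Let mI T : measurable_fun [set: R] (I T).
Proof.
pose H (z : R * R) : \bar R := ((\1_`[(- T)%R, T]%classic z.1)%:E * ((window r z.1 z.2)%:E * (w z.1)%:E))%E.
have mH : measurable_fun setT H.
  apply: emeasurable_funM.
    have m1 : measurable_fun setT (\1_`[(- T)%R, T]%classic : R -> R) by exact: measurable_indic.
    by apply/measurable_EFinP; exact: measurableT_comp.
  by apply: emeasurable_funM => //; apply/measurable_EFinP; exact: measurableT_comp.
have H0 z : (0 <= H z)%E.
  by apply: mule_ge0; [rewrite lee_fin|exact: kw0].
rewrite (_ : I T = fun x => (\int[mu]_t H (t, x))%E).
  exact: (@measurable_fun_fubini_tonelli_G _ _ _ _ R mu H).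
apply/funext => x; rewrite /I integral_mkcond; apply: eq_integral => t _.
by rewrite patchE /H/= indicE; case: ifPn => h; rewrite ?mul1e ?mul0e.
Qed.

Let swap T : (\int[mu]_(t in `[(- T)%R, T]) (V t * w t)%:E = \int[mu]_x (f x * I T x))%E.
Proof.
transitivity (\int[mu]_t \int[mu]_x G T (t, x))%E.
  rewrite integral_mkcond; apply: eq_integral => t _; rewrite patchE.
  have -> : (\int[mu]_x G T (t, x) = (\1_`[(- T)%R, T]%classic t)%:E * (w t)%:E * (V t)%:E)%E.
    rewrite -VE -ge0_integralZl//.
    - apply: emeasurable_funM => //; exact: measurableT_comp mw2 (pair1_measurable t).
    - by move=> x _; apply: mule_ge0.
    - by apply: mule_ge0 => //; rewrite lee_fin.
  by rewrite indicE; case: ifPn => h; rewrite ?mul0e// mul1e -EFinM mulrC.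
rewrite (@fubini_tonelli _ _ _ _ R mu mu (G T))//.
  2: exact: mG.
apply: eq_integral => x _; rewrite /I -ge0_integralZl//; last exact: measurable_funTS (mkw x).
rewrite [RHS]integral_mkcond; apply: eq_integral => t _; rewrite patchE /G/= indicE.
case: ifPn => h; rewrite ?mul0e// mul1e.
by rewrite muleA (muleC _ (f x)); congr (_ * _)%E; rewrite muleC.
Qed.

Let mw' : measurable_fun [set: R] (fun x => (w' x)%:E).
Proof.
rewrite (_ : (fun x => _) = (fun x => \int[mu]_t ((window r t x)%:E * (w t)%:E))%E).
  apply: (@measurable_fun_fubini_tonelli_G _ _ _ _ R mu
    (fun z : R * R => (window r z.1 z.2)%:E * (w z.1)%:E)%E).
    by apply: emeasurable_funM => //; apply/measurable_EFinP; exact: measurableT_comp.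
  by move=> z; exact: kw0.
by apply/funext => x; rewrite wE.
Qed.

Let mfI T : measurable_fun [set: R] (fun x => f x * I T x)%E.
Proof. exact: emeasurable_funM mf (mI T). Qed.

Let mfw' : measurable_fun [set: R] (fun x => f x * (w' x)%:E)%E.
Proof. exact: emeasurable_funM mf mw'. Qed.

Let lower T : (\int[mu]_(t in `[(- (T - r))%R, (T - r)%R]) (V t * w t)%:E <=
  \int[mu]_(x in `[(- T)%R, T]) (f x * (w' x)%:E))%E.
Proof.
rewrite swap (integral_support mu (D := `[(- T)%R, T]%classic))//; last first.
  move=> x _ nx; rewrite I_out ?mule0// ltNge; apply/negP => h; apply: nx.
  by rewrite /= in_itv/= -ler_norml.
apply: ge0_le_integral => //.
- by move=> x _; apply: mule_ge0.
- exact: measurable_funTS (mfI _).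
- exact: measurable_funTS mfw'.
by move=> x _; apply: lee_wpmul2l.
Qed.

Let upper T : (\int[mu]_(x in `[(- T)%R, T]) (f x * (w' x)%:E) <=
  \int[mu]_(t in `[(- (T + r))%R, (T + r)%R]) (V t * w t)%:E)%E.
Proof.
rewrite swap; apply: (@le_trans _ _ (\int[mu]_(x in `[(- T)%R, T]) (f x * I (T + r) x))%E).
  apply: ge0_le_integral => //.
  - by move=> x _; apply: mule_ge0.
  - exact: measurable_funTS mfw'.
  - exact: measurable_funTS (mfI _).
  by move=> x /=; rewrite in_itv/= -ler_norml => xT; rewrite I_full.
apply: ge0_subset_integral => //; first exact: mfI.
by move=> x _; apply: mule_ge0.
Qed.

Let bVw : bounded_measurable (fun t => V t * w t) := bmM bV bw.

Let JE a b : (\int[mu]_(t in `[a, b]) (V t * w t)%:E = (J (fun t => V t * w t) a b)%:E)%E.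
Proof. by rewrite /Rintegral fineK//; apply: integrable_fin_num => //; exact: bm_integrable. Qed.

Lemma smear_fin T : (\int[mu]_(x in `[(- T)%R, T]) (f x * (w' x)%:E) < +oo)%E.
Proof. by apply: (le_lt_trans (upper T)); rewrite JE ltry. Qed.

(** As [f] and [w] are nonnegative and the window has radius [r], the integral of [f w']
    over [[- T, T]] lies between the integrals of [V w] over [[- (T - r), T - r]] and over
    [[- (T + r), T + r]], and these differ by a bounded amount. *)
Lemma smear_mean (L : R) :
  (2 * T)^-1 * J (fun t => V t * w t) (- T) T @[T --> +oo] --> L ->
  (2 * T)^-1 * fine (\int[mu]_(x in `[(- T)%R, T]) (f x * (w' x)%:E))%E @[T --> +oo] --> L.
Proof.
move=> cL.
have D0 : 0 <= D by apply: le_trans (VwD 0).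
have r1 : 0 < r by [].
have close T : r <= T ->
    `|fine (\int[mu]_(x in `[(- T)%R, T]) (f x * (w' x)%:E))%E - J (fun t => V t * w t) (- T) T| <= 2 * r * D.
  move=> rT; have T0 : 0 <= T by lra.
  have fin : (\int[mu]_(x in `[(- T)%R, T]) (f x * (w' x)%:E) =
      (fine (\int[mu]_(x in `[(- T)%R, T]) (f x * (w' x)%:E)))%:E)%E.
    rewrite fineK// ge0_fin_numE ?smear_fin//.
    by apply: integral_ge0 => x _; exact: mule_ge0.
  have := upper T; have := lower T; rewrite fin !JE !lee_fin => lo up.
  exact: (J_squeeze bVw VwD r0 rT lo up).
apply/cvgrPdist_le => eps eps0.
have := cL; move=> /cvgrPdist_le /(_ (eps / 2) ltac:(lra)) h2.
near=> T.
have T0 : 0 < T by near: T; apply: nbhs_pinfty_gt; rewrite num_real.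
have rT : r <= T by near: T; apply: nbhs_pinfty_ge; rewrite num_real.
have e1 : 2 * r * D / eps <= T by near: T; apply: nbhs_pinfty_ge; rewrite num_real.
have e2 : `|L - (2 * T)^-1 * J (fun t => V t * w t) (- T) T| <= eps / 2 by near: T.
have i0 : 0 < (2 * T)^-1 by rewrite invr_gt0 mulr_gt0.
move: (close T rT) e2; move: (fine _) (Rintegral _ _ _) => B A cl e2.
have -> : L - (2 * T)^-1 * B = (L - (2 * T)^-1 * A) - (2 * T)^-1 * (B - A) by ring.
apply: (le_trans (ler_normB _ _)); rewrite (splitr eps); apply: lerD => //.
rewrite normrM (gtr0_norm i0); apply: (le_trans (ler_wpM2l (ltW i0) cl)).
by rewrite mulrC ler_pdivrMr ?mulr_gt0//; move: e1; rewrite ler_pdivrMr//; lra.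
Unshelve. all: by end_near. Qed.

End Smear.

Section CosineSmear.
Context {R : realType}.
Local Notation mu := (@lebesgue_measure R).
Variables (r lam : R) (r0 : 0 < r) (lamr : `|lam| * r < 1).

Let k (s : R) : R := window r 0 s.

Let windowE t x : window r t x = k (x - t).
Proof. by rewrite /k /window subr0. Qed.

Let kN s : k (- s) = k s.
Proof. by rewrite /k /window !subr0 mulNr hatN. Qed.

Let k0 s : 0 <= k s. Proof. exact: window_ge0. Qed.

Let mk : measurable_fun [set: R] k.
Proof.
have h (t : R) : measurable_fun [set: R] (window r t).
  exact: measurableT_comp (measurable_window r) (pair1_measurable t).
exact: h.
Qed.

(** The window is even. Both forms are given because their average removes the sines from
    the addition formulas for the cosine. *)
Lemma window_convolution (h : R -> R) x : measurable_fun [set: R] h -> (forall t, 0 <= h t) ->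
  (\int[mu]_t ((window r t x)%:E * (h t)%:E) = \int[mu]_s ((k s)%:E * (h (x + s)%R)%:E))%E /\
  (\int[mu]_t ((window r t x)%:E * (h t)%:E) = \int[mu]_s ((k s)%:E * (h (x - s)%R)%:E))%E.
Proof.
move=> mh h0.
have mG : measurable_fun [set: R] (fun s => (k s)%:E * (h (x + s))%:E)%E.
  apply: emeasurable_funM; first exact/measurable_EFinP.
  by apply/measurable_EFinP; apply: measurableT_comp => //; exact: measurable_funD.
have G0 s : (0 <= (k s)%:E * (h (x + s))%:E)%E by rewrite -EFinM lee_fin mulr_ge0.
have E : (\int[mu]_t ((window r t x)%:E * (h t)%:E) = \int[mu]_s ((k s)%:E * (h (x + s)%R)%:E))%E.
  rewrite -(ge0_integralDx x (f := fun t => ((window r t x)%:E * (h t)%:E)%E)).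
  - apply: eq_integral => s _; rewrite windowE.
    by rewrite (_ : x - (s + x) = - s) ?kN ?(addrC s)//; ring.
  - apply: emeasurable_funM; last exact/measurable_EFinP.
    by apply/measurable_EFinP; exact: measurableT_comp (measurable_window r) (pair2_measurable x).
  - by move=> s; rewrite -EFinM lee_fin mulr_ge0// window_ge0.
split; first exact: E.
rewrite E; transitivity (\int[mu]_s ((k (- s))%:E * (h (x + - s)%R)%:E))%E.
  exact: esym (ge0_integralNx mG G0).
by apply: eq_integral => s _; rewrite kN.
Qed.

Let mcos (c d : R) : measurable_fun [set: R] (fun s => cos (c * s + d)).
Proof.
apply: (@measurableT_comp _ _ _ _ _ _ (@cos R)).
  by apply: continuous_measurable_fun; exact: continuous_cos.
by apply: measurable_funD => //; exact: measurable_funM.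
Qed.

Let mkcos : measurable_fun [set: R] (fun s => k s * cos (lam * s)).
Proof.
apply: measurable_funM; first exact: mk.
by have := mcos lam 0; under eq_fun do rewrite addr0.
Qed.

Lemma window_integrable t : mu.-integrable setT (EFin \o window r t).
Proof.
have [X X0 XE] := window_mass r0 t; apply/integrableP; split.
  by apply/measurable_EFinP; exact: measurableT_comp (measurable_window r) (pair1_measurable t).
under eq_integral do rewrite /= ger0_norm ?window_ge0//.
by rewrite XE ltry.
Qed.

Let ikcos : mu.-integrable setT (fun s => (k s * cos (lam * s))%:E).
Proof.
apply: le_integrable (window_integrable 0) => //; first exact/measurable_EFinP.
move=> s _ /=; rewrite lee_fin normrM ler_piMr//.
by rewrite ler_norml cos_geN1 cos_le1.
Qed.

(** On the support of the window, [|lam s| < 1 < pi / 2] and the cosine is positive. *)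
Lemma cosine_mass : exists2 ch : R, 0 < ch & (\int[mu]_s (k s * cos (lam * s))%:E = ch%:E)%E.
Proof.
have cpos s : `|s| < r -> 0 < cos (lam * s).
  move=> sr; apply: cos_gt0_pihalf.
  have : `|lam * s| < 1 by rewrite normrM; apply: le_lt_trans lamr; rewrite ler_wpM2l// ltW.
  by have := pihalf_ge1 R; rewrite ltr_norml; lra.
have kc0 s : 0 <= k s * cos (lam * s).
  have [h|h] := leP r `|s|; first by rewrite /k window_out ?subr0// mul0r.
  by rewrite mulr_ge0// ltW// cpos.
have fin := integrable_fin_num measurableT ikcos.
exists (fine (\int[mu]_s (k s * cos (lam * s))%:E)%E); last by rewrite fineK.
have r1 : 0 < r by [].
have pos : (0 < \int[mu]_s (k s * cos (lam * s))%:E)%E.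
  apply: (@integral_gt0 _ _ R mu _ `[(- (r / 2))%R, (r / 2)%R]%classic) => //.
  - exact/measurable_EFinP.
  - have h : (0 < mu `[(- (r / 2))%R, (r / 2)%R]%classic)%E by rewrite itv_measure ?lte_fin; lra.
    exact: h.
  move=> s; rewrite /= in_itv/= -ler_norml => sr'; have sr : `|s| < r by lra.
  rewrite lte_fin mulr_gt0 ?cpos//.
  by apply: window_in => //; rewrite subr0.
by rewrite fine_gt0// pos ltey_eq fin.
Qed.

(** Convolution with an even function multiplies a cosine of frequency [lam] by a
    constant. The summand [1] makes the weight nonnegative. *)
Lemma cosine_smear (X ch th x : R) : (\int[mu]_s (k s)%:E = X%:E)%E ->
  (\int[mu]_s (k s * cos (lam * s))%:E = ch%:E)%E ->
  (\int[mu]_t ((window r t x)%:E * (1 + cos (lam * t + th))%:E) =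
    (X + ch * cos (lam * x + th))%:E)%E.
Proof.
move=> XE chE.
set h := fun t => 1 + cos (lam * t + th).
have mh : measurable_fun [set: R] h by apply: measurable_funD.
have h0 t : 0 <= h t by rewrite /h; have := cos_geN1 (lam * t + th); lra.
have [E1 E2] := window_convolution x mh h0.
set I := (\int[mu]_t _)%E in E1 E2 *.
have mkh (g : R -> R) : measurable_fun [set: R] g -> measurable_fun [set: R] (fun s => (k s)%:E * (h (g s))%:E)%E.
  move=> mg; apply: emeasurable_funM; first exact/measurable_EFinP.
  by apply/measurable_EFinP; exact: measurableT_comp.
have kh0 s y : (0 <= (k s)%:E * (h y)%:E)%E by rewrite -EFinM lee_fin mulr_ge0.
have I0 : (0 <= I)%E.
  by apply: integral_ge0 => t _; rewrite -EFinM lee_fin mulr_ge0// window_ge0.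
have : (I + I = (2 * (X + ch * cos (lam * x + th)))%:E)%E.
  rewrite {1}E1 E2 -ge0_integralD//; last 2 first.
  - by apply: mkh; exact: measurable_funD.
  - by apply: mkh; exact: measurable_funB.
  transitivity (\int[mu]_s (2%:E * (k s)%:E + (2 * cos (lam * x + th))%:E * (k s * cos (lam * s))%:E))%E.
    apply: eq_integral => s _; rewrite -!EFinM -!EFinD; congr EFin; rewrite /h.
    rewrite (_ : lam * (x + s) + th = lam * x + th + lam * s); last by ring.
    rewrite (_ : lam * (x - s) + th = lam * x + th - lam * s); last by ring.
    by rewrite cosD cosB; ring.
  rewrite integralD//; last 2 first.
  - exact: integrableZl (window_integrable 0).
  - exact: integrableZl.
  rewrite !integralZl//; last exact: (window_integrable 0).
  by rewrite XE chE -!EFinM -EFinD; congr EFin; ring.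
clear E1 E2; clearbody I; case: I I0 => [i||]// _; rewrite -EFinD => -[e]; congr EFin; lra.
Qed.

End CosineSmear.

Lemma uap_cst (R : realType) (v : R) : uniformly_almost_periodic (cst v : R -> R).
Proof.
split; first by move=> x; exact: cvg_cst.
move=> t; exists id, (cst v); split => // A.
move=> /uniform_nbhs[E [entE EA]]; exists 0%N => // n _; apply: EA => s _.
exact: entourage_refl.
Qed.

Lemma lim_dist (R : realType) (f g : R -> R) (D : R) :
  cvg (f T @[T --> +oo]) -> cvg (g T @[T --> +oo]) ->
  (forall T, 0 < T -> `|f T - g T| <= D) ->
  `|lim (f T @[T --> +oo]) - lim (g T @[T --> +oo])| <= D.
Proof.
move=> cf cg fgD.
have cfg : `|f T - g T| @[T --> +oo] --> `|lim (f T @[T --> +oo]) - lim (g T @[T --> +oo])|.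
  by apply: cvg_norm; exact: (cvgB cf cg).
rewrite -(cvg_lim _ cfg)//; apply: limr_le; first by apply/cvg_ex; eexists; exact: cfg.
near=> T; apply: fgD; near: T; apply: nbhs_pinfty_gt; rewrite num_real.
Unshelve. all: by end_near. Qed.

Section LineMeans.
Context {R : realType}.
Local Notation mu := (@lebesgue_measure R).
Local Notation J f a b := (\int[mu]_(x in `[a, b]) f x).
Variables (a b : \bar R) (u : R * R -> \bar R) (hu : WAP (strip a b) u).
Variables (y0 del M r lam : R).
Hypotheses (d0 : 0 < del) (r0 : 0 < r) (lamr : `|lam| * r < 1).
Hypothesis slabS : forall x y, `|y - y0| <= 4 * del -> strip a b (x, y).
Hypothesis uM : forall z, `|z.2 - y0| <= 4 * del -> (u z <= M%:E)%E.
Variable C : R.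
Local Notation layer := (layer u y0 del M r).
Local Notation reach := (reach del r).
Hypothesis layerC : forall t y, `|y - y0| <= reach / 4 -> (layer t y <= C%:E)%E.

Let c (th x : R) : R := cos (lam * x + th).

Let bc th : bounded_measurable (c th).
Proof.
split; last by exists 1 => x; rewrite ler_norml cos_geN1 cos_le1.
apply: (@measurableT_comp _ _ _ _ _ _ (@cos R)).
  by apply: continuous_measurable_fun; exact: continuous_cos.
by apply: measurable_funD => //; exact: measurable_funM.
Qed.

Let cosine_period : exists2 p : R, 0 < p & forall th, periodic (c th) p.
Proof.
have [l0|l0] := eqVneq lam 0.
  by exists 1 => // th x; rewrite /c l0 !mul0r.
have pi0 : 0 < 2 * pi :> R by rewrite mulr_gt0// pi_gt0.
exists (2 * pi / `|lam|); first by rewrite divr_gt0// normr_gt0.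
move=> th x; rewrite /c; have [lp|lm] := ltP 0 lam.
  rewrite gtr0_norm// (_ : lam * (x + 2 * pi / lam) + th = lam * x + th + pi *+ 2) ?cosD2pi//.
  by rewrite -mulr_natl; field.
have lm' : lam < 0 by rewrite lt_neqAle l0.
rewrite ltr0_norm// -[LHS]cosD2pi; congr cos.
by rewrite -mulr_natl; field.
Qed.

Let mean_layer (y th : R) : `|y - y0| < reach / 4 ->
  cvg ((2 * T)^-1 * J (fun t => fine (layer t y) * c th t) (- T) T @[T --> +oo]).
Proof.
move=> hy; have [p p0 cp] := cosine_period.
apply: equimean_cvg; last by apply: (layer_equimean hu d0 r0 slabS uM layerC hy (bc th) p0).
by apply: bmM => //; apply: (bounded_measurable_layer hu slabS uM layerC); exact: ltW.
Qed.

Let mean_cosine th : cvg ((2 * T)^-1 * J (c th) (- T) T @[T --> +oo]).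
Proof.
have [p p0 cp] := cosine_period.
apply: equimean_cvg => //.
have := uap_equimean (uap_cst 1) (bc th) p0 (cp th).
by under eq_fun do rewrite /= mul1r.
Qed.

Let line (y x : R) := depth u y0 del M (x, y).

Let mline y : measurable_fun [set: R] (line y).
Proof.
apply: (@measurableT_comp _ _ _ _ _ _ (depth u y0 del M)); first exact: (measurable_depth hu M slabS).
exact: pair2_measurable.
Qed.

Let line0 y x : (0 <= line y x)%E. Proof. exact: depth_ge0. Qed.

Let lineE y x : `|y - y0| <= 4 * del -> u (x, y) = (M%:E - line y x)%E.
Proof.
move=> hy; rewrite /line /depth gapE//.
by case: (u (x, y)) => [v||]//=; rewrite -!EFinB opprB addrC subrK.
Qed.

Section Line.
Variables (y : R) (hy : `|y - y0| < reach / 4).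

Let hy4 : `|y - y0| <= 4 * del.
Proof.
have d1 : 0 < del by []. have ld : reach <= del by rewrite /reach ge_min lexx.
by apply: (le_trans (ltW hy)); lra.
Qed.

Let V t := fine (layer t y).

Let bV : bounded_measurable V.
Proof. by apply: (bounded_measurable_layer hu slabS uM layerC); exact: ltW. Qed.

Let VE t : (\int[mu]_x ((window r t x)%:E * line y x) = (V t)%:E)%E.
Proof. by rewrite /V -(layer_fin uM layerC)//; exact: ltW. Qed.

Let bm1 : bounded_measurable (cst 1 : R -> R) := bm_cst 1.

(** The weight [1] is smeared into the constant mass of the window, so the finiteness of
    the layers bounds the integral of [line y]. *)
Lemma integrable_line T : mu.-integrable `[- T, T] (line y).
Proof.
have [X X0 XE] := window_mass r0 0.
have wE x : (\int[mu]_t ((window r t x)%:E * (cst 1 t)%:E) = (cst X x)%:E)%E.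
  have [-> _] := @window_convolution R r (cst 1) x (measurable_cst _) (fun=> ler01).
  by under eq_integral do rewrite mule1.
have h : (\int[mu]_(x in `[(- T)%R, T]) (line y x * X%:E) < +oo)%E.
  exact: smear_fin (mline y) (line0 y) r0 bV VE bm1 (fun=> ler01) wE T.
apply/integrableP; split; first exact: measurable_funTS (mline y).
under eq_integral do rewrite gee0_abs//.
move: h; rewrite ge0_integralZr//; last 2 first.
- exact: measurable_funTS (mline y).
- by rewrite lee_fin ltW.
by apply: contraTT; rewrite -!leNgt !leye_eq => /eqP ->; rewrite gt0_mulye ?lte_fin.
Qed.

Lemma integrable_subharmonic_line T : mu.-integrable `[- T, T] (fun x => u (x, y)).
Proof.
rewrite (_ : (fun x => _) = (fun x => M%:E - line y x)%E); last by apply/funext => x; exact: lineE.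
apply: integrableB => //; last exact: integrable_line.
by apply: (bm_integrable (- T) T (bm_cst M)).
Qed.

(** The weights [1] and [1 + cos] are smeared into [X] and [X + ch cos]. Subtracting the
    two means isolates that of [line y] against the cosine. *)
Lemma mean_line th (ch : R) : 0 < ch ->
  (\int[mu]_s (window r 0 s * cos (lam * s))%:E = ch%:E)%E ->
  (2 * T)^-1 * J (fun x => fine (u (x, y)) * c th x) (- T) T @[T --> +oo] -->
  M * lim ((2 * T)^-1 * J (c th) (- T) T @[T --> +oo]) -
  ch^-1 * lim ((2 * T)^-1 * J (fun t => V t * c th t) (- T) T @[T --> +oo]).
Proof.
move=> ch0 chE.
have [X X0 XE] := window_mass r0 0.
have [_ [D hD]] := bV.
have D0 : 0 <= D by apply: le_trans (hD 0).
have w1E x : (\int[mu]_t ((window r t x)%:E * (cst 1 t)%:E) = (cst X x)%:E)%E.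
  have [-> _] := @window_convolution R r (cst 1) x (measurable_cst _) (fun=> ler01).
  by under eq_integral do rewrite mule1.
pose w2 t := 1 + c th t.
have bw2 : bounded_measurable w2 by exact: bmD.
have w20 t : 0 <= w2 t by rewrite /w2 /c; have := cos_geN1 (lam * t + th); lra.
have w2E x : (\int[mu]_t ((window r t x)%:E * (w2 t)%:E) = (X + ch * c th x)%:E)%E.
  exact: (cosine_smear r0 th x XE chE).
have D1 t : `|V t * cst 1 t| <= D by rewrite mulr1.
have D2 t : `|V t * w2 t| <= D * 2.
  rewrite normrM ler_pM// ger0_norm// /w2 /c.
  by have := cos_le1 (lam * t + th); lra.
have cA := @mean_layer y th hy.
set A := lim _ in cA *.
have cA0 : cvg ((2 * T)^-1 * J (fun t => V t * cst 1 t) (- T) T @[T --> +oo]).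
  apply: equimean_cvg; first exact: bmM.
  by apply: (layer_equimean hu d0 r0 slabS uM layerC hy bm1 ltr01).
set A0 := lim _ in cA0.
have cA2 : (2 * T)^-1 * J (fun t => V t * w2 t) (- T) T @[T --> +oo] --> A0 + A.
  rewrite (_ : (fun T => _) = (fun T => (2 * T)^-1 * J (fun t => V t * cst 1 t) (- T) T +
      (2 * T)^-1 * J (fun t => V t * c th t) (- T) T)).
    exact: (cvgD cA0 cA).
  apply/funext => T; rewrite -mulrDr -RintegralD//.
  - by congr (_ * _); apply: eq_Rintegral => t _; rewrite /w2/=; ring.
  - by apply: bm_integrable; exact: bmM.
  - by apply: bm_integrable; exact: bmM.
have s1 := smear_mean (mline y) (line0 y) r0 bV VE bm1 (fun=> ler01) w1E D1 cA0.
have s2 := smear_mean (mline y) (line0 y) r0 bV VE bw2 w20 w2E D2 cA2.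
have ilf T : mu.-integrable `[- T, T] (EFin \o (fun x => fine (line y x))).
  by apply: integrable_fine => //; exact: integrable_line.
have ilc T : mu.-integrable `[- T, T] (EFin \o (fun x => fine (line y x) * c th x)).
  have [mc [B hB]] := bc th.
  apply: (@integrable_weight _ _ R mu _ (measurable_itv `[- T, T]) _ (c th) B (ilf T)) => //.
  exact: measurable_funTS.
have mT T : measurable (`[- T, T]%classic : set R) by exact: measurable_itv.
have Z1 (k : R) T : J (fun x => k * fine (line y x)) (- T) T = k * J (fun x => fine (line y x)) (- T) T.
  by apply: RintegralZl => //; exact: ilf.
have Z2 (k : R) T : J (fun x => k * (fine (line y x) * c th x)) (- T) T =
    k * J (fun x => fine (line y x) * c th x) (- T) T.
  by apply: RintegralZl => //; exact: ilc.
have F1 T : fine (\int[mu]_(x in `[(- T)%R, T]) (line y x * (cst X x)%:E))%E =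
    X * J (fun x => fine (line y x)) (- T) T.
  rewrite integral_fine_weight; [|exact: mT|exact: integrable_line|exact: measurable_cst].
  by rewrite -Z1; apply: eq_Rintegral => x _; exact: mulrC.
have F2 T : fine (\int[mu]_(x in `[(- T)%R, T]) (line y x * (X + ch * c th x)%:E))%E =
    X * J (fun x => fine (line y x)) (- T) T + ch * J (fun x => fine (line y x) * c th x) (- T) T.
  have mX : measurable_fun [set: R] (fun x => X + ch * c th x).
    by apply: measurable_funD => //; apply: measurable_funM => //; have [] := bc th.
  rewrite integral_fine_weight; [|exact: mT|exact: integrable_line|exact: measurable_funTS mX].
  rewrite -Z1 -Z2 -RintegralD//.
  - by apply: eq_Rintegral => x _; ring.
  - by have := @integrableZl _ _ R mu _ (mT T) X _ (ilf T).
  - by have := @integrableZl _ _ R mu _ (mT T) ch _ (ilc T).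
have cf : (2 * T)^-1 * J (fun x => fine (line y x) * c th x) (- T) T @[T --> +oo] --> ch^-1 * A.
  rewrite (_ : (fun T => _) = (fun T => ch^-1 *
    ((2 * T)^-1 * fine (\int[mu]_(x in `[(- T)%R, T]) (line y x * (X + ch * c th x)%:E))%E -
     (2 * T)^-1 * fine (\int[mu]_(x in `[(- T)%R, T]) (line y x * (cst X x)%:E))%E))).
    rewrite (_ : ch^-1 * A = ch^-1 * ((A0 + A) - A0)); last by rewrite addrAC subrr add0r.
    by apply: cvgMr; exact: cvgB.
  apply/funext => T; rewrite F1 F2; move: ((2 * T)^-1) => i.
  by field; rewrite gt_eqF.
rewrite (_ : (fun T => _) = (fun T => M * ((2 * T)^-1 * J (c th) (- T) T) -
   (2 * T)^-1 * J (fun x => fine (line y x) * c th x) (- T) T)).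
  have cM : M * ((2 * T)^-1 * J (c th) (- T) T) @[T --> +oo] -->
      M * lim ((2 * T)^-1 * J (c th) (- T) T @[T --> +oo]).
    by apply: cvgMr; exact: mean_cosine.
  exact: (cvgB cM cf).
apply/funext => T; rewrite mulrCA -mulrBr; congr (_ * _).
rewrite -RintegralZl//; last exact: bm_integrable.
rewrite -RintegralB//; last first.
  by have := @integrableZl _ _ R mu _ (mT T) M _ (bm_integrable (- T) T (bc th)).
have [mc _] := bc th.
apply: Rintegral_fine_gap.
- exact: mT.
- by move=> x _; exact: lineE.
- exact: integrable_subharmonic_line.
- exact: integrable_line.
- exact: measurable_funTS mc.
Qed.

End Line.

Lemma mean_layer_lipschitz th y y' : `|y - y0| < reach / 4 -> `|y' - y0| < reach / 4 ->
  `|lim ((2 * T)^-1 * J (fun t => fine (layer t y) * c th t) (- T) T @[T --> +oo]) -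
    lim ((2 * T)^-1 * J (fun t => fine (layer t y') * c th t) (- T) T @[T --> +oo])| <=
  3 / 2 * C / reach * `|y' - y|.
Proof.
move=> hy hy'.
have bm z : `|z - y0| < reach / 4 -> bounded_measurable (fun t => fine (layer t z) * c th t).
  by move=> hz; apply: bmM => //; apply: (bounded_measurable_layer hu slabS uM layerC); exact: ltW.
have dist t : `|fine (layer t y) * c th t - fine (layer t y') * c th t| <=
    3 / 2 * C / reach * `|y' - y|.
  rewrite -mulrBl normrM; apply: (@le_trans _ _ `|fine (layer t y) - fine (layer t y')|).
    by rewrite ler_piMr// ler_norml cos_geN1 cos_le1.
  by apply: (layer_lipschitz hu d0 r0 slabS uM layerC); exact: ltW.
have key T : 0 < T -> `|(2 * T)^-1 * J (fun t => fine (layer t y) * c th t) (- T) T -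
    (2 * T)^-1 * J (fun t => fine (layer t y') * c th t) (- T) T| <= 3 / 2 * C / reach * `|y' - y|.
  move=> T0; have i0 : 0 < (2 * T)^-1 by rewrite invr_gt0 mulr_gt0.
  rewrite -mulrBr normrM (gtr0_norm i0) ler_pdivrMl ?mulr_gt0//.
  have TT : - T <= T by lra.
  apply: (le_trans (J_dist (bm y hy) (bm y' hy') TT dist)).
  have E : T - - T = 2 * T by ring.
  by rewrite E [leLHS]mulrC; exact: lexx.
exact: lim_dist (@mean_layer y th hy) (@mean_layer y' th hy') key.
Qed.

End LineMeans.

(** * Fourier-Bohr coefficients *)

Section Complex.
Context {R : realType}.

Lemma cvg_complex (T : Type) (F : set_system T) {FF : Filter F} (p q : T -> R) (p0 q0 : R) :
  p x @[x --> F] --> p0 -> q x @[x --> F] --> q0 ->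
  ((p x +i* q x)%C : R[i]^o) @[x --> F] --> ((p0 +i* q0)%C : R[i]^o).
Proof.
move=> /cvgrPdist_lt cp /cvgrPdist_lt cq; apply/cvgrPdist_lt => eps.
case: eps => e e'; rewrite ltcE/= => /andP[/eqP -> e0].
have e20 : 0 < e / 2 by rewrite divr_gt0.
have := cp _ e20; have := cq _ e20; apply: filterS2 => x hq hp.
rewrite [X in `|X|](_ : _ = ((p0 - p x) +i* (q0 - q x))%C)//.
rewrite normc_def ltcR/=.
apply: (@le_lt_trans _ _ (`|p0 - p x| + `|q0 - q x|)); last by lra.
rewrite -[leRHS]ger0_norm ?addr_ge0// -sqrtr_sqr ler_wsqrtr// [leRHS]sqrrD !real_normK ?num_real//.
by rewrite lerD2r lerDl mulrn_wge0// mulr_ge0.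
Qed.

End Complex.

Section LocalMeans.
Context {R : realType}.
Local Notation mu := (@lebesgue_measure R).
Local Notation J f a b := (\int[mu]_(x in `[a, b]) f x).
Variables (a b : \bar R) (u : R * R -> \bar R) (hu : WAP (strip a b) u) (lam : R).

(** A cosine of arbitrary phase [th] stands for both parts of the exponential: the phases
    [0] and [pi / 2] give the real and the imaginary part. *)
Lemma local_means (y0 : R) : strip a b (0, y0) -> exists e D : R, exists P : R -> R -> R,
  [/\ 0 < e,
      forall y, `|y - y0| < e -> forall T, mu.-integrable `[- T, T] (fun x => u (x, y)),
      forall th y, `|y - y0| < e ->
        (2 * T)^-1 * J (fun x => fine (u (x, y)) * cos (lam * x + th)) (- T) T @[T --> +oo] --> P th y
    & forall th y y', `|y - y0| < e -> `|y' - y0| < e -> `|P th y - P th y'| <= D * `|y' - y|].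
Proof.
move=> sy0; have [s s0 hs] := strip_room sy0.
pose del := s / 8; have d0 : 0 < del by rewrite divr_gt0.
have slab8 x y : `|y - y0| <= 8 * del -> strip a b (x, y).
  by move=> h; apply: hs; apply: (le_trans h); rewrite /del mulrC divfK.
have [M uM] := slab_upper_bound hu d0 slab8.
have slabS x y : `|y - y0| <= 4 * del -> strip a b (x, y).
  by move=> h; apply: slab8; apply: (le_trans h); rewrite ler_pM2r// ler_nat.
(* A window narrow enough for [cosine_mass]. *)
pose r := (`|lam| + 1)^-1.
have l1 : 0 < `|lam| + 1 by rewrite ltr_wpDl.
have r0 : 0 < r by rewrite invr_gt0.
have lamr : `|lam| * r < 1 by rewrite ltr_pdivrMr// mul1r ltrDl.
have [C layerC] := layer_bound hu d0 r0 slabS uM.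
have [ch ch0 chE] := cosine_mass r0 lamr.
exists (reach del r / 4), (ch^-1 * (3 / 2 * C / reach del r)), (fun th y =>
  M * lim ((2 * T)^-1 * J (fun x => cos (lam * x + th)) (- T) T @[T --> +oo]) -
  ch^-1 * lim ((2 * T)^-1 * J (fun t => fine (layer u y0 del M r t y) * cos (lam * t + th)) (- T) T @[T --> +oo])).
split.
- by rewrite divr_gt0// reach_gt0.
- by move=> y hy T; exact: (integrable_subharmonic_line hu d0 r0 slabS uM layerC hy).
- by move=> th y hy; exact: (mean_line hu d0 r0 slabS uM layerC hy (th := th) ch0 chE).
move=> th y y' hy hy'; rewrite opprD opprK addrACA subrr add0r (addrC (- _)) -mulrBr.
rewrite normrM gtr0_norm ?invr_gt0// -[leRHS]mulrA ler_pM2l ?invr_gt0// distrC.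
exact: (mean_layer_lipschitz hu lam d0 r0 slabS uM layerC th hy hy').
Qed.

(** By [exp (- i x) = cos x + i cos (x + pi / 2)]. *)
Lemma fourier_meanE (y T : R) : fourier_mean u lam y T =
  (((2 * T)^-1 * J (fun x => fine (u (x, y)) * cos (lam * x + 0)) (- T) T) +i*
   ((2 * T)^-1 * J (fun x => fine (u (x, y)) * cos (lam * x + pi / 2)) (- T) T))%C.
Proof.
rewrite /fourier_mean /complex_integral.
rewrite (_ : \int[mu]_(x in `[- T, T]) complex.Re _ =
    J (fun x => fine (u (x, y)) * cos (lam * x + 0)) (- T) T); last first.
  by apply: eq_Rintegral => x _; rewrite /= mul0r subr0 cosN addr0.
rewrite (_ : \int[mu]_(x in `[- T, T]) complex.Im _ =
    J (fun x => fine (u (x, y)) * cos (lam * x + pi / 2)) (- T) T); last first.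
  by apply: eq_Rintegral => x _; rewrite /= mul0r addr0 sinN cosDpihalf.
by congr (_ +i* _)%C; rewrite /= mul0r ?subr0 ?addr0.
Qed.

End LocalMeans.

Unset Implicit Arguments.
Set Strict Implicit.

Theorem theorem3 (R : realType) (a b : \bar R) (hab : (a < b)%E)
    (u : R * R -> \bar R) (hu : WAP (strip a b) u) (lam : R) :
  (forall y, im_set (strip a b) y -> fourier_bohr_exists u lam y) /\
  {within im_set (strip a b), continuous (fourier_bohr u lam)}.
Proof.
have im y : im_set (strip a b) y -> strip a b (0, y) by move=> [z Sz <-].
have loc y0 : im_set (strip a b) y0 -> exists e D : R, exists P : R -> R -> R,
   [/\ 0 < e,
      forall y, `|y - y0| < e -> forall T, lebesgue_measure.-integrable `[- T, T] (fun x => u (x, y)),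
      forall y, `|y - y0| < e -> fourier_mean u lam y T @[T --> +oo] -->
         ((P 0 y +i* P (pi / 2) y)%C : R[i]^o)
    & forall th y y', `|y - y0| < e -> `|y' - y0| < e -> `|P th y - P th y'| <= D * `|y' - y|].
  move=> /im/(local_means hu lam)[e [D [P [e0 iu Pl PD]]]]; exists e, D, P; split => // y hy.
  under eq_fun do rewrite fourier_meanE.
  by apply: cvg_complex; exact: Pl.
split.
  move=> y0 /loc[e [D [P [e0 iu Pl PD]]]].
  have h : `|y0 - y0| < e by rewrite subrr normr0.
  split; first by move=> T _; exact: iu.
  by apply/cvg_ex; eexists; exact: Pl h.
apply: continuous_in_subspaceT => y0 /set_mem/loc[e [D [P [e0 iu Pl PD]]]].
have FP y : `|y - y0| < e -> fourier_bohr u lam y = (P 0 y +i* P (pi / 2) y)%C.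
  by move=> hy; apply: cvg_lim; [exact: norm_hausdorff|exact: Pl].
have cP th : P th y @[y --> y0] --> P th y0.
  apply/cvgrPdist_le => eps eps0; apply/nbhs_ballP.
  have D1 : 0 < `|D| + 1 by rewrite ltr_wpDl.
  have d0 : 0 < Num.min e (eps / (`|D| + 1)) by rewrite lt_min e0 divr_gt0.
  exists (Num.min e (eps / (`|D| + 1))) => // y; rewrite /ball/= lt_min => /andP[h1 h2].
  have hy : `|y - y0| < e by rewrite distrC.
  have hy0 : `|y0 - y0| < e by rewrite subrr normr0.
  apply: (le_trans (PD th y0 y hy0 hy)); rewrite distrC.
  move: h2; rewrite ltr_pdivlMr// => h2; apply: le_trans (ltW h2).
  have := ler_norm D; have := normr_ge0 (y0 - y); move: `|y0 - y| `|D| => p q p0 Dq.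
  by rewrite mulrC; apply: ler_wpM2l => //; lra.
rewrite /continuous_at FP ?subrr ?normr0//.
apply: cvg_trans (cvg_complex (cP 0) (cP (pi / 2))).
apply: near_eq_cvg; apply/nbhs_ballP; exists e => // y; rewrite /ball/= distrC => hy.
by rewrite FP.
Qed.
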